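(* Let $X(K,U)$ be an Oeljeklaus-Toma manifold, where $K$ is a number field with exactly $s\ge 1$ real embeddings and $2t\ge 2$ non-real complex embeddings. Let $\mathcal{A}(U)$ be the set of isomorphism classes of flat complex line bundles over $X(K,U)$ given by homomorphisms $\rho\in\mathrm{Hom}(U,\mathbb{C}^{*})$. Then for any integer $r$, $$\dim \bigwedge^{r}\mathbb{C}^{2s+2t}=\sum_{E\in\mathcal{A}(U)}\dim H^{r}(X(K,U),E),$$ where $H^{r}(X(K,U),E)$ is the de Rham cohomology with values in the flat bundle $E$.
   Context: OT-manifolds. Let $s,t$ be positive integers and $K$ an extension field of $\mathbb{Q}$ of degree $s+2t$ with embeddings $\sigma_1,\dots,\sigma_{s+2t}$ into $\mathbb{C}$, where $\sigma_1,\dots,\sigma_s$ are real and $\sigma_{s+1},\dots,\sigma_{s+2t}$ are non-real with $\sigma_{s+i}=\overline{\sigma_{s+t+i}}$ for $1\le i\le t$. Let $\mathcal{O}_K$ be the ring of integers, $\mathcal{O}_K^{*}$ its unit group and $\mathcal{O}_K^{*,+}=\{a\in\mathcal{O}_K^{*}:\sigma_i(a)>0 \text{ for } 1\le i\le s\}$. Let $U\subset\mathcal{O}_K^{*,+}$ be a free abelian subgroup of rank $s$ such that $\{(\log\sigma_1(u),\dots,\log\sigma_s(u)):u\in U\}$ is a lattice in $\mathbb{R}^{s}$. With $H=\{z\in\mathbb{C}:\mathrm{Im}\,z>0\}$, the group $U\ltimes\mathcal{O}_K$ acts on $H^{s}\times\mathbb{C}^{t}$ by $(a,b)\cdot(w_1,\dots,w_s,z_1,\dots,z_t)=(\sigma_1(a)w_1+\sigma_1(b),\dots,\sigma_s(a)w_s+\sigma_s(b),\sigma_{s+1}(a)z_1+\sigma_{s+1}(b),\dots,\sigma_{s+t}(a)z_t+\sigma_{s+t}(b))$.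 The quotient $X(K,U)=(U\ltimes\mathcal{O}_K)\backslash(H^{s}\times\mathbb{C}^{t})$ is a compact complex manifold of dimension $s+t$, called an Oeljeklaus-Toma (OT) manifold; its fundamental group is $U\ltimes\mathcal{O}_K$. Flat line bundles. A homomorphism $\rho\in\mathrm{Hom}(U,\mathbb{C}^{*})$ is regarded as a character of $U\ltimes\mathcal{O}_K$ via the projection to $U$, and gives the flat line bundle $E_\rho=(U\ltimes\mathcal{O}_K)\backslash\big((H^{s}\times\mathbb{C}^{t})\times\mathbb{C}\big)$ for the action $\gamma\cdot(x,c)=(\gamma x,\rho(\gamma)c)$. In this way $\mathcal{A}(U)$ is identified with $\mathrm{Hom}(U,\mathbb{C}^{*})$. The sum over the (infinite) set $\mathcal{A}(U)$ means the dimension of the direct sum of the spaces; in particular only finitely many terms are non-zero. *)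

(* Defs.v *)
From HB Require Import structures.
From mathcomp Require Import all_boot all_order all_algebra all_field.
From mathcomp Require Import complex.
From mathcomp Require Import all_classical all_reals all_analysis.
Import Order.TTheory GRing.Theory Num.Theory.
Import numFieldNormedType.Exports.

Set Implicit Arguments.
Unset Strict Implicit.
Unset Printing Implicit Defensive.

Local Open Scope classical_set_scope.
Local Open Scope ring_scope.
Local Open Scope complex_scope.

(* For subspaces B of Z of V, the dimension of Z / B in {0, 1, 2, ..., +oo}:
   the supremum of the sizes of the finite families of elements of Z that are
   linearly independent modulo B.  (MathComp's \dim only covers subspaces of a
   finite-dimensional space.) *)
Definition dim_quot (R : realType) (F : fieldType) (V : lmodType F)
    (Z B : set V) : \bar R :=
  ereal_sup [set n%:R%:E | n in [set n : nat |
    exists b : 'I_n -> V, (forall i, Z (b i)) /\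
      forall c : 'I_n -> F, B (\sum_i c i *: b i) -> forall i, c i = 0]].

Definition lin_span (F : fieldType) (V : lmodType F) (S : set V) : set V :=
  [set x | exists n (c : 'I_n -> F) (b : 'I_n -> V),
     (forall i, S (b i)) /\ x = \sum_i c i *: b i].

Section ExteriorPower.
Variables (F : fieldType) (n k : nat).

(* The k-th tensor power of F^n, in coordinates with respect to the basis
   e_(f 0) (x) ... (x) e_(f (k-1)), f : 'I_k -> 'I_n. *)
Definition tensor_power : lmodType F := {ffun {ffun 'I_k -> 'I_n} -> F^o}.

Definition pure_tensor (v : 'I_k -> 'rV[F]_n) : tensor_power :=
  [ffun f : {ffun 'I_k -> 'I_n} => \prod_i v i 0 (f i)].

(* The exterior power is the quotient of the tensor power by this subspace. *)
Definition alt_relations : set tensor_power :=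
  lin_span [set x | exists v : 'I_k -> 'rV[F]_n,
    (exists i j, i != j /\ v i = v j) /\ x = pure_tensor v].

End ExteriorPower.

Definition dim_exterior (R : realType) (F : fieldType) (n : nat) (r : int) :
    \bar R :=
  match r with
  | Posz k => dim_quot R setT (@alt_relations F n k)
  | Negz _ => 0%:E
  end.

Section NumberField.
Variables (R : realType) (s t : nat) (K : fieldExtType rat).
Implicit Types (sigma : 'I_(s + t + t) -> {rmorphism K -> R[i]}) (U : set K).

(* The degree and the injectivity make sigma the list of all the
   embeddings of K into the complex numbers. *)
Definition embeddings_of_signature sigma : Prop :=
  [/\ \dim {: K}%VS = (s + t + t)%N,
      (forall i j, sigma i =1 sigma j -> i = j),
      (forall i : 'I_(s + t + t), (i < s)%N ->
         forall x, complex.Im (sigma i x) = 0),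
      (forall i : 'I_(s + t + t), (s <= i)%N ->
         exists x, complex.Im (sigma i x) != 0) &
      (forall (j : 'I_t) x, sigma (lshift t (rshift s j)) x =
         conjc (sigma (rshift (s + t) j) x))].

Definition ring_of_integers : set K :=
  [set x | integralOver (intr : int -> K) x].

Definition integer_units : set K :=
  [set x | ring_of_integers x /\
     exists2 y, ring_of_integers y & x * y = 1].

Definition positive_units sigma : set K :=
  [set x | integer_units x /\
     forall i : 'I_s, 0 < sigma (lshift t (lshift t i)) x].

Definition mul_subgroup U : Prop :=
  [/\ U 1, (forall x y, U x -> U y -> U (x * y)) &
      (forall x, U x -> U x^-1)].

Definition free_abelian_of_rank (d : nat) U : Prop :=
  exists2 u : 'I_d -> K, (forall i, U (u i)) &
    forall x, U x -> exists! n : {ffun 'I_d -> int}, x = \prod_i u i ^ n i.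

Definition log_embedding sigma (x : K) : 'rV[R]_s :=
  \row_i ln (complex.Re (sigma (lshift t (lshift t i)) x)).

Definition is_lattice (d : nat) (L : set 'rV[R]_d) : Prop :=
  exists2 b : 'I_d -> 'rV[R]_d, (\matrix_i b i) \in unitmx &
    L = [set \sum_i b i *~ n i | n in [set: 'I_d -> int]].

Definition OT_admissible sigma U : Prop :=
  [/\ U `<=` positive_units sigma, mul_subgroup U, free_abelian_of_rank s U &
      is_lattice (log_embedding sigma @` U)].

(* These characters also index the isomorphism classes of the flat line bundles
   E_rho: a flat isomorphism from E_rho to E_rho' is a nowhere zero constant on
   the connected cover H^s x C^t, and its equivariance forces rho = rho'. *)
Definition characters U : set (U -> R[i]) :=
  [set rho | (forall u, rho u != 0) /\
     forall u v w : U, val w = val u * val v -> rho w = rho u * rho v].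

End NumberField.

Section Smooth.
Variables (R : realType) (V : normedModType R) (W : set V).

(* W is meant to be open. *)
Fixpoint Ck_on (k : nat) (f : V -> R) : Prop :=
  (forall x, W x -> {for x, continuous f}) /\
  if k is k'.+1 then
    forall v, (forall x, W x -> derivable f x v) /\ Ck_on k' ('D_v f)
  else True.

Definition smooth_on (f : V -> R[i]) : Prop :=
  forall k, Ck_on k (fun x => complex.Re (f x)) /\
            Ck_on k (fun x => complex.Im (f x)).

Definition cderive (v : V) (f : V -> R[i]) (x : V) : R[i] :=
  'D_v (fun y => complex.Re (f y)) x +i* 'D_v (fun y => complex.Im (f y)) x.

(* Complex-valued k-forms on W; only the values at points of W matter. *)
Definition dform (k : nat) : lmodType R[i] := V -> ('I_k -> V) -> (R[i])^o.

Definition alternating_multilinear (k : nat) (f : ('I_k -> V) -> R[i]) : Prop :=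
  (forall v i (c : R) x y, f (dfwith v i (c *: x + y)) =
     c%:C * f (dfwith v i x) + f (dfwith v i y)) /\
  (forall v i j, i != j -> v i = v j -> f v = 0).

Definition smooth_form (k : nat) (w : dform k) : Prop :=
  (forall x, W x -> alternating_multilinear (w x)) /\
  (forall v, smooth_on (fun x => w x v)).

Definition exterior_d (k : nat) (w : dform k) : dform k.+1 := fun x v =>
  \sum_(i < k.+1) (-1) ^+ i * cderive (v i) (fun y => w y (v \o lift i)) x.

End Smooth.

Section OTManifold.
Variables (R : realType) (s t : nat) (K : fieldExtType rat).
Variables (sigma : 'I_(s + t + t) -> {rmorphism K -> R[i]}) (U : set K).

(* C^m as a real vector space: row i is (real part, imaginary part) of the
   i-th complex coordinate. *)
Definition ccoord (m : nat) (x : 'M[R]_(m, 2)) (i : 'I_m) : R[i] :=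
  x i 0 +i* x i 1.

Definition of_ccoord (m : nat) (z : 'I_m -> R[i]) : 'M[R]_(m, 2) :=
  \matrix_(i, j) (if j == 0 then complex.Re (z i) else complex.Im (z i)).

(* H^s x C^t *)
Definition OT_cover : set 'M[R]_(s + t, 2) :=
  [set x | forall i : 'I_s, 0 < complex.Im (ccoord x (lshift t i))].

Definition OT_action (a b : K) (x : 'M[R]_(s + t, 2)) : 'M[R]_(s + t, 2) :=
  of_ccoord (fun i => sigma (lshift t i) a * ccoord x i + sigma (lshift t i) b).

(* The differential of OT_action a b at any point. *)
Definition OT_tangent (a : K) (v : 'M[R]_(s + t, 2)) : 'M[R]_(s + t, 2) :=
  of_ccoord (fun i => sigma (lshift t i) a * ccoord v i).

(* Smooth k-forms on X(K, U) with values in the flat line bundle E_rho.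
   Since X(K, U) and E_rho are the quotients of H^s x C^t and of
   (H^s x C^t) x C by the action gamma (x, c) = (gamma x, rho(gamma) c),
   such a form is a form w on H^s x C^t with
   w_(gamma x) (dgamma v_1, ..., dgamma v_k) = rho(gamma) w_x (v_1, ..., v_k)
   for all gamma = (a, b); the flat connection is then the usual d. *)
Definition bundle_form (rho : U -> R[i]) (k : nat) :
    set (dform 'M[R]_(s + t, 2) k) :=
  [set w | smooth_form OT_cover w /\
     forall (a : U) (b : K), ring_of_integers b ->
     forall x, OT_cover x -> forall v,
       w (OT_action (val a) b x) (fun i => OT_tangent (val a) (v i)) =
       rho a * w x v].

Definition eq_on_cover (k : nat) (w1 w2 : dform 'M[R]_(s + t, 2) k) : Prop :=
  forall x, OT_cover x -> w1 x = w2 x.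

Definition closed_form (rho : U -> R[i]) (k : nat) :
    set (dform 'M[R]_(s + t, 2) k) :=
  [set w | bundle_form rho w /\ eq_on_cover (exterior_d w) 0].

Definition exact_form (rho : U -> R[i]) (k : nat) :
    set (dform 'M[R]_(s + t, 2) k) :=
  match k with
  | 0 => [set w | eq_on_cover w 0]
  | k'.+1 => [set w | exists2 e : dform 'M[R]_(s + t, 2) k',
                bundle_form rho e & eq_on_cover w (exterior_d e)]
  end.

Definition dim_cohomology (rho : U -> R[i]) (r : int) : \bar R :=
  match r with
  | Posz k => dim_quot R (@closed_form rho k) (@exact_form rho k)
  | Negz _ => 0%:E
  end.

End OTManifold.

(* Main.v *)
Require Import Defs.
From HB Require Import structures.
From mathcomp Require Import all_boot all_order all_algebra all_fingroup all_field.
From mathcomp Require Import complex.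
From mathcomp Require Import all_classical all_reals all_analysis.
From mathcomp Require Import ring lra zify.
Import Order.TTheory GRing.Theory Num.Theory.
Import numFieldNormedType.Exports.
Set Implicit Arguments.
Unset Strict Implicit.
Unset Printing Implicit Defensive.
Local Open Scope classical_set_scope.
Local Open Scope ring_scope.

(** On H^s x C^t use the coordinates x_i = Re w_i, c_i = log Im w_i (i <= s) and
    z_k (k <= t).  A form is then a family of smooth functions a_T, T a set of
    covectors among dx_i, dc_i, dz_k, d\bar z_k; O_K acts by translations in the
    vertical directions (x, z), and a unit u acts by an affine map that scales
    the covector product of T by a character chi_T of U.  Claim: H^k(E_rho) has
    as basis the constant forms of the T with |T| = k and chi_T = rho.  Since
    every chi_T is a character of U, summing over rho counts all T of size k,
    which is binom(2s+2t, k).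

    For the claim, an O_K-invariant closed form is cohomologous to its average
    over the vertical directions, via integrals along the lines spanned by a
    lattice of algebraic integers.  The homotopy is not U-equivariant; it is made
    so by averaging over U with a partition of unity in c, which costs an error
    of higher degree in the dc_i, so that one can induct on that degree.  Forms
    that are invariant under vertical translations split according to chi_T.  If
    chi_T(u) <> rho(u), the flow in the direction log u moves the form by a factor
    different from 1, so it is exact; if chi_T = rho the coefficients are
    periodic in c and can be averaged to constants.  Averaging kills exact forms
    and fixes constants, which gives independence. *)

(** * Smooth functions on open sets *)

(** Smoothness is given only through iterated directional derivatives, so linearity in the
    direction, the symmetry of second derivatives and the chain rule are derived from the mean value
    theorem along lines. The logarithms c_i turn the cover into a whole vector space and make a unit
    act on c by a translation; dc_i then has weight 1, and all means run along straight lines. A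
    unit preserves the lattice of integers but not a chosen list of vectors in it. The iterated mean
    does not depend on the list and so commutes with units; its homotopy, built by contraction with
    e and the integral of t f(x + t e) over 0 <= t <= 1, does depend on it. This is the obstacle
    behind the second averaging. The partition of unity uses the coordinates of c in the basis of
    logarithms of generators of U: the j-th generator raises the j-th coordinate by 1 and fixes the
    others, so the generators are treated one at a time. The bumps vary only with c, which is why
    each error term contains a further dc_i. The splitting by chi_T is compatible with d because d
    adds only covectors dc_i to a vertically invariant form. *)

Section RealSmooth.
Variables (R : realType) (V : normedModType R).
Implicit Types (W : set V) (f g : V -> R) (k : nat).

Definition sm W f : Prop := forall k, Ck_on W k f.

Lemma Ck_on_pred W k f : Ck_on W k.+1 f -> Ck_on W k f.
Proof.
elim: k f => [|k IH] f [fc fd]; first by split.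
by split=> // v; have [dv dk] := fd v; split=> //; exact: IH.
Qed.

(** Only the germ of a function enters its continuity and its derivatives. This is what makes a
    locally finite sum smooth. *)
Lemma Ck_on_local W k f :
  (forall x, W x -> exists W' g,
    [/\ nbhs x W', open W', (forall y, W' y -> f y = g y) & Ck_on W' k g]) ->
  Ck_on W k f.
Proof.
elim: k f => [|k IH] f H.
  split=> // x /H[W' [g [nx oW fg [gc _]]]].
  have nfg : {near x, g =1 f} by apply: filterS nx => y /fg.
  rewrite /prop_for /continuous_at (fg x (nbhs_singleton nx)).
  by apply: cvg_trans (near_eq_cvg nfg) (gc _ (nbhs_singleton nx)).
split.
  move=> x /H[W' [g [nx oW fg [gc _]]]].
  have nfg : {near x, g =1 f} by apply: filterS nx => y /fg.
  rewrite /prop_for /continuous_at (fg x (nbhs_singleton nx)).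
  by apply: cvg_trans (near_eq_cvg nfg) (gc _ (nbhs_singleton nx)).
move=> v; split.
  move=> x /H[W' [g [nx oW fg [_ gd]]]].
  apply: near_eq_derivable (proj1 (gd v) x (nbhs_singleton nx)).
  by apply: filterS nx => y /fg.
apply: IH => x /H[W' [g [nx oW fg [_ gd]]]].
exists W', ('D_v g); split=> //; last exact: (proj2 (gd v)).
move=> y Wy; apply: near_eq_derive.
by apply: filterS (open_nbhs_nbhs (conj oW Wy)) => z /fg.
Qed.

Lemma Ck_on_ext W k f g : open W -> (forall x, W x -> f x = g x) ->
  Ck_on W k g -> Ck_on W k f.
Proof.
move=> oW fg gk; apply: Ck_on_local => x Wx; exists W, g; split=> //.
exact: open_nbhs_nbhs.
Qed.

Lemma sm_ext W f g : open W -> (forall x, W x -> f x = g x) ->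
  sm W g -> sm W f.
Proof. by move=> oW fg sg k; exact: Ck_on_ext oW fg (sg k). Qed.

Lemma smP W f : sm W f <-> (forall x, W x -> {for x, continuous f}) /\
  forall v, (forall x, W x -> derivable f x v) /\ sm W ('D_v f).
Proof.
split=> [sf|[fc fd] [|k]]; last 2 first.
- by split.
- by split=> // v; have [? ?] := fd v; split.
split; first by have [] := sf 0%N.
move=> v; split; first by have [_ /(_ v)[]] := sf 1%N.
by move=> k; have [_ /(_ v)[]] := sf k.+1.
Qed.

Lemma sm_cont W f x : sm W f -> W x -> {for x, continuous f}.
Proof. by move=> /smP[fc _] /fc. Qed.

Lemma sm_derivable W f x v : sm W f -> W x -> derivable f x v.
Proof. by move=> /smP[_ /(_ v)[fd _]] /fd. Qed.

Lemma sm_derive W f v : sm W f -> sm W ('D_v f).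
Proof. by move=> /smP[_ /(_ v)[_ ?]]. Qed.

Lemma sm_local W f :
  (forall x, W x -> exists W' g,
    [/\ nbhs x W', open W', (forall y, W' y -> f y = g y) & sm W' g]) ->
  sm W f.
Proof.
move=> H k; apply: Ck_on_local => x /H[W' [g [? ? ? sg]]].
by exists W', g; split.
Qed.

(** Spares an induction on the order of differentiability whenever a family, such as the composites
    with an affine map or the integrals along a line, is visibly stable under derivation. *)
Lemma sm_coind W (P : (V -> R) -> Prop) : open W ->
  (forall f, P f -> (forall x, W x -> {for x, continuous f}) /\
     forall v, exists2 g, P g & forall x, W x -> is_derive x v f (g x)) ->
  forall f, P f -> sm W f.
Proof.
move=> oW H f Pf k; elim: k f Pf => [|k IH] f Pf.
  by split=> //; have [] := H f Pf.
have [fc fd] := H f Pf; split=> // v.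
have [g Pg fg] := fd v; split=> [x /fg[]//|].
by apply: Ck_on_ext oW _ (IH g Pg) => x /fg[].
Qed.

Lemma sm_cst W c : open W -> sm W (cst c).
Proof.
move=> oW.
apply: (@sm_coind W (fun f => exists c, f = cst c) oW); last by exists c.
move=> _ [d ->]; split=> [x _|v]; first exact: cvg_cst.
by exists (cst 0); [exists 0|move=> x _; exact: is_derive_cst].
Qed.

Lemma Ck_onD W k f g : open W ->
  Ck_on W k f -> Ck_on W k g -> Ck_on W k (f \+ g).
Proof.
move=> oW; elim: k f g => [|k IH] f g [fc fd] [gc gd].
  by split; last exact: I; move=> x Wx; apply: cvgD; [exact: fc|exact: gc].
split=> [x Wx|v]; first by apply: cvgD; [exact: fc|exact: gc].
have [df kf] := fd v; have [dg kg] := gd v.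
split=> [x Wx|]; first by apply: derivableD; [exact: df|exact: dg].
apply: Ck_on_ext (IH _ _ kf kg) => // x Wx.
by rewrite [LHS]deriveD; [|exact: df|exact: dg].
Qed.

Lemma Ck_onM W k f g : open W ->
  Ck_on W k f -> Ck_on W k g -> Ck_on W k (f \* g).
Proof.
move=> oW; elim: k f g => [|k IH] f g hf hg.
  case: hf => fc _; case: hg => gc _.
  by split; last exact: I; move=> x Wx; apply: cvgM; [exact: fc|exact: gc].
have hf' := Ck_on_pred hf; have hg' := Ck_on_pred hg.
case: hf => fc fd; case: hg => gc gd.
split=> [x Wx|v]; first by apply: cvgM; [exact: fc|exact: gc].
have [df kf] := fd v; have [dg kg] := gd v.
split=> [x Wx|]; first by apply: derivableM; [exact: df|exact: dg].
apply: (Ck_on_ext oW _ (Ck_onD oW (IH _ _ hf' kg) (IH _ _ hg' kf))) => x Wx.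
by rewrite [LHS]deriveM; [|exact: df|exact: dg].
Qed.

Lemma Ck_onV W k f : open W -> (forall x, W x -> f x != 0) ->
  Ck_on W k f -> Ck_on W k (fun x => (f x)^-1).
Proof.
move=> oW f0; elim: k => [|k IH] hf.
  case: hf => fc _; split; last exact: I.
  by move=> x Wx; apply: cvgV; [exact: f0|exact: fc].
have hf' := Ck_on_pred hf; have hV := IH hf'; case: hf => fc fd.
split=> [x Wx|v]; first by apply: cvgV; [exact: f0|exact: fc].
have [df kf] := fd v.
split=> [x Wx|]; first by apply: derivableV; [exact: f0|exact: df].
have h1 := Ck_onM oW (sm_cst (-1) oW k) (Ck_onM oW (Ck_onM oW hV hV) kf).
apply: Ck_on_ext oW _ h1 => x Wx.
rewrite deriveV ?f0//; last exact: df.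
by rewrite /= /GRing.scale /= mulN1r mulNr expr2 invfM.
Qed.

Lemma smD W f g : open W -> sm W f -> sm W g -> sm W (f \+ g).
Proof. by move=> oW sf sg k; exact: Ck_onD. Qed.

Lemma smM W f g : open W -> sm W f -> sm W g -> sm W (f \* g).
Proof. by move=> oW sf sg k; exact: Ck_onM. Qed.

Lemma smV W f : open W -> (forall x, W x -> f x != 0) -> sm W f ->
  sm W (fun x => (f x)^-1).
Proof. by move=> oW f0 sf k; exact: Ck_onV. Qed.

Lemma smN W f : open W -> sm W f -> sm W (fun x => - f x).
Proof.
move=> oW sf; apply: sm_ext (smM oW (sm_cst (-1) oW) sf) => // x _.
by rewrite /= mulN1r.
Qed.

Lemma smB W f g : open W -> sm W f -> sm W g -> sm W (f \- g).
Proof. by move=> oW sf sg; exact: smD (smN oW sg). Qed.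

Lemma sm_sum W (J : Type) (r : seq J) (Q : pred J) (F : J -> V -> R) :
  open W -> (forall j, Q j -> sm W (F j)) ->
  sm W (fun x => \sum_(j <- r | Q j) F j x).
Proof.
move=> oW sF; elim: r => [|j r IH].
  by apply: sm_ext (sm_cst 0 oW) => // x _; rewrite big_nil.
have [Qj|nQj] := boolP (Q j).
  apply: sm_ext (smD oW (sF j Qj) IH) => // x _.
  by rewrite big_cons Qj.
by apply: sm_ext IH => // x _; rewrite big_cons (negbTE nQj).
Qed.

End RealSmooth.

(** Meant for two estimates of one second difference [D] at the scale [k = h * h]: they bound the
    distance between the two mixed derivatives. *)
Lemma dist_of_scaled (R : realFieldType) (D a b k e : R) :
  0 < k -> `|D - k * a| < k * e -> `|D - k * b| < k * e -> `|a - b| < e + e.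
Proof.
move=> k0 X1 X2; rewrite -(ltr_pM2l k0) -[k in X in X < _](gtr0_norm k0) -normrM.
have -> : k * (a - b) = (D - k * b) - (D - k * a) by ring.
by rewrite mulrDr; apply: le_lt_trans (ler_normB _ _) _; exact: ltrD.
Qed.

(** The difference quotients of [f \o g] and of [f] along the two directions coincide term by
    term. *)
Lemma is_derive_affine (R : realType) (V V' : normedModType R) (g : V -> V')
    (f : V' -> R) (x v : V) (v' : V') :
  (forall h : R, g (h *: v + x) = h *: v' + g x) -> derivable f (g x) v' ->
  is_derive x v (f \o g) ('D_v' f (g x)).
Proof.
move=> gE df.
have E : (fun h : R => h^-1 *: (f (h *: v' + g x) - f (g x))) =
  (fun h : R => h^-1 *: ((f \o g \o shift x) (h *: v) - f (g x))).
  by apply/funext => h /=; rewrite gE.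
by split; move: df; rewrite /derivable /derive /= E.
Qed.

Section DirectionalDerivatives.
Variables (R : realType) (V : normedModType R).
Implicit Types (W : set V) (f g : V -> R).

Lemma is_derive_line f (y v : V) (t : R) : derivable f (t *: v + y) v ->
  is_derive t 1 (fun t => f (t *: v + y)) ('D_v f (t *: v + y)).
Proof.
apply: (is_derive_affine (g := fun t : R => t *: v + y)) => h.
by rewrite scalerDl addrA [h *: 1]mulr1.
Qed.

Lemma mvt_line f (y v : V) (h : R) :
  (forall t : R, `|t| <= `|h| -> derivable f (t *: v + y) v) ->
  exists2 c : R, `|c| <= `|h| &
    f (h *: v + y) - f y = h * 'D_v f (c *: v + y).
Proof.
move=> df; pose F (t : R) := f (t *: v + y).
have dF (t : R) : `|t| <= `|h| -> is_derive t 1 F ('D_v f (t *: v + y)).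
  by move=> th; exact/is_derive_line/df.
have F0 : f y = F 0 by rewrite /F scale0r add0r.
have cont (a b : R) : (forall t, a <= t <= b -> `|t| <= `|h|) ->
    {within `[a, b], continuous F}.
  move=> ab; apply: derivable_within_continuous => t /itvP tI.
  by have [] := dF t (ab t _); rewrite ?tI.
have [h0|h0|h0] := ltgtP h 0.
- have ab (t : R) : h <= t <= 0 -> `|t| <= `|h|.
    by move=> /andP[ht t0]; rewrite !ler0_norm ?lerN2// ltW.
  have [|c cI e] := @MVT_segment _ F (fun t => 'D_v f (t *: v + y)) _ _
      (ltW h0) _ (cont _ _ ab).
    by move=> t tI; apply: dF; apply: ab; rewrite !(itvP tI).
  exists c; first by apply: ab; rewrite !(itvP cI).
  by rewrite F0 -opprB -/(F h) e sub0r mulrN opprK mulrC.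
- have ab (t : R) : 0 <= t <= h -> `|t| <= `|h|.
    by move=> /andP[t0 ht]; rewrite !ger0_norm// ltW.
  have [|c cI e] := @MVT_segment _ F (fun t => 'D_v f (t *: v + y)) _ _
      (ltW h0) _ (cont _ _ ab).
    by move=> t tI; apply: dF; apply: ab; rewrite !(itvP tI).
  exists c; first by apply: ab; rewrite !(itvP cI).
  by rewrite F0 -/(F h) e subr0 mulrC.
- exists 0; first by rewrite normr0.
  by rewrite h0 mul0r scale0r add0r subrr.
Qed.

Lemma cont_ball W f x : open W -> W x -> {for x, continuous f} ->
  forall e : R, 0 < e -> exists2 d : R, 0 < d &
    forall y, `|y| < d -> W (y + x) /\ `|f (y + x) - f x| < e.
Proof.
move=> oW Wx fc e e0.
have : \forall y \near x, W y /\ `|f y - f x| < e.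
  near=> y; split.
    by near: y; exact: open_nbhs_nbhs.
  by rewrite distrC; near: y; move/cvgrPdist_lt : fc; exact.
move=> /nbhs_ballP[d d0 H]; exists d => // y yd; apply: H.
by rewrite -ball_normE /= opprD addrCA subrr addr0 normrN.
Unshelve. all: by end_near. Qed.

(** The increment is walked in two legs, along [v] and then along [u]; the mean value theorem on
    each leg and the continuity of both derivatives give the limit. *)
Lemma derive_lin W f x (a : R) (u v : V) : open W -> sm W f -> W x ->
  'D_(a *: u + v) f x = a * 'D_u f x + 'D_v f x.
Proof.
move=> oW sf Wx.
have cu := sm_cont (sm_derive u sf) Wx; have cv := sm_cont (sm_derive v sf) Wx.
apply/cvg_lim => //; apply/cvgrPdist_le => e e0.
(* The two legs contribute errors [|a| * e'] and [e'], which add up to [e]. *)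
pose e' := e / (`|a| + 1).
have a1 : 0 < `|a| + 1 by rewrite ltr_wpDl.
have e'0 : 0 < e' by rewrite divr_gt0.
have [d1 d10 H1] := cont_ball oW Wx cu e'0.
have [d2 d20 H2] := cont_ball oW Wx cv e'0.
pose M := `|a| * `|u| + `|v| + 1.
have M0 : 0 < M by rewrite ltr_wpDl// addr_ge0// mulr_ge0.
pose d := Num.min d1 d2.
have d0 : 0 < d by rewrite lt_min d10 d20.
near=> h.
have h0 : h != 0 by near: h; exact: nbhs_dnbhs_neq.
have hd : `|h| * M < d.
  rewrite -ltr_pdivlMr//; near: h.
  have dM : 0 < d / M by rewrite divr_gt0.
  by apply: (dnbhs0_lt dM).
have small (b c : R) : `|b| <= `|h| * `|a| -> `|c| <= `|h| ->
    `|b *: u + c *: v| < d.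
  move=> bh ch; apply: le_lt_trans hd; apply: le_trans (ler_normD _ _) _.
  rewrite !normrZ /M !mulrDr mulrA; apply: ler_wpDr; first by rewrite mulr1.
  by apply: lerD; apply: ler_wpM2r.
have inW (b c : R) : `|b| <= `|h| * `|a| -> `|c| <= `|h| -> W (b *: u + (c *: v + x)).
  move=> bh ch; have := small b c bh ch; rewrite lt_min => /andP[/H1[+ _] _].
  by rewrite addrA.
have [c1 c1h E1] : exists2 c : R, `|c| <= `|h * a| &
    f ((h * a) *: u + (h *: v + x)) - f (h *: v + x) =
    h * a * 'D_u f (c *: u + (h *: v + x)).
  apply: mvt_line => t th; apply: sm_derivable sf _.
  by apply: inW; rewrite -?normrM.
have [c2 c2h E2] : exists2 c : R, `|c| <= `|h| &
    f (h *: v + x) - f x = h * 'D_v f (c *: v + x).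
  apply: mvt_line => t th; apply: sm_derivable sf _.
  by have := inW 0 t; rewrite scale0r add0r; apply; rewrite ?normr0 ?mulr_ge0.
have -> : h^-1 *: (f (h *: (a *: u + v) + x) - f x) =
    a * 'D_u f (c1 *: u + (h *: v + x)) + 'D_v f (c2 *: v + x).
  have -> : h *: (a *: u + v) + x = (h * a) *: u + (h *: v + x).
    by rewrite scalerDr scalerA addrA.
  rewrite -[f _ in LHS](subrK (f (h *: v + x))) -addrA E1 E2.
  by rewrite /GRing.scale /= -mulrA -mulrDr mulKf.
rewrite normrM in c1h.
have := small c1 h c1h (lexx _); rewrite lt_min => /andP[/H1[_ +] _].
rewrite -addrA => X1.
have := small 0 c2; rewrite scale0r add0r normr0 mulr_ge0// => /(_ isT c2h).
rewrite lt_min => /andP[_ /H2[_ X2]].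
rewrite opprD addrACA -mulrBr; apply: le_trans (ler_normD _ _) _.
have -> : e = `|a| * e' + e'.
  by rewrite -{2}[e']mul1r -mulrDl /e' mulrC mulfVK// gt_eqF.
rewrite normrM; apply: lerD; last by rewrite distrC; exact: ltW.
by apply: ler_wpM2l; [exact: normr_ge0|rewrite distrC; exact: ltW].
Unshelve. all: by end_near. Qed.

(** The mean value theorem is applied along [u] to the increment of [f] in the direction [v], then
    along [v] to ['D_u f]; the mixed derivative is thus met at a point near [x]. *)
Lemma double_difference W f x (u v : V) : open W -> sm W f -> W x ->
  forall e : R, 0 < e -> exists2 d : R, 0 < d & forall h : R, 0 < h < d ->
    `|f (h *: u + (h *: v + x)) - f (h *: u + x) - f (h *: v + x) + f x
      - h * h * 'D_v ('D_u f) x| < h * h * e.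
Proof.
move=> oW sf Wx e e0.
have cuv := sm_cont (sm_derive v (sm_derive u sf)) Wx.
have [d1 d10 H1] := cont_ball oW Wx cuv e0.
pose M := `|u| + `|v| + 1.
have M0 : 0 < M by rewrite ltr_wpDl// addr_ge0.
exists (d1 / M); first by rewrite divr_gt0.
move=> h /andP[h0]; rewrite ltr_pdivlMr// => hM.
have small (b c : R) : `|b| <= h -> `|c| <= h -> `|b *: u + c *: v| < d1.
  move=> bh ch; apply: le_lt_trans hM; apply: le_trans (ler_normD _ _) _.
  rewrite !normrZ /M !mulrDr; apply: ler_wpDr; first by rewrite mulr1 ltW.
  by apply: lerD; apply: ler_wpM2r.
have inW (b c : R) : `|b| <= h -> `|c| <= h -> W (b *: u + (c *: v + x)).
  by move=> bh ch; have [] := H1 _ (small b c bh ch); rewrite addrA.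
have hh : `|h| = h by rewrite gtr0_norm.
have n0 : `|0 : R| <= h by rewrite normr0 ltW.
pose F := (fun y => f (h *: v + y) - f y).
have dF (t : R) : `|t| <= h ->
    is_derive (t *: u + x) u F ('D_u f (h *: v + (t *: u + x)) - 'D_u f (t *: u + x)).
  move=> th; apply: is_deriveB; last first.
    apply: derivableP; apply: sm_derivable sf _.
    by have := inW t 0; rewrite scale0r add0r; apply.
  have Wp : W (h *: v + (t *: u + x)) by rewrite addrCA; apply: inW; rewrite ?hh.
  apply: (is_derive_affine (g := fun y => h *: v + y)); last exact: sm_derivable sf _.
  by move=> k; rewrite addrCA.
have [c ch E] : exists2 c : R, `|c| <= `|h| &
    F (h *: u + x) - F x = h * 'D_u F (c *: u + x).
  by apply: mvt_line => t; rewrite hh => /dF[].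
rewrite hh in ch; move: E; rewrite (@derive_val _ _ _ _ _ _ _ (dF c ch)).
have [c' c'h ->] : exists2 c' : R, `|c'| <= `|h| &
    'D_u f (h *: v + (c *: u + x)) - 'D_u f (c *: u + x) =
     h * 'D_v ('D_u f) (c' *: v + (c *: u + x)).
  apply: (@mvt_line ('D_u f) (c *: u + x) v h) => t; rewrite hh => th.
  apply: (@sm_derivable _ _ W ('D_u f) _ v (sm_derive u sf)).
  by rewrite addrCA; apply: inW.
rewrite /F hh in c'h * => E.
have aux (A B C D X : R) : A - B - (C - D) = X -> A - B - C + D = X.
  by move=> <-; rewrite opprB addrA addrAC.
have -> : f (h *: u + (h *: v + x)) - f (h *: u + x) - f (h *: v + x) + f x =
  h * h * 'D_v ('D_u f) (c *: u + c' *: v + x).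
  rewrite -mulrA (_ : c *: u + c' *: v + x = c' *: v + (c *: u + x)); last first.
    by rewrite -addrA addrCA.
  have <- : h *: v + (h *: u + x) = h *: u + (h *: v + x) by rewrite addrCA.
  exact: aux E.
rewrite -mulrBr normrM ger0_norm ?mulr_ge0 ?ltW//.
rewrite ltr_pM2l ?mulr_gt0//.
by have [] := H1 _ (small c c' ch c'h).
Qed.

(** The second difference is symmetric in [u] and [v], so it approximates both mixed derivatives. *)
Lemma derive_comm W f x (u v : V) : open W -> sm W f -> W x ->
  'D_v ('D_u f) x = 'D_u ('D_v f) x.
Proof.
move=> oW sf Wx; apply/eqP/negPn/negP => ne.
(* Half the supposed distance: the two estimates then bound that distance strictly by itself. *)
pose e := `|'D_v ('D_u f) x - 'D_u ('D_v f) x| / 2.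
have e0 : 0 < e by rewrite divr_gt0// normr_gt0 subr_eq0.
have [d1 d10 H1] := double_difference u v oW sf Wx e0.
have [d2 d20 H2] := double_difference v u oW sf Wx e0.
pose h := Num.min d1 d2 / 2.
have d0 : 0 < Num.min d1 d2 by rewrite lt_min d10 d20.
have h0 : 0 < h by rewrite divr_gt0.
have hd : h < Num.min d1 d2 by rewrite /h ltr_pdivrMr// ltr_pMr// ltr1n.
move: hd; rewrite lt_min => /andP[hd1 hd2].
have ac (A B C D : R) : A - B - C + D = A - C - B + D by rewrite [A - B - C]addrAC.
have := H1 h; rewrite h0 hd1 => /(_ isT) X1.
have := H2 h; rewrite h0 hd2 => /(_ isT) X2.
have E : h *: v + (h *: u + x) = h *: u + (h *: v + x) by rewrite addrCA.
rewrite E ac in X2.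
have := dist_of_scaled (mulr_gt0 h0 h0) X1 X2.
by rewrite /e -splitr ltxx.
Qed.

Lemma derive_sumv W f x (I : Type) (r : seq I) (a : I -> R) (u : I -> V) :
  open W -> sm W f -> W x ->
  'D_(\sum_(i <- r) a i *: u i) f x = \sum_(i <- r) a i * 'D_(u i) f x.
Proof.
move=> oW sf Wx; elim: r => [|i r IH]; first by rewrite !big_nil derive0.
by rewrite !big_cons (derive_lin _ _ _ oW sf Wx) IH.
Qed.

End DirectionalDerivatives.

Section SmoothComposition.
Variable R : realType.

Lemma sm_comp_affine (V V' : normedModType R) (W : set V) (W' : set V')
    (g : V -> V') (L : V -> V') (f : V' -> R) :
  open W -> open W' -> continuous g ->
  (forall (h : R) v x, g (h *: v + x) = h *: L v + g x) ->
  (forall x, W x -> W' (g x)) -> sm W' f -> sm W (f \o g).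
Proof.
move=> oW oW' gc gL gW sf.
apply: (@sm_coind _ _ W (fun F => exists2 f', sm W' f' & F = f' \o g) oW).
  move=> _ [h sh ->]; split.
    move=> x Wx; apply: continuous_comp; first exact: gc.
    exact: sm_cont sh (gW _ Wx).
  move=> v; exists ('D_(L v) h \o g).
    by exists ('D_(L v) h) => //; exact: sm_derive.
  by move=> x Wx; apply: is_derive_affine => //; apply: sm_derivable sh (gW _ Wx).
by exists f.
Qed.

(** The mean value theorem on the segment from [g x] to [g (h *: v + x)] expresses the increment of
    [f] by a derivative in the direction [c h], which [derive_sumv] splits over the matrix
    entries. *)
Lemma is_derive_comp_sm (V : normedModType R) (m n : nat)
    (W : set 'M[R]_(m, n)) (f : 'M[R]_(m, n) -> R) (g : V -> 'M[R]_(m, n))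
    (x v : V) : open W -> sm W f -> W (g x) -> derivable g x v ->
  is_derive x v (f \o g)
    (\sum_(ij : 'I_m * 'I_n)
       'D_v (fun y => g y ij.1 ij.2) x * 'D_(delta_mx ij.1 ij.2) f (g x)).
Proof.
move=> oW sf Wgx dg.
pose c (h : R) : 'M[R]_(m, n) := g (h *: v + x) - g x.
have c0 : c h @[h --> 0^'] --> (0 : 'M[R]_(m, n)).
  have dg1 : differentiable (fun h : R => g (h *: v + x)) 0.
    apply/derivable1_diffP.
    exact: (proj1 (derivable1P g x v) dg).
  have := differentiable_continuous dg1.
  move=> /continuous_withinNx; rewrite scale0r add0r => gc.
  by rewrite -(subrr (g x)); apply: cvgB => //; exact: cvg_cst.
have [d d0 Hd] := cont_ball oW Wgx (sm_cont sf Wgx) ltr01.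
(* When [c h] is not small the segment may leave [W]; the dummy value 0 then keeps [Th] total and
   bounded by 1. *)
have ex (h : R) : exists th : R, `|th| <= 1 /\ (`|c h| < d ->
    f (c h + g x) - f (g x) = 'D_(c h) f (th *: c h + g x)).
  have [ch|ch] := boolP (`|c h| < d); last first.
    by exists 0; split; [rewrite normr0|].
  have [|th th1 E] := @mvt_line _ _ f (g x) (c h) 1.
    move=> t; rewrite normr1 => t1; apply: sm_derivable sf _.
    apply: (proj1 (Hd _ _)); apply: le_lt_trans ch.
    by rewrite normrZ ler_piMl.
  by exists th; split; [rewrite -[X in _ <= X]normr1|move: E; rewrite scale1r mul1r].
have [Th HTh] := choice ex.
have cd : \forall h \near 0^', `|c h| < d.
  by move/cvgr0_norm_lt : c0; exact.
have Tc : Th h *: c h + g x @[h --> 0^'] --> g x.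
  rewrite -[X in _ --> X]add0r; apply: cvgD; last exact: cvg_cst.
  apply/cvgr0Pnorm_lt => e e0.
  near=> h; apply: (@le_lt_trans _ _ `|c h|).
    by rewrite normrZ ler_piMl//; have [] := HTh h.
  by near: h; move/cvgr0Pnorm_lt : c0; exact.
have Q : h^-1 *: ((f \o g \o shift x) (h *: v) - (f \o g) x) @[h --> 0^'] -->
    \sum_(ij : 'I_m * 'I_n)
       'D_v (fun y => g y ij.1 ij.2) x * 'D_(delta_mx ij.1 ij.2) f (g x).
  have NE : {near 0^', (fun h : R => \sum_(ij : 'I_m * 'I_n)
       h^-1 *: ((fun y => g y ij.1 ij.2) (h *: v + x) - (fun y => g y ij.1 ij.2) x)
       * 'D_(delta_mx ij.1 ij.2) f (Th h *: c h + g x)) =1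
     (fun h => h^-1 *: ((f \o g \o shift x) (h *: v) - (f \o g) x))}.
    near=> h.
    have chd : `|c h| < d by near: h.
    have [Th1 /(_ chd)] := HTh h; rewrite {1}/c subrK => E.
    have cE : c h = \sum_(p : 'I_m * 'I_n) c h p.1 p.2 *: delta_mx p.1 p.2.
      by rewrite {1}[c h]matrix_sum_delta pair_big.
    have WT : W (Th h *: c h + g x).
      apply: (proj1 (Hd _ _)); apply: le_lt_trans chd.
      by rewrite normrZ ler_piMl.
    rewrite /= E; move: (Th h *: c h + g x) WT => y Wy.
    rewrite [in RHS]cE (derive_sumv _ _ _ oW sf Wy).
    rewrite scaler_sumr; apply: eq_bigr => -[i j] _ /=.
    by rewrite /c !mxE /GRing.scale /= mulrA.
  apply: cvg_trans (near_eq_cvg NE) _.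
  apply: cvg_big => [|-[i j] _]; first exact: add_continuous.
  apply: cvgM.
    by move: dg => /derivable_mxP /(_ i j).
  exact: (cvg_comp _ _ Tc (sm_cont (sm_derive (delta_mx i j) sf) Wgx)).
by split; [apply/cvg_ex; exists (\sum_(ij : 'I_m * 'I_n)
       'D_v (fun y => g y ij.1 ij.2) x * 'D_(delta_mx ij.1 ij.2) f (g x))
  |exact: cvg_lim Q].
Unshelve. all: by end_near. Qed.

(** The induction on the order is for all [f] at once: a derivative of [f \o g] is a sum of products
    of a derivative of an entry of [g] with a composite of the same kind. *)
Lemma sm_comp (V : normedModType R) (m n : nat) (W : set V)
    (W' : set 'M[R]_(m, n)) (f : 'M[R]_(m, n) -> R) (g : V -> 'M[R]_(m, n)) :
  open W -> open W' -> (forall i j, sm W (fun y => g y i j)) ->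
  (forall x, W x -> W' (g x)) -> sm W' f -> sm W (f \o g).
Proof.
move=> oW oW' sg gW sf k.
have dg x v : W x -> derivable g x v.
  by move=> Wx; apply/derivable_mxP => i j; exact: sm_derivable (sg i j) Wx.
have gc x : W x -> {for x, continuous g}.
  move=> Wx; apply/cvg_ballP => e e0; near=> y.
  split=> //; near: y; apply: filter_forall => i; apply: filter_forall => j.
  by have /cvg_ballP := sm_cont (sg i j) Wx; exact.
have fgc h : sm W' h -> forall x, W x -> {for x, continuous (h \o g)}.
  move=> sh x Wx; apply: continuous_comp; first exact: gc.
  exact: sm_cont sh (gW _ Wx).
elim: k f sf => [|k IH] f sf; first by split; [exact: fgc|].
split; first exact: fgc.
move=> v; have dfg x (Wx : W x) := is_derive_comp_sm oW' sf (gW x Wx) (dg x v Wx).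
split; first by move=> x Wx; have [] := dfg x Wx.
suff H (r : seq ('I_m * 'I_n)) : Ck_on W k (fun x => \sum_(ij <- r)
   'D_v (fun y => g y ij.1 ij.2) x * 'D_(delta_mx ij.1 ij.2) f (g x)).
  by apply: Ck_on_ext (H (index_enum _)) => // x Wx; have [_ ->] := dfg x Wx.
elim: r => [|ij r IHr].
  by apply: Ck_on_ext (sm_cst 0 oW k) => // x _; rewrite big_nil.
apply: Ck_on_ext (Ck_onD oW (Ck_onM oW (sm_derive v (sg ij.1 ij.2) k)
  (IH _ (sm_derive (delta_mx ij.1 ij.2) sf))) IHr) => // x _.
by rewrite big_cons.
Unshelve. all: by end_near. Qed.

End SmoothComposition.

Section ComplexSmooth.
Local Open Scope complex_scope.
Variable R : realType.
Local Notation Re := (@complex.Re R).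
Local Notation Im := (@complex.Im R).

Section OneSpace.
Variables (V : normedModType R).
Implicit Types (W : set V) (f g : V -> R[i]).

Lemma smooth_onP W f :
  smooth_on W f <-> sm W (fun x => Re (f x)) /\ sm W (fun x => Im (f x)).
Proof.
by split=> [H|[H1 H2] k]; split=> // k; have [] := H k.
Qed.

Lemma csm_ext W f g : open W -> (forall x, W x -> f x = g x) ->
  smooth_on W g -> smooth_on W f.
Proof.
by move=> oW fg /smooth_onP[g1 g2]; apply/smooth_onP; split;
   [apply: sm_ext oW _ g1|apply: sm_ext oW _ g2] => x /fg ->.
Qed.

Lemma csm_local W f :
  (forall x, W x -> exists W' g,
    [/\ nbhs x W', open W', (forall y, W' y -> f y = g y) & smooth_on W' g]) ->
  smooth_on W f.
Proof.
move=> H; apply/smooth_onP; split; apply: sm_local => x /H[W' [g [nW oW fg]]].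
- move=> /smooth_onP[g1 _]; exists W', (fun x => Re (g x)).
  by split=> // y /fg ->.
- move=> /smooth_onP[_ g2]; exists W', (fun x => Im (g x)).
  by split=> // y /fg ->.
Qed.

Lemma csm_real W (f : V -> R) : open W -> sm W f -> smooth_on W (fun x => (f x)%:C).
Proof. by move=> oW sf; apply/smooth_onP; split=> //; exact: (sm_cst 0 oW). Qed.

Lemma csm_cst W c : open W -> smooth_on W (fun=> c).
Proof.
by move=> oW; apply/smooth_onP; split; exact: (sm_cst _ oW).
Qed.

Lemma csmD W f g : open W -> smooth_on W f -> smooth_on W g ->
  smooth_on W (fun x => f x + g x).
Proof.
move=> oW /smooth_onP[f1 f2] /smooth_onP[g1 g2]; apply/smooth_onP; split.
- by apply: sm_ext oW _ (smD oW f1 g1) => x _; rewrite raddfD.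
- by apply: sm_ext oW _ (smD oW f2 g2) => x _; rewrite raddfD.
Qed.

Lemma csmM W f g : open W -> smooth_on W f -> smooth_on W g ->
  smooth_on W (fun x => f x * g x).
Proof.
move=> oW /smooth_onP[f1 f2] /smooth_onP[g1 g2]; apply/smooth_onP; split.
- apply: sm_ext oW _ (smB oW (smM oW f1 g1) (smM oW f2 g2)) => x _ /=.
  by case: (f x) => a b; case: (g x).
- apply: sm_ext oW _ (smD oW (smM oW f1 g2) (smM oW f2 g1)) => x _ /=.
  by case: (f x) => a b; case: (g x).
Qed.

Lemma csm_sum W (J : Type) (r : seq J) (Q : pred J) (F : J -> V -> R[i]) :
  open W -> (forall j, Q j -> smooth_on W (F j)) ->
  smooth_on W (fun x => \sum_(j <- r | Q j) F j x).
Proof.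
move=> oW sF; elim: r => [|j r IH].
  by apply: csm_ext (csm_cst 0 oW) => // x _; rewrite big_nil.
have [Qj|nQj] := boolP (Q j).
  by apply: csm_ext (csmD oW (sF j Qj) IH) => // x _; rewrite big_cons Qj.
by apply: csm_ext IH => // x _; rewrite big_cons (negbTE nQj).
Qed.

Lemma csm_cderive W v f : smooth_on W f -> smooth_on W (cderive v f).
Proof.
by move=> /smooth_onP[f1 f2]; apply/smooth_onP; split; exact: sm_derive.
Qed.

Lemma cderive_near v f g x : (\near x, f x = g x) -> cderive v f x = cderive v g x.
Proof.
move=> fg; rewrite /cderive; congr (_ +i* _); apply: near_eq_derive.
- by apply: filterS fg => y ->.
- by apply: filterS fg => y ->.
Qed.

Lemma cderive_open W v f g x : open W -> W x -> (forall y, W y -> f y = g y) ->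
  cderive v f x = cderive v g x.
Proof.
move=> oW Wx fg; apply: cderive_near.
by apply: filterS (open_nbhs_nbhs (conj oW Wx)) => y /fg.
Qed.

Lemma cderive_cst (v : V) (c : R[i]) x : cderive v (fun=> c) x = 0.
Proof. by rewrite /cderive; apply/eqP; rewrite eq_complex /= !derive_cst !eqxx. Qed.

Lemma cderiveD W v f g x : smooth_on W f -> smooth_on W g -> W x ->
  cderive v (fun y => f y + g y) x = cderive v f x + cderive v g x.
Proof.
move=> /smooth_onP[f1 f2] /smooth_onP[g1 g2] Wx.
have d1 := @sm_derivable _ _ _ _ _ v f1 Wx; have d2 := @sm_derivable _ _ _ _ _ v f2 Wx.
have e1 := @sm_derivable _ _ _ _ _ v g1 Wx; have e2 := @sm_derivable _ _ _ _ _ v g2 Wx.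
have E1 : (fun y => Re (f y + g y)) = (fun y => Re (f y)) + (fun y => Re (g y)).
  by apply/funext => y /=; rewrite raddfD.
have E2 : (fun y => Im (f y + g y)) = (fun y => Im (f y)) + (fun y => Im (g y)).
  by apply/funext => y /=; rewrite raddfD.
by rewrite /cderive E1 E2 (deriveD d1 e1) (deriveD d2 e2).
Qed.

Lemma cderiveM W v f g x : smooth_on W f -> smooth_on W g -> W x ->
  cderive v (fun y => f y * g y) x = cderive v f x * g x + f x * cderive v g x.
Proof.
move=> /smooth_onP[f1 f2] /smooth_onP[g1 g2] Wx.
have d1 := @sm_derivable _ _ _ _ _ v f1 Wx; have d2 := @sm_derivable _ _ _ _ _ v f2 Wx.
have e1 := @sm_derivable _ _ _ _ _ v g1 Wx; have e2 := @sm_derivable _ _ _ _ _ v g2 Wx.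
have E1 : (fun y => Re (f y * g y)) = (fun y => Re (f y)) * (fun y => Re (g y)) -
   (fun y => Im (f y)) * (fun y => Im (g y)).
  by apply/funext => y /=; rewrite !fctE; case: (f y) => ? ?; case: (g y).
have E2 : (fun y => Im (f y * g y)) = (fun y => Re (f y)) * (fun y => Im (g y)) +
   (fun y => Im (f y)) * (fun y => Re (g y)).
  by apply/funext => y /=; rewrite !fctE; case: (f y) => ? ?; case: (g y).
rewrite /cderive E1 E2.
rewrite (deriveB (derivableM d1 e1) (derivableM d2 e2)).
rewrite (deriveD (derivableM d1 e2) (derivableM d2 e1)).
rewrite (deriveM d1 e1) (deriveM d2 e2) (deriveM d1 e2) (deriveM d2 e1).
move: ('D_v _ x) ('D_v _ x) ('D_v _ x) ('D_v _ x) => a b c d.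
rewrite /GRing.scale /=; apply/eqP; rewrite eq_complex.
case: (f x) => p q; case: (g x) => r s /=.
by apply/andP; split; apply/eqP; ring.
Qed.

Lemma cderiveZ W v c f x : open W -> smooth_on W f -> W x ->
  cderive v (fun y => c * f y) x = c * cderive v f x.
Proof.
move=> oW sf Wx; rewrite (cderiveM v (csm_cst c oW) sf Wx).
by rewrite cderive_cst mul0r add0r.
Qed.

Lemma cderive_sum W v (J : Type) (r : seq J) (Q : pred J) (F : J -> V -> R[i]) x :
  open W -> (forall j, Q j -> smooth_on W (F j)) -> W x ->
  cderive v (fun x => \sum_(j <- r | Q j) F j x) x =
  \sum_(j <- r | Q j) cderive v (F j) x.
Proof.
move=> oW sF Wx; elim: r => [|j r IH].
  rewrite big_nil; transitivity (@cderive R V v (fun=> 0) x); last exact: cderive_cst.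
  by apply: cderive_open Wx _ => // y _; rewrite big_nil.
rewrite big_cons; have [Qj|nQj] := boolP (Q j).
  rewrite -IH -(cderiveD v (sF j Qj) (csm_sum r oW sF) Wx).
  by apply: cderive_open Wx _ => // y _; rewrite big_cons Qj.
by rewrite -IH; apply: cderive_open Wx _ => // y _; rewrite big_cons (negbTE nQj).
Qed.

Lemma cderive_comm W u v f x : open W -> smooth_on W f -> W x ->
  cderive v (cderive u f) x = cderive u (cderive v f) x.
Proof.
move=> oW /smooth_onP[f1 f2] Wx; rewrite /cderive /=.
by rewrite (derive_comm _ _ oW f1 Wx) (derive_comm _ _ oW f2 Wx).
Qed.

Lemma cderive_sumv W f x (I : Type) (r : seq I) (a : I -> R) (u : I -> V) :
  open W -> smooth_on W f -> W x ->
  cderive (\sum_(i <- r) a i *: u i) f x = \sum_(i <- r) (a i)%:C * cderive (u i) f x.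
Proof.
move=> oW /smooth_onP[f1 f2] Wx; rewrite /cderive.
rewrite !(derive_sumv _ _ _ oW _ Wx)//.
apply/eqP; rewrite eq_complex !raddf_sum /=; apply/andP; split; apply/eqP.
- by apply: eq_bigr => i _; rewrite mul0r subr0.
- by apply: eq_bigr => i _; rewrite mul0r addr0.
Qed.

End OneSpace.

Lemma csm_comp_affine (V V' : normedModType R) (W : set V) (W' : set V')
    (g : V -> V') (L : V -> V') (f : V' -> R[i]) :
  open W -> open W' -> continuous g ->
  (forall (h : R) v x, g (h *: v + x) = h *: L v + g x) ->
  (forall x, W x -> W' (g x)) -> smooth_on W' f -> smooth_on W (f \o g).
Proof.
move=> oW oW' gc gL gW /smooth_onP[f1 f2]; apply/smooth_onP.
by split; [exact: sm_comp_affine oW oW' gc gL gW f1|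
  exact: sm_comp_affine oW oW' gc gL gW f2].
Qed.

Lemma cderive_affine (V V' : normedModType R) (W' : set V')
    (g : V -> V') (v : V) (v' : V') (f : V' -> R[i]) x :
  (forall (h : R), g (h *: v + x) = h *: v' + g x) ->
  smooth_on W' f -> W' (g x) ->
  cderive v (f \o g) x = cderive v' f (g x).
Proof.
move=> gL /smooth_onP[f1 f2] Wgx; rewrite /cderive.
have [_ <-] := is_derive_affine gL (@sm_derivable _ _ _ _ _ v' f1 Wgx).
by have [_ <-] := is_derive_affine gL (@sm_derivable _ _ _ _ _ v' f2 Wgx).
Qed.

Lemma csm_comp (V : normedModType R) (m n : nat) (W : set V)
    (W' : set 'M[R]_(m, n)) (f : 'M[R]_(m, n) -> R[i]) (g : V -> 'M[R]_(m, n)) :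
  open W -> open W' -> (forall i j, sm W (fun y => g y i j)) ->
  (forall x, W x -> W' (g x)) -> smooth_on W' f -> smooth_on W (f \o g).
Proof.
move=> oW oW' sg gW /smooth_onP[f1 f2]; apply/smooth_onP.
by split; [exact: sm_comp oW oW' sg gW f1|exact: sm_comp oW oW' sg gW f2].
Qed.

Lemma cderive_comp (V : normedModType R) (m n : nat)
    (W : set 'M[R]_(m, n)) (f : 'M[R]_(m, n) -> R[i]) (g : V -> 'M[R]_(m, n))
    (x v : V) : open W -> smooth_on W f -> W (g x) -> derivable g x v ->
  cderive v (f \o g) x =
    \sum_(ij : 'I_m * 'I_n)
       ('D_v (fun y => g y ij.1 ij.2) x)%:C * cderive (delta_mx ij.1 ij.2) f (g x).
Proof.
move=> oW /smooth_onP[f1 f2] Wgx dg; rewrite /cderive.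
have [_ ->] := is_derive_comp_sm oW f1 Wgx dg.
have [_ ->] := is_derive_comp_sm oW f2 Wgx dg.
apply/eqP; rewrite eq_complex !raddf_sum /=; apply/andP; split; apply/eqP.
- by apply: eq_bigr => i _; rewrite mul0r subr0.
- by apply: eq_bigr => i _; rewrite mul0r addr0.
Qed.

End ComplexSmooth.

(** * Integrals along lines *)

Section LineIntegral.
Local Open Scope complex_scope.
Variables (R : realType) (V : normedModType R).
Implicit Types (f g : V -> R) (e v x : V) (w : R -> R).
Local Notation mu := (@lebesgue_measure R).

(** The weights 1 and t are the ones of interest: the first gives the average over a period, the
    second the homotopy from the identity to that average. The bound by 1 lets uniform estimates
    pass through the integral unchanged. *)
Definition weight w := continuous w /\ forall t : R, 0 <= t <= 1 -> `|w t| <= 1.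

Definition lint w e f x : R := \int[mu]_(t in `[0, 1]) (w t * f (t *: e + x)).

Lemma weight1 : weight (fun=> 1).
Proof. by split=> [t|t _]; [exact: cvg_cst|rewrite normr1]. Qed.

Lemma weight_id : weight id.
Proof. by split=> [t|t /andP[t0 t1]]; [exact: cvg_id|rewrite ger0_norm]. Qed.

Lemma line_continuous e x : continuous (fun t : R => t *: e + x).
Proof.
move=> t; apply: cvgD; last exact: cvg_cst.
by apply: cvgZr_tmp; exact: cvg_id.
Qed.

Lemma line_comp_cont f e x : continuous f -> continuous (fun t : R => f (t *: e + x)).
Proof.
move=> fc t.
have H := @continuous_comp _ _ _ (fun t : R => t *: e + x) f t (@line_continuous e x t) (fc _).
exact: H.
Qed.

Lemma cont_int01 (u : R -> R) : continuous u -> mu.-integrable `[0, 1] (EFin \o u).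
Proof.
move=> uc; apply: continuous_compact_integrable; first exact: segment_compact.
exact: continuous_subspaceT.
Qed.

Lemma lint_cont w e f x : weight w -> continuous f ->
  continuous (fun t : R => w t * f (t *: e + x)).
Proof.
by move=> [wc _] fc t; apply: cvgM; [exact: wc|exact: line_comp_cont].
Qed.

Lemma int01_cst (c : R) : \int[mu]_(t in `[0, 1]) c = c.
Proof.
rewrite Rintegral_cst//= lebesgue_measure_itv/= lte_fin ltr01.
by rewrite oppr0 adde0 mulr1.
Qed.

Lemma int01_bound (u : R -> R) (e : R) : continuous u ->
  (forall t : R, 0 <= t <= 1 -> `|u t| <= e) -> `|\int[mu]_(t in `[0, 1]) u t| <= e.
Proof.
move=> uc ue; apply: le_trans (le_normr_Rintegral _ (cont_int01 uc)) _ => //.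
rewrite -[X in _ <= X](int01_cst e); apply: le_Rintegral => //.
- by apply: cont_int01 => t; apply: cvg_norm; exact: uc.
- by apply: cont_int01 => t; exact: cvg_cst.
Qed.

(** Compactness of the segment. This uniform estimate takes the place of dominated convergence in
    the passages to the limit under the integral. *)
Lemma unif_line f e x : continuous f -> forall eps : R, 0 < eps ->
  exists2 d : R, 0 < d & forall y, `|y| < d -> forall t : R, 0 <= t <= 1 ->
    `|f (y + (t *: e + x)) - f (t *: e + x)| < eps.
Proof.
move=> fc eps eps0.
have NC := proj1 (compact_near_coveringP _) (@segment_compact R 0 1) V (nbhs (0 : V))
  (fun y t => `|f (y + (t *: e + x)) - f (t *: e + x)| < eps) (nbhs_filter _).
suff /NC/nbhs_ballP[d d0 H] : forall t : R, `[0, 1]%classic t -> \forall t' \near t &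
    y \near nbhs (0 : V), `|f (y + (t' *: e + x)) - f (t' *: e + x)| < eps.
  exists d; first exact: d0.
  move=> y yd t t01; apply: (H y); last by rewrite /= in_itv.
  by rewrite -ball_normE /= sub0r normrN.
move=> t _ {NC}.
have e2 : 0 < eps / 2 by rewrite divr_gt0.
have [d d0 Hd] := cont_ball openT (I : setT (t *: e + x)) (fc _) e2.
have d2 : 0 < d / 2 by rewrite divr_gt0.
have e1 : 0 < `|e| + 1 by rewrite ltr_wpDl.
exists ([set t' | `|t' - t| < d / 2 / (`|e| + 1)], [set y | `|y| < d / 2]).
  split=> /=.
    apply/nbhs_ballP; exists (d / 2 / (`|e| + 1)) => /=; first by rewrite divr_gt0.
    by move=> t'; rewrite -ball_normE /= distrC.
  apply/nbhs_ballP; exists (d / 2) => // y.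
  by rewrite -ball_normE /= sub0r normrN.
move=> [t' y] /= [tt' yd].
have td : `|(t' - t) *: e| < d / 2.
  rewrite normrZ; apply: le_lt_trans (_ : `|t' - t| * (`|e| + 1) < _).
    by apply: ler_wpM2l => //; rewrite lerDl.
  by rewrite -ltr_pdivlMr.
have tE : t' *: e + x = (t' - t) *: e + (t *: e + x).
  by rewrite scalerBl addrA subrK.
have [_ X1] : True /\ `|f (y + (t' *: e + x)) - f (t *: e + x)| < eps / 2.
  rewrite tE [y + _]addrA; split=> //.
  have [|_] := Hd (y + (t' - t) *: e); last exact.
  by rewrite [d]splitr; apply: le_lt_trans (ler_normD _ _) _; exact: ltrD.
have [_ X2] : True /\ `|f (t' *: e + x) - f (t *: e + x)| < eps / 2.
  rewrite tE; split=> //; have [|_] := Hd ((t' - t) *: e); last exact.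
  by apply: lt_trans td _; rewrite ltr_pdivrMr// ltr_pMr// ltr1n.
rewrite [eps]splitr -[X in `|X|](subrKA (f (t *: e + x))).
by apply: le_lt_trans (ler_normD _ _) _; apply: ltrD => //; rewrite distrC.
Qed.

Lemma sm_continuous f : sm setT f -> continuous f.
Proof. by move=> sf x; exact: sm_cont sf I. Qed.

Lemma lint_continuous w e f : weight w -> continuous f -> continuous (lint w e f).
Proof.
move=> ww fc x; apply/cvgrPdist_le => eps eps0.
have [d d0 H] := unif_line e x fc eps0.
near=> y.
have yd : `|y - x| < d.
  by near: y; apply/nbhs_ballP; exists d => // z; rewrite -ball_normE /= distrC.
have c1 := lint_cont (e := e) (x := x) ww fc.
have c2 := lint_cont (e := e) (x := y) ww fc.
rewrite distrC /lint -RintegralB//; [|exact: cont_int01..].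
apply: int01_bound => [t|t t01]; first by apply: cvgB; [exact: c2|exact: c1].
rewrite -mulrBr normrM -[eps]mul1r; apply: ler_pM => //.
  by have [_ ->] := ww.
have -> : t *: e + y = (y - x) + (t *: e + x) by rewrite addrCA subrK.
by rewrite ltW// H.
Unshelve. all: by end_near. Qed.

(** By the mean value theorem the difference quotient of the integrand is ['D_v f] at a point
    shifted by at most [|h| * |v|], hence uniformly close to the claimed integrand by
    [unif_line]. *)
Lemma is_derive_lint w e f x v : weight w -> sm setT f ->
  is_derive x v (lint w e f) (lint w e ('D_v f) x).
Proof.
move=> ww sf.
have sf' := sm_derive v sf.
have fc := sm_continuous sf; have dfc := sm_continuous sf'.
suff Q : h^-1 *: ((lint w e f \o shift x) (h *: v) - lint w e f x) @[h --> 0^']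
    --> lint w e ('D_v f) x.
  by split; [apply/cvg_ex; exists (lint w e ('D_v f) x)|exact: cvg_lim Q].
apply/cvgrPdist_le => eps eps0.
have [d d0 H] := unif_line e x dfc eps0.
have v1 : 0 < `|v| + 1 by rewrite ltr_wpDl.
near=> h.
have h0 : h != 0 by near: h; exact: nbhs_dnbhs_neq.
have hd : `|h| * (`|v| + 1) < d.
  rewrite -ltr_pdivlMr//; near: h.
  by apply: dnbhs0_lt; rewrite divr_gt0.
have c0 := lint_cont (e := e) (x := x) ww fc.
have c1 := lint_cont (e := e) (x := h *: v + x) ww fc.
have c2 := lint_cont (e := e) (x := x) ww dfc.
have c3 : continuous (fun t => w t * f (t *: e + (h *: v + x)) - w t * f (t *: e + x)).
  by move=> t; apply: cvgB; [exact: c1|exact: c0].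
have c4 : continuous (fun t => h^-1 * (w t * f (t *: e + (h *: v + x)) - w t * f (t *: e + x))).
  by move=> t; apply: cvgM; [exact: cvg_cst|exact: c3].
rewrite distrC /lint /= -RintegralB//; [|exact: cont_int01..].
rewrite [h^-1 *: _]/GRing.scale /= -RintegralZl//; last exact: cont_int01.
rewrite -RintegralB//; [|exact: cont_int01..].
apply: int01_bound => [t|t t01]; first by apply: cvgB; [exact: c4|exact: c2].
rewrite -mulrBr mulrCA -mulrBr normrM -[eps]mul1r; apply: ler_pM => //.
  by have [_ ->] := ww.
have [|c ch E] := @mvt_line _ _ f (t *: e + x) v h.
  by move=> s _; exact: (sm_derivable sf I).
rewrite [t *: e + _]addrCA E mulKf//; apply/ltW/H => //.
rewrite normrZ; apply: le_lt_trans hd.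
by apply: ler_pM => //; rewrite lerDl.
Unshelve. all: by end_near. Qed.

Lemma sm_lint w e f : weight w -> sm setT f -> sm setT (lint w e f).
Proof.
move=> ww sf.
apply: (@sm_coind _ _ setT (fun F => exists2 f', sm setT f' & F = lint w e f') openT).
  move=> _ [g sg ->]; split.
    by move=> x _; exact: lint_continuous ww (sm_continuous sg) x.
  move=> v; exists (lint w e ('D_v g)).
    by exists ('D_v g) => //; exact: sm_derive.
  by move=> x _; exact: is_derive_lint.
by exists f.
Qed.

Lemma lintD w e f g x : weight w -> continuous f -> continuous g ->
  lint w e (fun y => f y + g y) x = lint w e f x + lint w e g x.
Proof.
move=> ww fc gc; rewrite /lint -RintegralD//; last 2 first.
- exact/cont_int01/lint_cont.
- exact/cont_int01/lint_cont.
by apply: eq_Rintegral => t _; rewrite mulrDr.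
Qed.

Lemma lintZ w e (c : R) f x : weight w -> continuous f ->
  lint w e (fun y => c * f y) x = c * lint w e f x.
Proof.
move=> ww fc; rewrite /lint -RintegralZl//; last exact/cont_int01/lint_cont.
by apply: eq_Rintegral => t _; rewrite mulrCA.
Qed.

Lemma lint_inv e f x : (forall t : R, f (t *: e + x) = f x) ->
  lint (fun=> 1) e f x = f x.
Proof.
move=> H; rewrite /lint -[RHS]int01_cst; apply: eq_Rintegral => t _.
by rewrite H mul1r.
Qed.

Lemma ftc01 (F F' : R -> R) : (forall t : R, is_derive t 1 F (F' t)) -> continuous F' ->
  \int[mu]_(t in `[0, 1]) F' t = F 1 - F 0.
Proof.
move=> dF cF'; have Fc : continuous F.
  by move=> t; apply/differentiable_continuous/derivable1_diffP; case: (dF t).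
rewrite /Rintegral (@continuous_FTC2 _ F' F 0 1 ltr01) ?fineD//.
- exact: continuous_subspaceT.
- split=> [t _||]; first by case: (dF t).
  + by apply: cvg_at_right_filter; exact: Fc.
  + by apply: cvg_at_left_filter; exact: Fc.
- by move=> t _; rewrite derive1E; case: (dF t).
Qed.

Lemma is_derive_line_sm f e x (t : R) : sm setT f ->
  is_derive t 1 (fun t => f (t *: e + x)) ('D_e f (t *: e + x)).
Proof. by move=> sf; apply: is_derive_line; exact: (sm_derivable sf I). Qed.

Lemma lint1_derive e f x : sm setT f ->
  lint (fun=> 1) e ('D_e f) x = f (e + x) - f x.
Proof.
move=> sf; rewrite /lint.
have := @ftc01 _ _ (fun t => @is_derive_line_sm f e x t sf).
rewrite scale1r scale0r add0r => <-.
  by apply: eq_Rintegral => t _; rewrite mul1r.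
exact: line_comp_cont (sm_continuous (sm_derive e sf)).
Qed.

(** Integration by parts: t f(t e + x) has t-derivative t D_e f + f, both taken at t e + x. *)
Lemma lint_id_derive e f x : sm setT f ->
  lint id e ('D_e f) x = f (e + x) - lint (fun=> 1) e f x.
Proof.
move=> sf; rewrite /lint.
have c1 := lint_cont (e := e) (x := x) weight1 (sm_continuous sf).
have c2 := lint_cont (e := e) (x := x) weight_id (sm_continuous (sm_derive e sf)).
pose F (t : R) := t * f (t *: e + x).
have dF (t : R) : is_derive t 1 F (t * 'D_e f (t *: e + x) + 1 * f (t *: e + x)).
  have := is_deriveM (is_derive_id t 1) (@is_derive_line_sm f e x t sf).
  by rewrite [_ *: 1]/GRing.scale /= mulr1 mul1r.
have := ftc01 dF; rewrite /F scale1r mul1r mul0r subr0 => <-.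
  by rewrite RintegralD ?addrK//; exact: cont_int01.
by move=> t; apply: cvgD; [exact: c2|exact: c1].
Qed.

End LineIntegral.

Section ComplexLineIntegral.
Local Open Scope complex_scope.
Variables (R : realType) (V : normedModType R).
Implicit Types (f g : V -> R[i]) (e v x : V) (w : R -> R).
Local Notation csm := (smooth_on (setT : set V)).

Definition clint w e f x : R[i] :=
  lint w e (fun y => complex.Re (f y)) x +i* lint w e (fun y => complex.Im (f y)) x.

Lemma csmRe f : csm f -> sm setT (fun y => complex.Re (f y)).
Proof. by move=> /smooth_onP[]. Qed.

Lemma csmIm f : csm f -> sm setT (fun y => complex.Im (f y)).
Proof. by move=> /smooth_onP[]. Qed.

Lemma csm_clint w e f : weight w -> csm f -> csm (clint w e f).
Proof.
by move=> ww sf; apply/smooth_onP; split; apply: sm_lint => //;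
  [exact: csmRe|exact: csmIm].
Qed.

Lemma cderive_clint w e v f : weight w -> csm f ->
  cderive v (clint w e f) = clint w e (cderive v f).
Proof.
move=> ww sf; apply/funext => x; rewrite /cderive /clint /=.
have [_ ->] := @is_derive_lint R V w e _ x v ww (csmRe sf).
by have [_ ->] := @is_derive_lint R V w e _ x v ww (csmIm sf).
Qed.

Lemma clintD w e f g x : weight w -> csm f -> csm g ->
  clint w e (fun y => f y + g y) x = clint w e f x + clint w e g x.
Proof.
move=> ww sf sg; rewrite /clint.
have fc := sm_continuous (csmRe sf); have fc' := sm_continuous (csmIm sf).
have gc := sm_continuous (csmRe sg); have gc' := sm_continuous (csmIm sg).
apply/eqP; rewrite eq_complex /= -!lintD//; apply/andP; split; apply/eqP.
- by congr (lint _ _ _ _); apply/funext => y; rewrite raddfD.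
- by congr (lint _ _ _ _); apply/funext => y; rewrite raddfD.
Qed.

Lemma clintZ w e (c : R[i]) f x : weight w -> csm f ->
  clint w e (fun y => c * f y) x = c * clint w e f x.
Proof.
move=> ww sf; rewrite /clint.
have fc := sm_continuous (csmRe sf); have fc' := sm_continuous (csmIm sf).
case: c => a b; apply/eqP; rewrite eq_complex /=.
have cZ (k : R) (h : V -> R) : continuous h -> continuous (fun y => k * h y).
  by move=> hc y; apply: cvgM; [exact: cvg_cst|exact: hc].
rewrite -mulNr -!lintZ// -!lintD//; [|exact: cZ..].
apply/andP; split; apply/eqP; congr (lint _ _ _ _); apply/funext => y.
- by case: (f y) => p q /=; rewrite mulNr.
- by case: (f y) => p q /=.
Qed.

Lemma clint_inv e f x : (forall t : R, f (t *: e + x) = f x) ->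
  clint (fun=> 1) e f x = f x.
Proof.
move=> H; rewrite /clint !lint_inv => [|t|t]; rewrite ?H//.
by case: (f x).
Qed.

Lemma clint1_derive e f x : csm f ->
  clint (fun=> 1) e (cderive e f) x = f (e + x) - f x.
Proof.
move=> sf; rewrite /clint /= (lint1_derive _ _ (csmRe sf)) (lint1_derive _ _ (csmIm sf)).
by case: (f (e + x)) => a b; case: (f x).
Qed.

Lemma clint_id_derive e f x : csm f ->
  clint id e (cderive e f) x = f (e + x) - clint (fun=> 1) e f x.
Proof.
move=> sf; rewrite /clint /= (lint_id_derive _ _ (csmRe sf)) (lint_id_derive _ _ (csmIm sf)).
by case: (f (e + x)) => a b.
Qed.

End ComplexLineIntegral.

Lemma clint_comp (R : realType) (V V' : normedModType R) (w : R -> R)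
    (g : V -> V') (e : V) (e' : V') (f : V' -> R[i]) x :
  (forall t : R, g (t *: e + x) = t *: e' + g x) ->
  clint w e (f \o g) x = clint w e' f (g x).
Proof.
move=> H; rewrite /clint /lint; congr (_ +i* _)%C; apply: eq_Rintegral => t _ /=;
  by rewrite H.
Qed.

(** * Smooth bumps whose integer translates sum to 1 *)

Section Bump.
Variable R : realType.

(** The powers of 1/x make the family stable under derivation: the n-th derivative function is a
    combination of the members n+1 and n+2, so one induction proves all of them smooth. *)
Definition flat (n : nat) (x : R) : R := if 0 < x then x ^- n * expR (- x^-1) else 0.

Lemma flat_ge0 n x : 0 <= flat n x.
Proof.
rewrite /flat; case: ifP => // x0.
by rewrite mulr_ge0 ?expR_ge0// invr_ge0 exprn_ge0// ltW.
Qed.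

(** Take e^y >= y at y = 1/((n+1) x) and raise it to the power n+1; this is the origin of the
    constant. The linear bound yields the derivative 0 at the origin. *)
Lemma flat_bound n x : flat n x <= (n.+1 ^ n.+1)%:R * `|x|.
Proof.
rewrite /flat; case: ifP => x0; last by rewrite mulr_ge0.
rewrite gtr0_norm//.
have y0 : 0 < x^-1 by rewrite invr_gt0.
have key : (x^-1 / n.+1%:R) ^+ n.+1 <= expR x^-1.
  rewrite -[X in expR X](divfK (_ : n.+1%:R != 0 :> R)) ?pnatr_eq0//.
  rewrite expRM_natr lerXn2r ?nnegrE ?expR_ge0 ?divr_ge0 ?ltW//.
  by apply: lt_le_trans (expR_ge1Dx _); rewrite ltrDr.
rewrite expRN ler_pdivrMr ?expR_gt0// -exprVn.
move: key; rewrite expr_div_n ler_pdivrMr ?exprn_gt0 ?ltr0n// exprS => key.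
rewrite -(ler_pM2l y0); apply: le_trans key _.
by rewrite mulrA mulrCA mulVf ?gt_eqF// mulr1 natrX mulrC.
Qed.

Lemma is_derive_flat1 n x :
  is_derive x (1 : R) (flat n) (- n%:R * flat n.+1 x + flat n.+2 x).
Proof.
have [x0|x0|->] := ltgtP x 0.
- apply: (@near_eq_is_derive _ _ _ (cst 0)).
    near=> y; rewrite /flat ifN// -leNgt ltW//.
    by near: y; exact: lt_nbhsl.
  rewrite /flat !ltNge !(ltW x0) /= mulr0 add0r; exact: is_derive_cst.
- apply: (@near_eq_is_derive R R R (fun y : R => (y ^+ n)^-1 * expR (- y^-1)) (flat n)).
    near=> y; rewrite /flat ifT//.
    by near: y; exact: lt_nbhsr.
  rewrite /flat x0.
  have xn0 : x != 0 by rewrite gt_eqF.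
  have dV : is_derive x (1 : R) (fun y : R => y^-1) (- x ^- 2).
    by have := @is_deriveV R id x 1 1 xn0 (is_derive_id x 1); rewrite [_ *: 1]mulr1.
  have dN : is_derive x (1 : R) (fun y : R => - y^-1) (x ^- 2).
    by rewrite -[x ^- 2]opprK; exact: (is_deriveN dV).
  have dE : is_derive x (1 : R) (fun y : R => expR (- y^-1)) (x ^- 2 * expR (- x^-1)).
    have := @is_derive1_comp R expR (fun y => - y^-1) x _ _ (is_derive_expR _) dN.
    by rewrite mulrC.
  have dX : is_derive x (1 : R) (fun y : R => (y ^+ n)^-1) (- n%:R * x ^- n.+1).
    have dn : is_derive x (1 : R) (fun y : R => y ^+ n) (n%:R * x ^+ n.-1).
      have := is_deriveX n (is_derive_id x (1 : R)); rewrite [_ *: 1]mulr1.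
      by congr is_derive; apply/funext => y; rewrite exprfctE.
    have := @is_deriveV R (fun y => y ^+ n) x _ _ (expf_neq0 n xn0) dn.
    suff -> : - (x ^+ n) ^- 2 *: (n%:R * x ^+ n.-1) = - n%:R * x ^- n.+1 by [].
    rewrite /GRing.scale /=; case: n {dn} => [|m]; first by rewrite mul0r mulr0 oppr0 mul0r.
    by rewrite /= !exprS expr0; field; rewrite xn0 expf_neq0.
  have := is_deriveM dX dE; rewrite /GRing.scale /= => dM.
  suff <- : (x ^+ n)^-1 * (x ^- 2 * expR (- x^-1)) + expR (- x^-1) * (- n%:R * x ^- n.+1) =
    - n%:R * (x ^- n.+1 * expR (- x^-1)) + x ^- n.+2 * expR (- x^-1) by [].
  by rewrite !exprS expr0; field; rewrite xn0 expf_neq0.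
- have E0 m : flat m 0 = 0 by rewrite /flat ltxx.
  rewrite !E0 mulr0 addr0.
  have Q : h^-1 *: ((flat n \o shift 0) (h *: 1) - flat n 0) @[h --> 0^'] --> (0 : R).
    apply/cvgr0Pnorm_le => e e0.
    near=> h.
    have h0 : h != 0 by near: h; exact: nbhs_dnbhs_neq.
    rewrite /= E0 subr0 addr0 [h *: 1]mulr1.
    (* The difference quotient at 0 is the next member of the family, which tends to 0 by
       [flat_bound]. *)
    have -> : h^-1 *: flat n h = flat n.+1 h.
      rewrite /flat; case: ifP => _; last by rewrite scaler0.
      by rewrite /GRing.scale /= mulrA exprS invfM.
    rewrite ger0_norm ?flat_ge0//; apply: le_trans (flat_bound _ _) _.
    rewrite mulrC -ler_pdivlMr ?ltr0n ?expn_gt0//.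
    near: h; apply: dnbhs0_le.
    by rewrite divr_gt0// ltr0n expn_gt0.
  by split; [apply/cvg_ex; exists 0|exact: cvg_lim Q].
Unshelve. all: by end_near. Qed.

Lemma is_derive_scale (f : R -> R) (x v df : R) :
  is_derive x (1 : R) f df -> is_derive x v f (v * df).
Proof.
move=> [d <-]; have d' : differentiable f x by apply/derivable1_diffP.
split; first exact: diff_derivable.
rewrite !deriveE// -[v in 'd f x v](mulr1 v) -[v * 1]/(v *: 1).
by rewrite linearZ.
Qed.

Lemma flat_cont n : continuous (flat n).
Proof.
move=> x; have [d _] := is_derive_flat1 n x.
by apply: differentiable_continuous; apply/derivable1_diffP.
Qed.

Lemma sm_flat n : sm (setT : set R) (flat n).
Proof.
move=> k; elim: k n => [|k IH] n.
  by split; last exact: I; move=> x _; exact: flat_cont.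
split=> [x _|v]; first exact: flat_cont.
have dv x := is_derive_scale v (is_derive_flat1 n x).
split=> [x _|]; first by case: (dv x).
have oT := @openT R.
apply: (Ck_on_ext oT _ (Ck_onM oT (sm_cst v oT k)
  (Ck_onD oT (Ck_onM oT (sm_cst (- n%:R) oT k) (IH n.+1)) (IH n.+2)))) => x _.
by case: (dv x) => _ ->.
Qed.

Definition step (x : R) : R := flat 0 x / (flat 0 x + flat 0 (1 - x)).

Lemma flat0_gt0 x : 0 < x -> 0 < flat 0 x.
Proof. by move=> x0; rewrite /flat x0 expr0 invr1 mul1r expR_gt0. Qed.

Lemma flat0_le0 x : x <= 0 -> flat 0 x = 0.
Proof. by move=> x0; rewrite /flat ltNge x0. Qed.

Lemma step_den x : flat 0 x + flat 0 (1 - x) != 0.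
Proof.
rewrite gt_eqF//; have [x0|x0] := ltP 0 x.
  by rewrite ltr_pwDl ?flat_ge0 ?flat0_gt0.
by rewrite ltr_wpDl ?flat_ge0// flat0_gt0// subr_gt0 (le_lt_trans x0).
Qed.

Lemma step0 x : x <= 0 -> step x = 0.
Proof. by move=> x0; rewrite /step flat0_le0// mul0r. Qed.

Lemma step1 x : 1 <= x -> step x = 1.
Proof.
move=> x1; have := step_den x; rewrite /step [flat 0 (1 - x)]flat0_le0 ?subr_le0//.
by rewrite addr0 => x0; rewrite divff.
Qed.

Lemma sm_step : sm (setT : set R) step.
Proof.
have oT := @openT R.
have s1 : sm setT (fun x : R => flat 0 (1 - x)).
  apply: (sm_comp_affine (L := fun v => - v) oT oT _ _ _ (sm_flat 0)) => //.
  - by move=> x; apply: cvgB; [exact: cvg_cst|exact: cvg_id].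
  - by move=> h v x; rewrite opprD addrCA scalerN.
exact: smM (sm_flat 0) (smV oT (fun x _ => step_den x) (smD oT (sm_flat 0) s1)).
Qed.

(** A difference of consecutive translates, so that sums over integer translates telescope. *)
Definition smooth_bump (x : R) : R := step (x + 1) - step x.

Lemma sm_bump : sm (setT : set R) smooth_bump.
Proof.
have oT := @openT R; apply: smB => //; last exact: sm_step.
apply: (sm_comp_affine (L := id) oT oT _ _ _ sm_step) => //.
- by move=> x; apply: cvgD; [exact: cvg_id|exact: cvg_cst].
- by move=> h v x; rewrite addrA.
Qed.

Lemma bump_out x : 1 <= `|x| -> smooth_bump x = 0.
Proof.
rewrite /smooth_bump; have [x0|x0] := leP 0 x.
  by rewrite ger0_norm// => x1; rewrite !step1 ?subrr// ler_wpDr.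
rewrite ltr0_norm// => x1.
by rewrite !step0 ?subrr//; lra.
Qed.

Lemma bump_sum (x : R) (N : nat) : `|x| + 1 <= N%:R ->
  \sum_(i < N.*2) smooth_bump (x + (i%:R - N%:R)) = 1.
Proof.
move=> xN; rewrite (eq_bigr (fun i : 'I_N.*2 =>
  step (x - N%:R + i.+1%:R) - step (x - N%:R + i%:R))); last first.
  move=> i _; rewrite /smooth_bump; congr (step _ - step _).
  - by rewrite -natr1; ring.
  - by ring.
rewrite -(big_mkord xpredT (fun i => step (x - N%:R + i.+1%:R) - step (x - N%:R + i%:R))).
rewrite telescope_sumr// addr0 step1 ?step0 ?subr0//.
- by rewrite subr_le0; apply: le_trans xN; rewrite ler_wpDr// ler_norm.
- rewrite -addnn natrD addrA subrK -lerBlDl; apply: le_trans xN.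
  by have := ler_norm (- x); rewrite normrN; lra.
Qed.

End Bump.

(** * The Koszul complex of commuting derivations *)

Section Koszul.
Local Close Scope classical_set_scope.
Variables (F : numFieldType) (M : lmodType F) (I : finType).
Implicit Types (T : {set I}) (i j : I).

Definition before j i : bool := (enum_rank j < enum_rank i)%N.

(** The sign for moving the covector [i] from the front to its place in the increasing product over
    [T]. *)
Definition sgn i T : F := (-1) ^+ #|[set j in T | before j i]|.

Lemma sgn_setU1 i j T : j \notin T -> sgn i (j |: T) = sgn i T * (-1) ^+ before j i.
Proof.
move=> jT; rewrite /sgn -exprD; congr (_ ^+ _).
have [ji|ji] := boolP (before j i).
  have -> : [set k in j |: T | before k i] = j |: [set k in T | before k i].
    by apply/finset.setP => k; rewrite !inE; case: eqP => //= ->; rewrite ji.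
  by rewrite cardsU1 inE (negbTE jT) addnC.
have -> : [set k in j |: T | before k i] = [set k in T | before k i].
  by apply/finset.setP => k; rewrite !inE; case: eqP => //= ->; rewrite (negbTE ji) andbF.
by rewrite addn0.
Qed.

Lemma sgn_setD1 i j T : j \in T -> sgn i (T :\ j) = sgn i T * (-1) ^+ before j i.
Proof.
move=> jT; rewrite -{2}(finset.setD1K jT) sgn_setU1 ?finset.setD11//.
by rewrite -mulrA -expr2 sqrr_sign mulr1.
Qed.

Lemma before_sign i j : i != j ->
  (-1) ^+ before i j = - (-1) ^+ before j i :> F.
Proof.
rewrite /before => ij; case: ltngtP => [_|_|/val_inj/enum_rank_inj E].
- by rewrite expr1 expr0.
- by rewrite expr1 expr0 opprK.
- by rewrite E eqxx in ij.
Qed.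

Lemma beforexx i : before i i = false. Proof. exact: ltnn. Qed.

Lemma sgn_sqr i T : sgn i T * sgn i T = 1.
Proof. by rewrite -expr2 sqrr_sign. Qed.

Variable D : I -> {linear M -> M}.

(** The exterior derivative on coefficients, for products of closed covectors dual to the
    derivations [D]. *)
Definition kd (a : {set I} -> M) T : M := \sum_(i in T) sgn i T *: D i (a (T :\ i)).

(** Interior product with the vector field that has the constant components [c] in the dual
    frame. *)
Definition ki (c : I -> F) (a : {set I} -> M) T : M :=
  \sum_(i in ~: T) (c i * sgn i T) *: a (i |: T).

(** Cartan's formula; the Lie derivative acts on coefficients because the components are constant.
    The terms that remove [i] and add another index [j] cancel by the sign rule. The diagonal terms
    with [i] in [T] come from the first composite, those with [i] outside [T] from the second. *)
Lemma cartan c a T : kd (ki c a) T + ki c (kd a) T = \sum_i c i *: D i (a T).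
Proof.
pose X i j := (c j * (sgn i T * sgn j (T :\ i))) *: D i (a (j |: T :\ i)).
have E1 : kd (ki c a) T =
    \sum_(i in T) c i *: D i (a T) + \sum_(i in T) \sum_(j in ~: T) X i j.
  rewrite -big_split /=; apply: eq_bigr => i iT.
  have -> : ki c a (T :\ i) = (c i * sgn i (T :\ i)) *: a T +
      \sum_(j in ~: T) (c j * sgn j (T :\ i)) *: a (j |: T :\ i).
    rewrite /ki (bigD1 i) ?inE ?eqxx//= finset.setD1K//; congr (_ + _).
    apply: eq_bigl => j; rewrite !inE negb_and negbK.
    by case: eqP => [->|_]; rewrite ?iT// andbT.
  rewrite linearD linearZ linear_sum scalerDr scaler_sumr; congr (_ + _).
    rewrite scalerA mulrCA sgn_setD1// beforexx expr0 mulr1 sgn_sqr mulr1 //.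
  by apply: eq_bigr => j _; rewrite linearZ scalerA mulrCA.
have E2 : ki c (kd a) T =
    \sum_(j in ~: T) c j *: D j (a T) - \sum_(i in T) \sum_(j in ~: T) X i j.
  rewrite exchange_big -sumrB /=; apply: eq_bigr => j; rewrite inE => jT.
  rewrite /kd big_setU1//= scalerDr scalerA finset.setU1K// sgn_setU1// beforexx.
  rewrite expr0 mulr1 -mulrA sgn_sqr mulr1; congr (_ + _).
  rewrite scaler_sumr -sumrN; apply: eq_bigr => i iT.
  have ij : i != j by apply: contraNneq jT => <-.
  have -> : (j |: T) :\ i = j |: T :\ i.
    by apply/finset.setP => k; rewrite !inE; case: (k =P j) => [->|//]; rewrite eq_sym ij.
  rewrite scalerA /X -scaleNr; congr (_ *: _).
  rewrite sgn_setU1// sgn_setD1// before_sign 1?eq_sym//.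
  by ring.
rewrite E1 E2 addrACA subrr addr0 [RHS](bigID (mem T)) /=.
by congr (_ + _); apply: eq_bigl => j; rewrite inE.
Qed.

(** Exchanging the two removed indices flips the sign, so the double sum is its own negative, and 2
    is invertible. *)
Lemma kd_kd a T : (forall i j x, D i (D j x) = D j (D i x)) -> kd (kd a) T = 0.
Proof.
move=> DC.
pose X i j := (sgn i T * sgn j (T :\ i)) *: D i (D j (a (T :\ i :\ j))).
have -> : kd (kd a) T = \sum_(i in T) \sum_(j in T | j != i) X i j.
  apply: eq_bigr => i iT; rewrite linear_sum scaler_sumr.
  apply: eq_big => [j|j jT]; first by rewrite !inE andbC.
  by rewrite linearZ scalerA.
have SS : \sum_(i in T) \sum_(j in T | j != i) X i j =
    - \sum_(i in T) \sum_(j in T | j != i) X i j.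
  rewrite {1}(exchange_big_dep (mem T)) /=; last by move=> i j _ /andP[].
  rewrite -sumrN; apply: eq_bigr => j jT; rewrite -sumrN.
  apply: eq_big => [i|i /and3P[iT _ ji]]; first by rewrite jT eq_sym.
  rewrite /X DC -scaleNr [T :\ i :\ j]finset.setDDl finset.setUC -finset.setDDl.
  congr (_ *: _); rewrite !sgn_setD1// before_sign 1?eq_sym//.
  by ring.
apply/eqP; have := SS; move/eqP; rewrite -addr_eq0 -mulr2n -scaler_nat.
by rewrite scaler_eq0 pnatr_eq0 /=.
Qed.

End Koszul.

(** * The module of smooth functions on the whole space *)

Section SmoothModule.
Local Open Scope complex_scope.
Variables (R : realType) (V : normedModType R).

(** Smooth functions are packaged as a module so that derivations, means and pullbacks become linear
    maps to which the Koszul formulas apply. *)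
Definition smooth_pred : {pred V -> (R[i])^o} :=
  fun f => `[< smooth_on (setT : set V) (f : V -> R[i]) >].

Record cinf := Cinf { cfun :> V -> (R[i])^o; _ : cfun \in smooth_pred }.

HB.instance Definition _ := [isSub for cfun].
HB.instance Definition _ := [Choice of cinf by <:].

Fact smooth_submod : GRing.submod_closed smooth_pred.
Proof.
have oT := @openT V; split.
  by apply/asboolP; exact: (csm_cst 0 oT).
move=> c f g /asboolP sf /asboolP sg; apply/asboolP.
exact: csmD oT (csmM oT (csm_cst c oT) sf) sg.
Qed.

HB.instance Definition _ := GRing.isSubmodClosed.Build _ _ smooth_pred smooth_submod.
HB.instance Definition _ := [SubChoice_isSubLmodule of cinf by <:].

Implicit Types (f g : cinf) (x v e : V).

Lemma smooth_cinf f : smooth_on setT (f : V -> R[i]).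
Proof. by case: f => f /= /asboolP. Qed.

Definition mk_cinf (f : V -> R[i]) (sf : smooth_on setT f) : cinf := Cinf (asboolT sf).

Lemma cinfP f g : (forall x, f x = g x) -> f = g.
Proof. by move=> fg; apply/val_inj/funext. Qed.

Lemma cfunD f g x : (f + g) x = f x + g x. Proof. by []. Qed.
Lemma cfunZ (c : R[i]) f x : (c *: f) x = c * f x. Proof. by []. Qed.
Lemma cfun0 x : (0 : cinf) x = 0. Proof. by []. Qed.
Lemma cfunB f g x : (f - g) x = f x - g x. Proof. by []. Qed.

Lemma cfun_sum (J : Type) (r : seq J) (Q : pred J) (F : J -> cinf) x :
  (\sum_(j <- r | Q j) F j) x = \sum_(j <- r | Q j) F j x.
Proof.
by elim/big_rec2: _ => [|j y1 y2 _ <-]; rewrite ?cfun0 ?cfunD.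
Qed.

Definition ccst (c : R[i]) : cinf := mk_cinf (csm_cst c openT).

Definition Der v f : cinf := mk_cinf (csm_cderive v (smooth_cinf f)).

Fact Der_linear v : linear (Der v).
Proof.
move=> c f g; apply: cinfP => x /=.
rewrite (@cderiveD _ _ setT v (fun y => c * f y) g)//; last 2 first.
- by apply: csmM; [exact: openT|apply: csm_cst; exact: openT|exact: smooth_cinf].
- exact: smooth_cinf.
by rewrite (cderiveZ v c openT (smooth_cinf f)).
Qed.
HB.instance Definition _ v := GRing.isLinear.Build _ _ _ _ (Der v) (Der_linear v).

Lemma Der_comm u v f : Der u (Der v f) = Der v (Der u f).
Proof. by apply: cinfP => x; exact: cderive_comm openT (smooth_cinf f) I. Qed.

Lemma Der_ccst v c : Der v (ccst c) = 0.
Proof. by apply: cinfP => x; exact: cderive_cst. Qed.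

Definition Lint (w : R -> R) (ww : weight w) e f : cinf :=
  mk_cinf (csm_clint e ww (smooth_cinf f)).

Fact Lint_linear w (ww : weight w) e : linear (Lint ww e).
Proof.
move=> c f g; apply: cinfP => x /=.
rewrite (@clintD _ _ w e (fun y => c * f y) g)//; last 2 first.
- by apply: csmM; [exact: openT|apply: csm_cst; exact: openT|exact: smooth_cinf].
- exact: smooth_cinf.
by rewrite (clintZ _ _ _ ww (smooth_cinf f)).
Qed.
HB.instance Definition _ w (ww : weight w) e :=
  GRing.isLinear.Build _ _ _ _ (Lint ww e) (Lint_linear ww e).

Lemma Der_Lint w (ww : weight w) e v f : Der v (Lint ww e f) = Lint ww e (Der v f).
Proof. by apply: cinfP => x /=; rewrite (cderive_clint e v ww (smooth_cinf f)). Qed.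

Definition mean := Lint (weight1 R).
Definition mean' := Lint (weight_id R).

HB.instance Definition _ e := GRing.isLinear.Build _ _ _ _ (mean e) (Lint_linear (weight1 R) e).
HB.instance Definition _ e := GRing.isLinear.Build _ _ _ _ (mean' e) (Lint_linear (weight_id R) e).

Lemma Der_mean e f x : Der e (mean e f) x = f (e + x) - f x.
Proof. by rewrite Der_Lint; exact: clint1_derive (smooth_cinf f). Qed.

(** On periodic functions the mean with weight t inverts the derivation up to the average; combined
    with contraction along [e] it becomes a homotopy on forms. *)
Lemma Der_mean' e f : (forall x, f (e + x) = f x) -> Der e (mean' e f) = f - mean e f.
Proof.
move=> fe; rewrite Der_Lint; apply: cinfP => x.
by rewrite cfunB -fe; exact: clint_id_derive (smooth_cinf f).
Qed.

Lemma mean_id e f : (forall (r : R) x, f (r *: e + x) = f x) -> mean e f = f.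
Proof. by move=> fe; apply: cinfP => x; exact: clint_inv (fun r => fe r x). Qed.

Lemma Der0_inv e f : Der e f = 0 -> forall (r : R) x, f (r *: e + x) = f x.
Proof.
move=> df r x.
have [fr fi] := (proj1 (smooth_onP _ _) (smooth_cinf f)).
have d0 y : cderive e f y = 0 by have := congr1 (fun g : cinf => g y) df.
apply/eqP; rewrite eq_complex; apply/andP; split; rewrite -subr_eq0.
- have [|c _ ->] := @mvt_line _ _ (fun y => complex.Re (f y)) x e r.
    by move=> t _; exact: (sm_derivable fr I).
  by have := congr1 (@complex.Re R) (d0 (c *: e + x)); rewrite /= => ->; rewrite mulr0.
- have [|c _ ->] := @mvt_line _ _ (fun y => complex.Im (f y)) x e r.
    by move=> t _; exact: (sm_derivable fi I).
  by have := congr1 (@complex.Im R) (d0 (c *: e + x)); rewrite /= => ->; rewrite mulr0.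
Qed.

Lemma mean_inv e f : (forall x, f (e + x) = f x) ->
  forall (r : R) x, mean e f (r *: e + x) = mean e f x.
Proof.
move=> fe; apply: Der0_inv; apply: cinfP => x.
by rewrite Der_mean fe subrr.
Qed.

Lemma Der_inv0 v f : (forall (r : R) x, f (r *: v + x) = f x) -> Der v f = 0.
Proof.
move=> H; have <- := mean_id H; apply: cinfP => x.
by rewrite Der_mean -[in f (v + x)](scale1r v) H subrr.
Qed.

(** The linear part is kept as data because pullback turns a direction [e] into [alin e], in
    derivatives and in line integrals alike. *)
Record aff := Aff { afun :> V -> V; alin : V -> V; acont : continuous afun;
  affP : forall (h : R) v x, afun (h *: v + x) = h *: alin v + afun x }.

Fact pull_smooth (a : aff) f : smooth_on setT (f \o a : V -> R[i]).
Proof.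
have oT := @openT V.
exact: (csm_comp_affine oT oT (@acont a) (@affP a) (fun _ _ => I) (smooth_cinf f)).
Qed.

Definition pull (a : aff) f : cinf := mk_cinf (pull_smooth a f).

Fact pull_linear a : linear (pull a). Proof. by move=> c f g; exact: cinfP. Qed.
HB.instance Definition _ a := GRing.isLinear.Build _ _ _ _ (pull a) (pull_linear a).

Lemma Der_pull a v f : Der v (pull a f) = pull a (Der (alin a v) f).
Proof.
apply: cinfP => x; apply: (@cderive_affine _ _ _ setT) => //.
- by move=> h; exact: affP.
- exact: smooth_cinf.
Qed.

Lemma Lint_pull w (ww : weight w) (a : aff) e f :
  Lint ww e (pull a f) = pull a (Lint ww (alin a e) f).
Proof. by apply: cinfP => x; apply: clint_comp => t; exact: affP. Qed.

Fact trans_cont e : continuous (fun x => e + x).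
Proof. by move=> x; apply: cvgD; [exact: cvg_cst|exact: cvg_id]. Qed.
Fact trans_affP e (h : R) v x : e + (h *: v + x) = h *: v + (e + x).
Proof. by rewrite addrCA. Qed.
Definition trans e : aff := Aff (@trans_cont e) (@trans_affP e).

Lemma pull_transP e f : pull (trans e) f = f <-> forall x, f (e + x) = f x.
Proof.
split=> [H x|H]; last by apply: cinfP => x; exact: H.
by rewrite -[in RHS]H.
Qed.

Lemma Lint_inv w (ww : weight w) e v f : (forall x, f (v + x) = f x) ->
  forall x, Lint ww e f (v + x) = Lint ww e f x.
Proof.
by move=> /pull_transP fv; apply/pull_transP; rewrite -(@Lint_pull _ ww (trans v)) fv.
Qed.

End SmoothModule.

Lemma Ck_on_sub (R : realType) (V : normedModType R) (W W' : set V) k f :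
  W' `<=` W -> Ck_on W k f -> Ck_on W' k f.
Proof.
move=> WW'; elim: k f => [|k IH] f [fc fd]; first by split=> // x /WW'; exact: fc.
split=> [x /WW'|v]; first exact: fc.
by have [dv dk] := fd v; split=> [x /WW'|]; [exact: dv|exact: IH].
Qed.

Lemma smooth_sub (R : realType) (V : normedModType R) (W W' : set V) (f : V -> R[i]) :
  W' `<=` W -> smooth_on W f -> smooth_on W' f.
Proof. by move=> WW' sf k; have [? ?] := sf k; split; apply: Ck_on_sub WW' _. Qed.

(** * Sums against a partition of unity in one linear coordinate *)

Section PartitionOfUnity.
Local Open Scope complex_scope.
Variables (R : realType) (V : normedModType R) (l : V -> R).
Hypothesis lcont : continuous l.
Hypothesis llin : forall (h : R) v x, l (h *: v + x) = h * l v + l x.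
Implicit Types (G : int -> cinf V) (x v : V).

Let oT := @openT V.

Definition bumpl (m : int) : cinf V :=
  mk_cinf (csm_real oT (sm_comp_affine (W' := setT) (g := fun x => l x + m%:~R) (L := l)
    oT (@openT R) (fun x => cvgD (@lcont x) (cvg_cst _))
    (fun h v x => etrans (congr1 (fun z => z + _) (llin h v x)) (esym (addrA _ _ _)))
    (fun _ _ => I) (@sm_bump R))).

Fact cmul_smooth (f g : cinf V) : smooth_on setT (fun x => (f x : R[i]) * g x).
Proof. exact: csmM oT (smooth_cinf f) (smooth_cinf g). Qed.

Definition cmul (f g : cinf V) : cinf V := mk_cinf (cmul_smooth f g).

Definition pou_term (N : nat) G (i : nat) : cinf V :=
  cmul (bumpl (i%:Z - N%:Z)) (G (i%:Z - N%:Z)).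

(** The integer index m = i - N runs from -N to N - 1. *)
Definition pou_sum (N : nat) G : cinf V := \sum_(0 <= i < N.*2) pou_term N G i.

Lemma bumpl_out (m : int) x : `|l x| + 1 <= `|m%:~R : R| -> bumpl m x = 0.
Proof.
move=> lm; rewrite /bumpl /= bump_out//.
rewrite addrC -[l x]opprK; apply: le_trans (lerB_dist _ _); rewrite normrN.
by rewrite lerBrDr addrC.
Qed.

Lemma pou_term_out (N : nat) G (i : nat) x :
  `|l x| + 1 <= `|(i%:Z - N%:Z)%:~R : R| -> pou_term N G i x = 0.
Proof.
move=> /bumpl_out H; transitivity ((bumpl (i%:Z - N%:Z) x : R[i]) * G (i%:Z - N%:Z) x) => //.
by rewrite H; exact: mul0r.
Qed.

Lemma pou_sumS N G x : `|l x| + 1 <= N%:R -> pou_sum N.+1 G x = pou_sum N G x.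
Proof.
move=> lN; rewrite /pou_sum doubleS big_nat_recr// big_nat_recl// !cfunD !cfun_sum.
rewrite pou_term_out; last first.
  rewrite sub0r mulrNz normrN [X in _ <= X]ger0_norm ?ler0z//.
  by apply: le_trans lN _; rewrite -pmulrn ler_nat.
rewrite (@pou_term_out N.+1 G N.*2.+1 x); last first.
  have -> : (N.*2.+1)%:Z - N.+1%:Z = N%:Z by lia.
  by rewrite [X in _ <= X]ger0_norm ?ler0z// -pmulrn.
rewrite add0r addr0; apply: eq_bigr => i _; rewrite /pou_term.
by have -> : i.+1%:Z - N.+1%:Z = i%:Z - N%:Z by lia.
Qed.

Lemma pou_sumE (N N' : nat) G x : `|l x| + 1 <= N%:R -> `|l x| + 1 <= N'%:R ->
  pou_sum N G x = pou_sum N' G x.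
Proof.
wlog NN' : N N' / (N <= N')%N => [H lN lN'|lN _].
  by have [/H|/ltnW/H H'] := leqP N N'; [exact|apply/esym/H'].
rewrite -(subnK NN'); elim: (N' - N)%N => [|k ->] //.
rewrite addSn pou_sumS//; apply: le_trans lN _; rewrite ler_nat; exact: leq_addl.
Qed.

(** One unit makes the truncation exceed [|l x|], the other accounts for the radius 1 of the support
    of the bump. *)
Definition pou_level x : nat := (Num.truncn `|l x|).+2.

Lemma pou_levelP x : `|l x| + 1 <= (pou_level x)%:R.
Proof. by rewrite -natr1 lerD2r ltW// truncnS_gt. Qed.

Fact pou_open (n : nat) : open [set y | `|l y| < n%:R].
Proof.
apply: (@open_comp _ _ (fun y => `|l y|) [set z | z < n%:R]).
  by move=> y _; apply: cvg_norm; exact: lcont.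
exact: open_lt.
Qed.

Fact pou_smooth G : smooth_on setT (fun x => pou_sum (pou_level x) G x : R[i]).
Proof.
(* The level may jump between neighbouring points; with one more term on each side a single finite
   sum is valid on a whole neighbourhood. *)
apply: csm_local => x _; pose N := (pou_level x).+1.
exists [set y | `|l y| < (pou_level x)%:R], (pou_sum N G).
have oW := pou_open (pou_level x).
split=> //.
- apply: open_nbhs_nbhs; split=> //=.
  by apply: lt_le_trans (pou_levelP x); rewrite ltrDl.
- move=> y /= yN; apply: pou_sumE; first exact: pou_levelP.
  by rewrite /N -natr1 lerD2r ltW.
- by apply: smooth_sub (smooth_cinf (pou_sum N G)).
Qed.

Definition pou G : cinf V := mk_cinf (pou_smooth G).

Lemma pouE N G x : `|l x| + 1 <= N%:R -> pou G x = pou_sum N G x.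
Proof. by apply: pou_sumE; exact: pou_levelP. Qed.

Lemma pou_nearE G x : \forall y \near x, pou G y = pou_sum (pou_level x).+1 G y.
Proof.
have H : nbhs x [set y | `|l y| < (pou_level x)%:R].
  apply: open_nbhs_nbhs; split; first exact: pou_open.
  by apply: lt_le_trans (pou_levelP x); rewrite ltrDl.
apply: filterS H => y /= yN; apply: pouE.
by rewrite -natr1 lerD2r ltW.
Qed.

Fact pou_additive G G' (c : R[i]) : pou (fun m => c *: G m + G' m) = c *: pou G + pou G'.
Proof.
apply: cinfP => x; rewrite cfunD cfunZ !(pouE _ (pou_levelP x)) /pou_sum !cfun_sum.
rewrite mulr_sumr -big_split /=; apply: eq_bigr => i _.
by rewrite mulrDr mulrCA.
Qed.

Lemma pou_sumv (J : Type) (r : seq J) (Q : pred J) (c : J -> R[i]) (G : J -> int -> cinf V) :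
  pou (fun m => \sum_(j <- r | Q j) c j *: G j m) = \sum_(j <- r | Q j) c j *: pou (G j).
Proof.
elim: r => [|j r IH].
  rewrite big_nil; apply: cinfP => x; rewrite (pouE _ (pou_levelP x)) /pou_sum cfun_sum.
  by apply: big1 => i _; rewrite /pou_term /= big_nil mulr0.
rewrite big_cons; case: ifP => Qj.
  rewrite -IH -pou_additive; congr pou; apply/funext => m.
  by rewrite big_cons Qj.
by rewrite -IH; congr pou; apply/funext => m; rewrite big_cons Qj.
Qed.

Lemma pou_cst (f : cinf V) : pou (fun=> f) = f.
Proof.
apply: cinfP => x; rewrite (pouE _ (pou_levelP x)) /pou_sum cfun_sum /pou_term /=.
rewrite -mulr_suml big_mkord -(raddf_sum (real_complex R)).
rewrite (eq_bigr (fun i : 'I_(pou_level x).*2 =>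
  smooth_bump (l x + (i%:R - (pou_level x)%:R)))); last first.
  by move=> i _; rewrite mulrzBr -!pmulrn.
by rewrite bump_sum ?pou_levelP// mul1r.
Qed.

(** The bumps are constant along the level sets of [l], so no derivative falls on them.
    Transversally one does, which is the source of the error terms in the filtration argument. *)
Lemma Der_pou v G : l v = 0 -> Der v (pou G) = pou (fun m => Der v (G m)).
Proof.
move=> lv0; apply: cinfP => x.
transitivity (Der v (pou_sum (pou_level x).+1 G) x).
  by apply: cderive_near; exact: pou_nearE.
rewrite (pouE (N := (pou_level x).+1)); last first.
  by apply: le_trans (pou_levelP x) _; rewrite ler_nat.
rewrite /pou_sum linear_sum !cfun_sum; apply: eq_bigr => i _.
rewrite /pou_term; move: (_ - _)%Z => m /=.
rewrite (cderiveM v (smooth_cinf (bumpl m)) (smooth_cinf (G m)) I).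
have -> : cderive v (bumpl m) x = 0; last by rewrite mul0r add0r.
have : Der v (bumpl m) = 0; last by move=> /(congr1 (fun f : cinf V => f x)).
by apply: Der_inv0 => r y; rewrite /= llin lv0 mulr0 add0r.
Qed.

Lemma pou_pull0 (a : aff V) G : (forall x, l (a x) = l x) ->
  pull a (pou G) = pou (fun m => pull a (G m)).
Proof.
move=> la; apply: cinfP => x; rewrite (pouE _ (pou_levelP x)).
transitivity (pou G (a x)); first by [].
rewrite (pouE (N := pou_level x)) ?la ?pou_levelP//.
rewrite /pou_sum !cfun_sum; apply: eq_bigr => i _ /=.
by rewrite la.
Qed.

(** A shift of [l] by 1 carries each bump to the next, so pullback only reindexes. Weighted sums of
    the translates of a form by the powers of a unit are therefore invariant under it. *)
Lemma pou_pull1 (a : aff V) G : (forall x, l (a x) = l x + 1) ->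
  pull a (pou G) = pou (fun m => pull a (G (m - 1))).
Proof.
move=> la; apply: cinfP => x; pose N := (pou_level x).+1.
have lN : `|l x| + 1 <= N%:R.
  by apply: le_trans (pou_levelP x) _; rewrite ler_nat.
have lN1 : `|l x| + 1 <= N.+1%:R by apply: le_trans lN _; rewrite ler_nat.
have laN : `|l (a x)| + 1 <= N%:R.
  rewrite -natr1 lerD2r la; apply: le_trans (pou_levelP x).
  by apply: le_trans (ler_normD _ _) _; rewrite normr1.
transitivity (pou G (a x)); first by [].
rewrite (pouE _ laN) (pouE _ lN1) /pou_sum; move: N lN lN1 laN => N lN lN1 laN.
(* The longer sum has two extra initial terms, at m = -N-1 and m = -N, which vanish at [x]. *)
rewrite doubleS [in RHS]big_nat_recl// [in RHS]big_nat_recl// !cfunD !cfun_sum.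
rewrite pou_term_out; last first.
  by rewrite sub0r mulrNz normrN [X in _ <= X]ger0_norm ?ler0z// -pmulrn.
rewrite (@pou_term_out N.+1 _ 1 x); last first.
  have -> : 1%:Z - N.+1%:Z = - N%:Z by lia.
  by rewrite mulrNz normrN [X in _ <= X]ger0_norm ?ler0z// -pmulrn.
rewrite !add0r; apply: eq_bigr => i _; rewrite /pou_term /=.
have -> : i.+2%:Z - N.+1%:Z = i%:Z - N%:Z + 1 by lia.
have E : (i%:Z - N%:Z + 1)%:~R = (i%:Z - N%:Z)%:~R + 1 :> R by rewrite intrD.
by rewrite addrK la E addrA addrAC.
Qed.

End PartitionOfUnity.

Lemma mx_continuous (R : realType) (V : topologicalType) (m n : nat) (g : V -> 'M[R]_(m, n)) :
  (forall i j, continuous (fun x => g x i j)) -> continuous g.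
Proof.
move=> gc x; apply/cvg_ballP => e e0; near=> y.
split=> //; near: y; apply: filter_forall => i; apply: filter_forall => j.
by have /cvg_ballP := gc i j x; exact.
Unshelve. all: by end_near. Qed.

(** * The invariant frame and the action of units *)

Section Frame.
Local Open Scope complex_scope.
Variables (R : realType) (s t : nat).
Local Notation E := 'M[R]_(s + t, 2).
Local Notation I := ('I_(s + t) * 'I_2)%type.
Implicit Types (l : I) (v p : E) (f : cinf E) (T : {set I}).

(* [zeta (i, 0)] and [zeta (i, 1)] are dx_i and dc_i at a real place i, and dz_i
   and d\bar z_i at a complex one; [frameD l] is the derivation dual to [zeta l]. *)
Definition coefB l (j : 'I_2) : R[i] :=
  if (l.1 < s)%N then (l.2 == j)%:R
  else if j == 0 then 1 else if l.2 == 0 then 'i else - 'i.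

(** The inverse transpose of [coefB] at each place; at a complex place these are the coefficients of
    the Wirtinger derivatives. *)
Definition coefA l (j : 'I_2) : R[i] :=
  if (l.1 < s)%N then (l.2 == j)%:R
  else if j == 0 then 2^-1 else if l.2 == 0 then - 'i / 2 else 'i / 2.

Definition zeta l v : R[i] := \sum_j coefB l j * (v l.1 j)%:C.

Lemma sumI2 (M : nmodType) (F : 'I_2 -> M) : \sum_j F j = F 0 + F 1.
Proof. by rewrite big_ord_recl big_ord1; congr (_ + F _); apply/val_inj. Qed.

Lemma I2P (j : 'I_2) : j = 0 \/ j = 1.
Proof.
by case: j => -[|[|//]] ij; [left|right]; apply/val_inj.
Qed.

Lemma coefAB i (k k' : 'I_2) :
  \sum_j coefA (i, k) j * coefB (i, k') j = (k == k')%:R.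
Proof.
rewrite sumI2 /coefA /coefB /=; case: ifP => _.
  by case: (I2P k) => ->; case: (I2P k') => -> /=; rewrite ?mulr0 ?mul0r ?mulr1 ?addr0 ?add0r.
have i2 : 'i * 'i = -1 :> R[i] by rewrite -expr2 sqr_i.
have h2 : 2^-1 + 2^-1 = 1 :> R[i] by field.
case: (I2P k) => ->; case: (I2P k') => -> /=; rewrite mulr1.
- by rewrite mulrAC mulNr i2 opprK mul1r.
- by rewrite mulrN mulrAC mulNr i2 opprK mul1r subrr.
- by rewrite mulrAC i2 mulN1r subrr.
- by rewrite mulrN mulrAC i2 mulN1r opprK.
Qed.

Lemma coefBA i (j j' : 'I_2) :
  \sum_k coefA (i, k) j * coefB (i, k) j' = (j == j')%:R.
Proof.
rewrite sumI2 /coefA /coefB /=; case: ifP => _.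
  by case: (I2P j) => ->; case: (I2P j') => -> /=; rewrite ?mulr0 ?mul0r ?mulr1 ?addr0 ?add0r.
have i2 : 'i * 'i = -1 :> R[i] by rewrite -expr2 sqr_i.
have h2 : 2^-1 + 2^-1 = 1 :> R[i] by field.
case: (I2P j) => ->; case: (I2P j') => -> /=.
- by rewrite mulr1.
- by rewrite mulrN subrr.
- by rewrite !mulr1 mulNr addNr.
- by rewrite mulrAC mulNr i2 opprK mul1r mulrN mulrAC i2 mulN1r opprK.
Qed.

Definition frameD l f : cinf E :=
  \sum_j coefA l j *: Der (delta_mx l.1 j) f.

Fact frameD_linear l : linear (frameD l).
Proof.
move=> c f g; rewrite /frameD scaler_sumr -big_split; apply: eq_bigr => j _.
by rewrite linearP scalerDr !scalerA mulrC.
Qed.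
HB.instance Definition _ l := GRing.isLinear.Build _ _ _ _ (frameD l) (frameD_linear l).

Lemma zeta_linear l (c : R) v w : zeta l (c *: v + w) = c%:C * zeta l v + zeta l w.
Proof.
rewrite /zeta mulr_sumr -big_split; apply: eq_bigr => j _ /=.
by rewrite !mxE rmorphD rmorphM mulrDr mulrCA.
Qed.

Lemma zeta_delta l i j : zeta l (delta_mx i j) = (l.1 == i)%:R * coefB l j.
Proof.
rewrite /zeta (bigD1 j)//= big1 ?addr0 => [|j' /negbTE jj'].
  by rewrite mxE eqxx andbT mulrC; case: eqP.
by rewrite mxE jj' andbF mulr0.
Qed.

Lemma Der_frame v f : Der v f = \sum_l zeta l v *: frameD l f.
Proof.
have -> : Der v f = \sum_(p : I) (v p.1 p.2)%:C *: Der (delta_mx p.1 p.2) f.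
  apply: cinfP => x; rewrite cfun_sum /=.
  rewrite -(cderive_sumv _ _ _ openT (smooth_cinf f) Logic.I).
  by rewrite [in LHS](matrix_sum_delta v) pair_big.
rewrite -(pair_bigA _ (fun i j => (v i j)%:C *: Der (delta_mx i j) f)) /=.
rewrite -(pair_bigA _ (fun i k => zeta (i, k) v *: frameD (i, k) f)) /=.
apply: eq_bigr => i _; rewrite /frameD /=.
under [RHS]eq_bigr do rewrite scaler_sumr.
rewrite exchange_big; apply: eq_bigr => j _ /=.
under eq_bigr do rewrite scalerA.
rewrite -scaler_suml; congr (_ *: _).
under eq_bigr do rewrite mulr_suml.
rewrite exchange_big /= (bigD1 j)//= [X in _ + X]big1 ?addr0 => [|j' jj'].
  transitivity ((\sum_k coefA (i, k) j * coefB (i, k) j) * (v i j)%:C).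
    by rewrite coefBA eqxx mul1r.
  by rewrite mulr_suml; apply: eq_bigr => k _; rewrite [RHS]mulrC mulrA.
under eq_bigr do rewrite mulrC mulrA.
by rewrite -mulr_suml coefBA eq_sym (negbTE jj') mul0r.
Qed.

Lemma frameD_comm l l' f : frameD l (frameD l' f) = frameD l' (frameD l f).
Proof.
rewrite /frameD; under eq_bigr do rewrite linear_sum scaler_sumr.
rewrite exchange_big; apply: eq_bigr => j _ /=; rewrite linear_sum scaler_sumr.
apply: eq_bigr => k _; rewrite !linearZ /= !scalerA mulrC; congr (_ *: _).
exact: Der_comm.
Qed.

Lemma frameD_ccst l c : frameD l (ccst _ c) = 0.
Proof. by rewrite /frameD big1 // => j _; rewrite Der_ccst scaler0. Qed.

Lemma frameD_Lint w (ww : weight w) e l f :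
  frameD l (Lint ww e f) = Lint ww e (frameD l f).
Proof.
rewrite /frameD linear_sum; apply: eq_bigr => j _.
by rewrite linearZ Der_Lint.
Qed.

(* The indices of the covectors dc_i. *)
Definition isc l : bool := (l.1 < s)%N && (l.2 == 1).

(** [vert] and [cvec] are complementary: the directions in which integers translate and those of the
    c_i. Only real places are tested because both columns of a complex place are vertical. *)
Definition vert v : Prop := forall i : 'I_(s + t), (i < s)%N -> v i 1 = 0.
Definition cvec v : Prop := forall (i : 'I_(s + t)) j, ~~ isc (i, j) -> v i j = 0.

Lemma zeta_vert l v : vert v -> isc l -> zeta l v = 0.
Proof.
case: l => i j vv /andP[/= si /eqP ->]; rewrite /zeta sumI2 /coefB /= si /=.
by rewrite vv// mulr0 mul0r addr0.
Qed.

Lemma zeta_cvec l v : cvec v -> ~~ isc l -> zeta l v = 0.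
Proof.
case: l => i j cv nl; rewrite /zeta; apply: big1 => k _ /=.
have [sc|/cv ->] := boolP (isc (i, k)); last by rewrite mulr0.
move: nl sc; rewrite /isc /coefB /= => nl /andP[si k1].
by move: nl; rewrite si /= (eqP k1) => /negbTE ->; rewrite mul0r.
Qed.

Lemma split_vert v : exists v1 v2, [/\ vert v1, cvec v2 & v = v1 + v2].
Proof.
exists (\matrix_(i, j) (if isc (i, j) then 0 else v i j)),
  (\matrix_(i, j) (if isc (i, j) then v i j else 0)); split.
- by move=> i si; rewrite mxE /isc /= si.
- by move=> i j /negbTE ij; rewrite mxE ij.
- by apply/matrixP => i j; rewrite !mxE; case: ifP; rewrite ?addr0 ?add0r.
Qed.

Lemma frameD_vert0 l f : ~~ isc l -> (forall v x, vert v -> f (v + x) = f x) ->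
  frameD l f = 0.
Proof.
move=> nl fv; rewrite /frameD; apply: big1 => j _.
have [sc|sc] := boolP (isc (l.1, j)).
  move: nl sc; rewrite /isc /coefA /= => nl /andP[si j1].
  by move: nl; rewrite si (eqP j1) /= => /negbTE ->; rewrite scale0r.
rewrite Der_inv0 ?scaler0// => r x; apply: fv => i si; rewrite !mxE.
move: sc; rewrite /isc /= [1 == j]eq_sym; case: (i =P l.1) => [<-|_]; last by rewrite mulr0.
by rewrite si /= => /negbTE ->; rewrite mulr0.
Qed.

Lemma frameD_cvec0 l f : isc l -> (forall v x, cvec v -> f (v + x) = f x) ->
  frameD l f = 0.
Proof.
move=> /andP[si l1] fv; rewrite /frameD sumI2 /coefA si (eqP l1) /= scale0r add0r.
rewrite Der_inv0 ?scaler0// => r x; apply: fv => i j sc; rewrite !mxE.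
case: (i =P l.1) => [il|]; last by rewrite mulr0.
case: (j =P 1) => [jl|]; last by rewrite andbF mulr0.
by move: sc; rewrite /isc /= il si jl.
Qed.

Lemma const_of_inv f : (forall v x, vert v -> f (v + x) = f x) ->
  (forall v x, cvec v -> f (v + x) = f x) -> f = ccst _ (f 0).
Proof.
move=> fv fc; apply: cinfP => x.
have [v1 [v2 [vv cv ->]]] := split_vert x.
by rewrite fv// -[v2]addr0 fc.
Qed.

Definition Kd (a : {set I} -> cinf E) : {set I} -> cinf E := kd frameD a.

End Frame.

Section Action.
Local Open Scope complex_scope.
Variables (R : realType) (s t : nat).
Local Notation E := 'M[R]_(s + t, 2).
Local Notation I := ('I_(s + t) * 'I_2)%type.
Local Notation Z := ('I_(s + t) -> R[i]).
Local Notation Re := (@complex.Re R).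
Local Notation Im := (@complex.Im R).
Implicit Types (l : I) (v p : E) (f : cinf E) (T : {set I}) (z : Z).

Definition positive_scale z : Prop :=
  forall i : 'I_(s + t), (i < s)%N -> Im (z i) = 0 /\ 0 < Re (z i).

(* The linear part of w |-> z w in the coordinates x_i, c_i = log Im w_i. *)
Definition log_lin z v : E := \matrix_(i, j)
  if (i < s)%N then (if j == 0 then Re (z i) * v i 0 else v i 1)
  else if j == 0 then Re (z i) * v i 0 - Im (z i) * v i 1
  else Re (z i) * v i 1 + Im (z i) * v i 0.

(** The translation part, from log Im (z w) = log z + log Im w for real z > 0. *)
Definition log_vec z : E := \matrix_(i, j) if isc (i, j) then ln (Re (z i)) else 0.

Definition log_fun z p : E := log_lin z p + log_vec z.

Fact log_lin_linear z (h : R) v x : log_lin z (h *: v + x) = h *: log_lin z v + log_lin z x.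
Proof.
apply/matrixP => i j; rewrite !mxE; case: ifP => _; case: ifP => _; ring.
Qed.

Fact log_affP z (h : R) v x : log_fun z (h *: v + x) = h *: log_lin z v + log_fun z x.
Proof. by rewrite /log_fun log_lin_linear addrA. Qed.

Fact log_cont z : continuous (log_fun z).
Proof.
apply: mx_continuous => i j x.
have c0 := @coord_continuous R (s + t) 2 i 0 x.
have c1 := @coord_continuous R (s + t) 2 i 1 x.
have cM (k : R) (g : E -> R) : {for x, continuous g} -> {for x, continuous (fun y => k * g y)}.
  move=> gc; exact: (cvgM (@cvg_cst _ k _ (nbhs x) _) gc).
rewrite /log_fun /log_lin /log_vec.
under eq_fun do rewrite !mxE.
pose g (y : E) := if (i < s)%N then (if j == 0 then Re (z i) * y i 0 else y i 1)
  else if j == 0 then Re (z i) * y i 0 - Im (z i) * y i 1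
  else Re (z i) * y i 1 + Im (z i) * y i 0.
have gx : {for x, continuous g}.
  rewrite /g; case: (i < s)%N; case: (j == 0).
  - exact: cM.
  - exact: c1.
  - exact: (cvgB (cM _ _ c0) (cM _ _ c1)).
  - exact: (cvgD (cM _ _ c1) (cM _ _ c0)).
exact: (cvgD gx (@cvg_cst _ (if isc (i, j) then ln (Re (z i)) else 0) _ (nbhs x) _)).
Qed.

Definition log_act z : aff E := Aff (@log_cont z) (@log_affP z).

(** The eigenvalue of the action on the covector [l]: dx_i and dz_i are multiplied by z_i, d\bar z_i
    by its conjugate, and dc_i is fixed because c_i is only translated. *)
Definition wt z l : R[i] :=
  if (l.1 < s)%N then (if l.2 == 0 then z l.1 else 1)
  else if l.2 == 0 then z l.1 else conjc (z l.1).

Definition wts z T : R[i] := \prod_(l in T) wt z l.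

Lemma zeta_log_lin z l v : positive_scale z ->
  zeta l (log_lin z v) = wt z l * zeta l v.
Proof.
move=> pz; case: l => i j; rewrite /zeta /wt !sumI2 /coefB /= !mxE /=.
case: ifP => si.
  have [z0 _] := pz i si; case: (I2P j) => -> /=.
    rewrite !mul1r !mul0r !addr0; apply/eqP; rewrite eq_complex; case: (z i) z0 => a b /= ->.
    by rewrite !mul0r mulr0 subr0 addr0 eqxx /=.
  by rewrite !mul0r !mul1r.
case: (z i) => a b; case: (I2P j) => -> /=; apply/eqP; rewrite eq_complex /=;
  by apply/andP; split; apply/eqP; ring.
Qed.

Lemma frameD_zeta l f : frameD l f = \sum_j coefA R l j *: Der (delta_mx l.1 j) f.
Proof. by []. Qed.

Lemma frameD_pull z l f : positive_scale z ->
  frameD l (pull (log_act z) f) = wt z l *: pull (log_act z) (frameD l f).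
Proof.
move=> pz; case: l => i k; rewrite frameD_zeta.
under eq_bigr do rewrite Der_pull Der_frame linear_sum scaler_sumr.
rewrite exchange_big (bigD1 (i, k))//= [X in _ + X]big1 ?addr0 => [|[i' k'] ll'].
  under eq_bigr do rewrite linearZ zeta_log_lin// zeta_delta eqxx mul1r scalerA mulrCA.
  by rewrite -scaler_suml -mulr_sumr coefAB eqxx mulr1.
under eq_bigr do rewrite linearZ zeta_log_lin// zeta_delta scalerA.
rewrite -scaler_suml.
suff -> : \sum_j coefA R (i, k) j * (wt z (i', k') * ((i' == i)%:R * coefB R (i', k') j)) = 0.
  by rewrite scale0r.
have [e1|_] := eqVneq i' i; last by rewrite big1// => j _; rewrite mul0r !mulr0.
have e2 : k' != k by apply: contraNneq ll' => e2; rewrite e1 e2.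
under eq_bigr do rewrite mul1r mulrCA.
by rewrite -mulr_sumr e1 coefAB eq_sym (negbTE e2) mulr0.
Qed.

(** On functions invariant under vertical translations the action thus reduces to a translation in
    the c_i. *)
Lemma log_act_split z p : exists2 v, vert v & log_act z p = v + (log_vec z + p).
Proof.
exists (log_lin z p - p).
  by move=> i si; rewrite !mxE si subrr.
by rewrite [log_vec z + p]addrC addrA subrK.
Qed.

Lemma cvec_log_vec z : cvec (log_vec z).
Proof. by move=> i j /negbTE ij; rewrite mxE ij. Qed.

Lemma log_actM z z' p : positive_scale z -> positive_scale z' ->
  log_act (fun i => z i * z' i) p = log_act z (log_act z' p).
Proof.
move=> pz pz'; apply/matrixP => i j; rewrite /= /log_fun !mxE /isc /=.
case: ifP => si; last first.
  by case: (z i) => a b; case: (z' i) => c d; case: ifP => _ /=; ring.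
have [z0 z1] := pz i si; have [z0' z1'] := pz' i si.
case: (z i) z0 z1 => a b /= -> a0; case: (z' i) z0' z1' => c d /= -> c0.
rewrite mulr0 subr0 lnM//; case: (I2P j) => -> /=; ring.
Qed.

Lemma log_act1 p : log_act (fun=> 1) p = p.
Proof.
apply/matrixP => i j; rewrite /= /log_fun !mxE /= ln1 if_same addr0.
by case: (I2P j) => ->; case: ifP => _ /=; ring.
Qed.

Lemma wtM z z' l : wt (fun i => z i * z' i) l = wt z l * wt z' l.
Proof. by rewrite /wt; case: ifP => _; case: ifP => _; rewrite ?mulr1 ?rmorphM. Qed.

Lemma wtsM z z' T : wts (fun i => z i * z' i) T = wts z T * wts z' T.
Proof. by rewrite /wts -big_split; apply: eq_bigr => l _; exact: wtM. Qed.

Lemma wts1 T : wts (fun=> 1) T = 1.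
Proof.
by rewrite /wts big1// => l _; rewrite /wt; case: ifP => _; case: ifP => _ //; rewrite rmorph1.
Qed.

(* The action of a unit on coefficients: its fixed points are the forms with
   values in the flat bundle whose character takes the value r. *)
Definition tw z (r : R[i]) (a : {set I} -> cinf E) T : cinf E :=
  (r^-1 * wts z T) *: pull (log_act z) (a T).

Lemma twM z z' r r' a : positive_scale z -> positive_scale z' ->
  tw (fun i => z i * z' i) (r * r') a = tw z r (tw z' r' a).
Proof.
move=> pz pz'; apply/funext => T; rewrite /tw linearZ scalerA wtsM invfM mulrACA.
congr (_ *: _); apply: cinfP => p.
transitivity (a T (log_act (fun i => z' i * z i) p)).
  by rewrite /=; congr (a T (log_fun _ _)); apply/funext => i; rewrite mulrC.
by rewrite log_actM.
Qed.

Lemma tw1 a : tw (fun=> 1) 1 a = a.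
Proof.
apply/funext => T; rewrite /tw wts1 invr1 mulr1 scale1r; apply: cinfP => p.
by rewrite /= -[log_fun _ p]/(log_act _ p) log_act1.
Qed.

Local Notation d := (@Kd R s t).

(** The derivation along [l] picks up the weight of [l], which completes the weight of [T :\ l] to
    that of [T]. *)
Lemma kd_tw z r a : positive_scale z -> d (tw z r a) = tw z r (d a).
Proof.
move=> pz; apply/funext => T; rewrite /Kd /kd /tw linear_sum scaler_sumr.
apply: eq_bigr => l lT; rewrite !linearZ /= frameD_pull// !scalerA mulrC -!mulrA.
congr (_ *: _); have -> : wts z T = wt z l * wts z (T :\ l)%SET.
  by rewrite /wts (finset.big_setD1 l).
by ring.
Qed.

End Action.

(** * Iterated means along a list of vectors *)

Section Means.
Variables (R : realType) (V : normedModType R).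
Implicit Types (f g : cinf V) (x v e : V) (es : seq V).

Definition invar (L : set V) f : Prop := forall v, L v -> forall x, f (v + x) = f x.

Lemma invar0 L : invar L 0. Proof. by []. Qed.

Lemma invarD L f g : invar L f -> invar L g -> invar L (f + g).
Proof. by move=> lf lg v Lv x; rewrite !cfunD lf// lg. Qed.

Lemma invarZ L c f : invar L f -> invar L (c *: f).
Proof. by move=> lf v Lv x; rewrite !cfunZ lf. Qed.

Lemma invarB L f g : invar L f -> invar L g -> invar L (f - g).
Proof. by move=> lf lg v Lv x; rewrite !cfunB lf// lg. Qed.

Lemma invar_sum L (J : Type) (r : seq J) (Q : pred J) (F : J -> cinf V) :
  (forall j, Q j -> invar L (F j)) -> invar L (\sum_(j <- r | Q j) F j).
Proof. by move=> lF; apply: (big_ind (invar L)) => //; exact: invarD. Qed.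

Lemma invar_Lint L w (ww : weight w) e f : invar L f -> invar L (Lint ww e f).
Proof. by move=> lf v Lv; apply: Lint_inv; exact: lf. Qed.

Lemma invar_sub L L' f : L' `<=` L -> invar L f -> invar L' f.
Proof. by move=> LL' lf v /LL'; exact: lf. Qed.

Fixpoint mseq es f : cinf V := if es is e :: es' then mean e (mseq es' f) else f.

Fact mseq_linear es : linear (mseq es).
Proof. by elim: es => //= e es IH c f g; rewrite IH linearP. Qed.
HB.instance Definition _ es := GRing.isLinear.Build _ _ _ _ (mseq es) (mseq_linear es).

Lemma invar_mseq L es f : invar L f -> invar L (mseq es f).
Proof. by elim: es => //= e es IH lf; apply: invar_Lint; exact: IH. Qed.

Lemma Der_mseq v es f : Der v (mseq es f) = mseq es (Der v f).
Proof. by elim: es => //= e es IH; rewrite Der_Lint IH. Qed.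

(** Each mean makes the function constant along its own vector, and the means taken afterwards
    preserve this. *)
Lemma mseq_line es f : (forall e, e \in es -> forall x, f (e + x) = f x) ->
  forall e, e \in es -> forall (r : R) x, mseq es f (r *: e + x) = mseq es f x.
Proof.
elim: es => //= e es IH fe e'; rewrite inE => /orP[/eqP ->|e'es] r x.
  apply: mean_inv => y; apply: (@invar_mseq [set e]) => // v -> z.
  by apply: fe; rewrite mem_head.
have H y : mseq es f (r *: e' + y) = mseq es f y.
  by apply: IH => // e'' e''es; apply: fe; rewrite inE e''es orbT.
exact: (Lint_inv (weight1 R) e H x).
Qed.

Lemma mseq_id es f : (forall e, e \in es -> forall (r : R) x, f (r *: e + x) = f x) ->
  mseq es f = f.
Proof.
elim: es => //= e es IH fe; rewrite IH => [|e' e'es]; last first.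
  by apply: fe; rewrite inE e'es orbT.
by apply: mean_id; apply: fe; rewrite mem_head.
Qed.

Lemma mseq_pull (a : aff V) es f :
  mseq es (pull a f) = pull a (mseq [seq alin a e | e <- es] f).
Proof. by elim: es => //= e es ->; rewrite /mean Lint_pull. Qed.

Lemma sum_inv (n : nat) (r : 'I_n -> R) (e : 'I_n -> V) f :
  (forall i (c : R) x, f (c *: e i + x) = f x) ->
  forall x, f (\sum_i r i *: e i + x) = f x.
Proof.
move=> fe; suff H (s : seq 'I_n) : forall x, f (\sum_(i <- s) r i *: e i + x) = f x.
  by move=> x; exact: H.
elim: s => [|i s IH] x; first by rewrite big_nil add0r.
by rewrite big_cons -addrA fe.
Qed.

Definition spans es (W : set V) : Prop := forall v, W v ->
  exists r : 'I_(size es) -> R, v = \sum_(i < size es) r i *: tnth (in_tuple es) i.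

Lemma mseq_invar es (L W : set V) f : spans es W -> (forall e, e \in es -> L e) ->
  invar L f -> invar W (mseq es f).
Proof.
move=> sp esL lf v Wv x; have [r ->] := sp v Wv; apply: sum_inv => i c y.
apply: mseq_line; last exact: mem_tnth.
by move=> e /esL Le z; exact: lf.
Qed.

(* Both means annihilate exact derivatives and fix constants along [W]. *)
Lemma mseq_unique es es' (L W : set V) f : L `<=` W ->
  spans es W -> spans es' W ->
  (forall e, e \in es -> L e) -> (forall e, e \in es' -> L e) ->
  (forall r v, W v -> W (r *: v)) ->
  invar L f -> mseq es f = mseq es' f.
Proof.
move=> LW sp sp' esL es'L WZ lf.
have kill e g : L e -> invar L g -> mseq es' (Der e g) = 0.
  move=> Le lg; rewrite -Der_mseq; apply: Der_inv0 => r x.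
  by apply: (mseq_invar sp' es'L lg); apply/WZ/LW.
have H : mseq es' (mseq es f) = mseq es' f.
  elim: es esL {sp} => //= e es IH esL.
  have Le : L e by apply: esL; rewrite mem_head.
  rewrite -IH => [|e' e'es]; last by apply: esL; rewrite inE e'es orbT.
  have lg := invar_mseq es lf; move: (mseq es f) lg => g lg.
  have /(congr1 (mseq es')) := Der_mean' (fun x => lg e Le x).
  rewrite kill; last 2 first; [by []|exact: invar_Lint|].
  by rewrite linearB => /esym/eqP; rewrite subr_eq0 => /eqP ->.
rewrite -H [RHS]mseq_id// => e es'e r x.
by apply: (mseq_invar sp esL lf); apply/WZ/LW/es'L.
Qed.

End Means.

(** * The homotopy between a closed form and its mean *)

Section MeanHomotopy.
Variables (R : realType) (s t : nat).
Local Notation E := 'M[R]_(s + t, 2).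
Local Notation I := ('I_(s + t) * 'I_2)%type.
Local Notation d := (@Kd R s t).
Implicit Types (a b : {set I} -> cinf E) (T : {set I}).

Lemma kd_map (phi : {linear cinf E -> cinf E}) a T :
  (forall l f, frameD l (phi f) = phi (frameD l f)) ->
  d (fun T => phi (a T)) T = phi (d a T).
Proof.
move=> H; rewrite /Kd /kd linear_sum; apply: eq_bigr => l _.
by rewrite /= H linearZ.
Qed.

Lemma kdD a b T : d (fun T => a T + b T) T = d a T + d b T.
Proof. by rewrite /Kd /kd -big_split; apply: eq_bigr => l _; rewrite linearD scalerDr. Qed.

Lemma kdZ c a T : d (fun T => c *: a T) T = c *: d a T.
Proof.
by rewrite /Kd /kd scaler_sumr; apply: eq_bigr => l _; rewrite linearZ !scalerA mulrC.
Qed.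

Lemma kdN a T : d (fun T => - a T) T = - d a T.
Proof. by rewrite /Kd /kd -sumrN; apply: eq_bigr => l _; rewrite linearN scalerN. Qed.

Lemma kd0 T : d (fun=> 0) T = 0.
Proof. by rewrite /Kd /kd big1// => l _; rewrite linear0 scaler0. Qed.

Lemma frameD_mseq l es f : frameD l (mseq es f) = mseq es (frameD l f) :> cinf E.
Proof. by elim: es => //= e es IH; rewrite frameD_Lint IH. Qed.

Definition cone e (phi : cinf E -> cinf E) a := ki (fun l => zeta l e) (fun T => phi (a T)).

(** For a closed form one half of Cartan's formula drops out, so contraction yields a primitive of
    the Lie derivative along [e]. *)
Lemma cone_cartan e (phi : {linear cinf E -> cinf E}) a T :
  (forall l f, frameD l (phi f) = phi (frameD l f)) -> (forall T, d a T = 0) ->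
  d (cone e phi a) T = Der e (phi (a T)).
Proof.
move=> phiD a0; rewrite Der_frame.
have C : d (cone e phi a) T + ki (fun l => zeta l e) (d (fun T => phi (a T))) T =
    \sum_l zeta l e *: frameD l (phi (a T)).
  exact: (cartan (@frameD R s t) (fun l => zeta l e) (fun T => phi (a T)) T).
rewrite [X in _ + X]big1 ?addr0 in C; first exact: C.
by move=> l _; rewrite kd_map// a0 linear0 scaler0.
Qed.

Lemma mean_homotopy (P Q : ({set I} -> cinf E) -> Prop) es a :
  (forall e a, e \in es -> P a -> forall T x, a T (e + x) = a T x) ->
  (forall e a, e \in es -> P a -> P (fun T => mean e (a T))) ->
  (forall e a, e \in es -> P a -> Q (cone e (mean' e) a)) ->
  Q (fun=> 0) -> (forall a b, Q a -> Q b -> Q (fun T => a T + b T)) ->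
  P a -> (forall T, d a T = 0) ->
  exists b, [/\ Q b, P (fun T => mseq es (a T)) &
    forall T, a T = mseq es (a T) + d b T].
Proof.
elim: es => [|e es IH] Pe Pm PQ Q0 QD Pa a0.
  by exists (fun=> 0); split=> // T; rewrite kd0 addr0.
have es1 e' : e' \in es -> e' \in e :: es by rewrite inE => ->; rewrite orbT.
have [|||b [Qb Pb Eb]] := IH _ _ _ Q0 QD Pa a0.
- by move=> e' a' /es1; exact: Pe.
- by move=> e' a' /es1; exact: Pm.
- by move=> e' a' /es1; exact: PQ.
have hd := mem_head e es.
(* The part of the primitive that belongs to [e] is contracted from the form already averaged along
   the other vectors. *)
exists (fun T => b T + cone e (mean' e) (fun T => mseq es (a T)) T); split.
- by apply: QD => //; exact: PQ.
- exact: Pm.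
move=> T; rewrite kdD addrCA cone_cartan; last 2 first.
- by move=> l f; exact: frameD_Lint.
- by move=> T'; rewrite kd_map ?a0 ?linear0// => l f; exact: frameD_mseq.
have DM := Der_mean' (fun x => Pe _ _ hd Pb T x).
transitivity (mseq es (a T) + d b T); first exact: Eb.
rewrite [X in _ + (_ + X)]DM [mseq (e :: es) _]/(mean e (mseq es (a T))).
by rewrite [X in _ = _ + X]addrC subrK addrC.
Qed.

End MeanHomotopy.

(** * Equivariant cohomology in logarithmic coordinates *)

Section Core.
Local Open Scope complex_scope.
Variables (R : realType) (s t : nat).
Local Notation E := 'M[R]_(s + t, 2).
Local Notation I := ('I_(s + t) * 'I_2)%type.
Local Notation Z := ('I_(s + t) -> R[i]).
Local Notation d := (@Kd R s t).
Implicit Types (a b : {set I} -> cinf E) (T S : {set I}) (v x : E) (l : I).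

(** [L] stands for the image of O_K and [es] for a list of its vectors that spans the vertical
    space; [zs j] and [rs j] are the embeddings and the value of rho at the j-th generator of U, and
    the [ll j] are the coordinates dual to the vectors [log_vec (zs k)]. *)
Variables (L : set E) (es : seq E) (zs : 'I_s -> Z) (rs : 'I_s -> R[i]).
Variable ll : 'I_s -> E -> R.

Definition zpow (j : 'I_s) (m : int) : Z := fun i => zs j i ^ m.

Hypotheses (zpos : forall j, positive_scale (zs j)) (z0 : forall j i, zs j i != 0).
Hypothesis r0 : forall j, rs j != 0.
Hypothesis Lvert : L `<=` @vert R s t.
Hypothesis Lstab : forall j m v, L v -> L (log_lin (zpow j m) v).
Hypothesis esL : forall e, e \in es -> L e.
Hypothesis esspan : spans es (@vert R s t).
Hypothesis esspan' : forall j, spans [seq log_lin (zs j) e | e <- es] (@vert R s t).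
Hypothesis lcont : forall j, continuous (ll j).
Hypothesis llin : forall j (h : R) v x, ll j (h *: v + x) = h * ll j v + ll j x.
Hypothesis lvert : forall j v, vert v -> ll j v = 0.
Hypothesis llog : forall j k, ll j (log_vec (zs k)) = (j == k)%:R.
Hypothesis cspan : forall v, cvec v -> v = \sum_k ll k v *: log_vec (zs k).

Lemma real_positive (z : R[i]) : complex.Im z = 0 -> 0 < complex.Re z ->
  forall m : int, complex.Im (z ^ m) = 0 /\ 0 < complex.Re (z ^ m).
Proof.
case: z => x y /= -> x0 m.
have -> : (x +i* 0) ^ m = (x ^ m)%:C by rewrite fmorphXz.
by split=> //=; rewrite exprz_gt0.
Qed.

Lemma zpow_pos j m : positive_scale (zpow j m).
Proof. by move=> i /zpos-/(_ j)[z1 z2]; exact: real_positive. Qed.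

Lemma zpow1 j : zpow j 1 = zs j.
Proof. by apply/funext => i; rewrite /zpow expr1z. Qed.

Definition twp j m a := tw (zpow j m) (rs j ^ m) a.
Definition inv j a : Prop := tw (zs j) (rs j) a = a.
Definition Linv a : Prop := forall T, invar L (a T).

Lemma twpSl j m a : twp j (m + 1) a = tw (zs j) (rs j) (twp j m a).
Proof.
rewrite /twp -twM//; last exact: zpow_pos.
rewrite exprzDr ?unitfE ?r0// expr1z [_ * rs j]mulrC; congr (tw _ _ a).
by apply/funext => i; rewrite /zpow exprzDr ?unitfE ?z0// expr1z mulrC.
Qed.

Lemma twpSr j m a : twp j (m + 1) a = twp j m (tw (zs j) (rs j) a).
Proof.
rewrite /twp -twM//; last exact: zpow_pos.
rewrite exprzDr ?unitfE ?r0// expr1z; congr (tw _ _ a).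
by apply/funext => i; rewrite /zpow exprzDr ?unitfE ?z0// expr1z.
Qed.

Lemma twp0 j a : twp j 0 a = a.
Proof. by rewrite -[RHS]tw1 /twp; congr (tw _ _ a). Qed.

Lemma twp_inv j m a : inv j a -> twp j m a = a.
Proof.
move=> ja; have st n : twp j (n + 1) a = twp j n a by rewrite twpSr ja.
elim/int_rect: m => [|n IH|n IH]; first exact: twp0.
- have -> : n.+1%:Z = n%:Z + 1 by lia.
  by rewrite st.
- rewrite -st; have -> : - n.+1%:Z + 1 = - n%:Z by lia.
  exact: IH.
Qed.

Lemma llD j x y : ll j (x + y) = ll j x + ll j y.
Proof. by rewrite -[x in LHS]scale1r llin mul1r. Qed.

Lemma ll_act j k x : ll j (log_act (zs k) x) = ll j x + (j == k)%:R.
Proof.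
have [v vv ->] := log_act_split (zs k) x.
by rewrite !llD lvert// llog add0r addrC.
Qed.

(* Translates of [a] by the powers of the j-th unit, weighted by the partition
   of unity in the coordinate [ll j]. *)
Definition Ej j a T : cinf E := pou (@lcont j) (@llin j) (fun m => twp j m a T).

Lemma pouZ j (c : R[i]) G :
  c *: pou (@lcont j) (@llin j) G = pou (@lcont j) (@llin j) (fun m => c *: G m).
Proof.
have := pou_additive (@lcont j) (@llin j) G (fun=> 0) c.
rewrite pou_cst addr0 => <-; congr pou.
by apply/funext => m; rewrite addr0.
Qed.

Lemma Ej_inv j a : inv j (Ej j a).
Proof.
apply/funext => T; rewrite /tw /Ej pou_pull1; last by move=> x; rewrite ll_act eqxx.
rewrite pouZ; congr pou; apply/funext => m.
by rewrite -[m in RHS](subrK 1) twpSl.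
Qed.

(** The units commute, and the k-th one does not move the coordinate [ll j]. The generators can
    therefore be averaged one after another. *)
Lemma Ej_inv' j k a : k != j -> inv k a -> inv k (Ej j a).
Proof.
move=> kj ka; apply/funext => T; rewrite /tw /Ej pou_pull0; last first.
  by move=> x; rewrite ll_act eq_sym (negbTE kj) addr0.
rewrite pouZ; congr pou; apply/funext => m.
transitivity (tw (zs k) (rs k) (twp j m a) T) => //.
rewrite -{2}ka /twp -!twM//; try exact: zpow_pos.
rewrite [in RHS]mulrC; congr (tw _ _ a T).
by apply/funext => i; rewrite mulrC.
Qed.

Lemma Ej_fix j a b T : a T = b T -> inv j b -> Ej j a T = a T.
Proof.
move=> ab jb; rewrite -[RHS](pou_cst (@lcont j) (@llin j)); congr pou.
apply/funext => m; rewrite ab -[in RHS](twp_inv m jb).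
by rewrite /twp /tw ab.
Qed.

Lemma Ej0 j a T : a T = 0 -> Ej j a T = 0.
Proof.
move=> aT; rewrite -[RHS](pou_cst (@lcont j) (@llin j)); congr pou.
by apply/funext => m; rewrite /twp /tw aT linear0 scaler0.
Qed.

Lemma Ej_L j a : Linv a -> Linv (Ej j a).
Proof.
move=> La T v Lv; apply/pull_transP; rewrite /Ej pou_pull0; last first.
  by move=> x; rewrite /= llD lvert ?add0r//; exact: Lvert.
congr pou; apply/funext => m; apply/pull_transP.
apply: (@invarZ _ _ [set v]) => // _ -> x.
rewrite [LHS]/(a T (log_act _ _)) -[v]scale1r affP scale1r.
exact: (La T _ (Lstab j m Lv)).
Qed.

Lemma frameD_pou j l G : ~~ isc l ->
  frameD l (pou (@lcont j) (@llin j) G) = pou (@lcont j) (@llin j) (fun m => frameD l (G m)).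
Proof.
move=> nl; rewrite /frameD pou_sumv; apply: eq_bigr => k _.
have [sc|sc] := boolP (isc (l.1, k)).
  move: nl sc; rewrite /isc /coefA /= => nl /andP[si j1].
  by move: nl; rewrite si (eqP j1) /= => /negbTE ->; rewrite !scale0r.
rewrite Der_pou//; apply: lvert => i si; rewrite mxE.
move: sc; rewrite /isc /= [1 == k]eq_sym; case: (i =P l.1) => [<-|//].
by rewrite si /= => /negbTE ->.
Qed.

(** The bumps depend on the c_i alone, so their derivatives enter the coefficient at [T] only
    through [a (T :\ l)] with [l] one of the dc_i; the hypothesis removes these terms. *)
Lemma Ej_kd j a T : (forall l, l \in T -> isc l -> a (T :\ l) = 0) ->
  d (Ej j a) T = Ej j (d a) T.
Proof.
move=> aT.
have -> : Ej j (d a) T = pou (@lcont j) (@llin j) (fun m =>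
    \sum_(l in T) sgn _ l T *: frameD l (twp j m a (T :\ l))).
  by congr pou; apply/funext => m; rewrite /twp -kd_tw//; exact: zpow_pos.
rewrite pou_sumv; apply: eq_bigr => l lT; congr (_ *: _).
have [sc|sc] := boolP (isc l); last exact: frameD_pou.
rewrite Ej0 ?aT// linear0 -[LHS](pou_cst (@lcont j) (@llin j)); congr pou.
by apply/funext => m; rewrite /twp /tw aT// linear0 scaler0 linear0.
Qed.

Definition cosize T : nat := #|[set l in T | isc l]%SET|.
Definition deg k a : Prop := forall T, #|T| <> k -> a T = 0.
(** Degree k - 1, written with a successor so that k = 0 forces the zero form. *)
Definition degS k a : Prop := forall T, #|T|.+1 <> k -> a T = 0.
Definition filt p a : Prop := forall T, (cosize T < p)%N -> a T = 0.

Lemma cone_deg k e (phi : {linear cinf E -> cinf E}) a :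
  deg k a -> degS k (cone e phi a).
Proof.
move=> ka T Tk; rewrite /cone /ki big1// => l; rewrite finset.inE => lT.
by rewrite ka ?linear0 ?scaler0// finset.cardsU1 lT.
Qed.

Lemma cone_L e (phi : {linear cinf E -> cinf E}) a :
  (forall f, invar L f -> invar L (phi f)) -> Linv a -> Linv (cone e phi a).
Proof. by move=> H La T; apply: invar_sum => l _; apply: invarZ; exact: H. Qed.

(** Contraction with a vertical vector removes no dc_i. *)
Lemma cone_filt p e (phi : {linear cinf E -> cinf E}) a :
  vert e -> filt p a -> filt p (cone e phi a).
Proof.
move=> ve pa T Tp; rewrite /cone /ki big1// => l; rewrite finset.inE => lT.
have [sc|sc] := boolP (isc l); first by rewrite zeta_vert// mul0r scale0r.
rewrite pa ?linear0 ?scaler0//; apply: leq_ltn_trans Tp; apply: subset_leq_card.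
apply/fintype.subsetP => k; rewrite !finset.inE => /andP[/orP[/eqP ->|->//]].
by rewrite (negbTE sc).
Qed.

(** A unit preserves [L] but replaces [es] by another spanning list of vectors of [L]; by
    [mseq_unique] the mean along it is the same. *)
Lemma mseq_inv j a : Linv a -> inv j a -> inv j (fun T => mseq es (a T)).
Proof.
move=> La ja; apply/funext => T; rewrite /tw -[in RHS]ja /tw linearZ /= mseq_pull.
congr (_ *: pull _ _); apply: (mseq_unique (L := L) (W := @vert R s t)) => //.
- exact: esspan'.
- by move=> e /mapP[e' e'es ->]; rewrite /= -zpow1; apply/Lstab/esL.
- by move=> r v vv i si; rewrite mxE vv// mulr0.
Qed.

(* The error of the equivariant averaging involves one more dc_i, so the vertical
   average is exact up to terms of higher [cosize]. *)
Lemma filtration_step p k a : (forall T, d a T = 0) -> Linv a ->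
  (forall j, inv j a) -> deg k a -> filt p a ->
  exists b, [/\ Linv b, forall j, inv j b, degS k b &
    filt p.+1 (fun T => a T - mseq es (a T) - d b T)].
Proof.
move=> a0 La ja ka pa.
(* [n] counts the generators under which the primitive is already invariant. The equation is
   demanded only for [cosize T <= p], since the averaging may spoil it beyond. *)
suff H n : (n <= s)%N -> exists b, [/\ Linv b, forall j : 'I_s, (j < n)%N -> inv j b,
    degS k b, filt p b & forall T, (cosize T <= p)%N -> d b T = a T - mseq es (a T)].
  have [b [Lb jb kb pb Eb]] := H s (leqnn s).
  by exists b; split=> // [j|T]; [exact: jb|rewrite ltnS => /Eb ->; rewrite subrr].
elim: n => [|n IH] ns.
  have [||||||b [[Lb kb pb] _ Eb]] := @mean_homotopy R s t
    (fun a => [/\ Linv a, deg k a & filt p a])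
    (fun b => [/\ Linv b, degS k b & filt p b]) es a _ _ _ _ _ _ a0.
  - by move=> e a' /esL Le [La' _ _] T; exact: La'.
  - move=> e a' /esL Le [La' ka' pa']; split=> T.
    + exact/invar_Lint/La'.
    + by move=> /ka' ->; rewrite linear0.
    + by move=> /pa' ->; rewrite linear0.
  - move=> e a' /esL Le [La' ka' pa']; split.
    + by apply: cone_L => // f; exact: invar_Lint.
    + exact: cone_deg.
    + by apply: cone_filt => //; exact: Lvert.
  - by split=> // T; exact: invar0.
  - move=> b b' [h1 h2 h3] [h1' h2' h3']; split=> T.
    + exact: invarD.
    + by move=> H; rewrite h2// h2'// addr0.
    + by move=> H; rewrite h3// h3'// addr0.
  - by split.
  exists b; split=> // T _.
  by apply/esym/eqP; rewrite subr_eq addrC; apply/eqP; exact: Eb.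
have [b [Lb jb kb pb Eb]] := IH (ltnW ns); pose j := Ordinal ns.
exists (Ej j b); split.
- exact: Ej_L.
- move=> i; rewrite ltnS leq_eqVlt => /orP[/eqP ij|ij].
    have -> : i = j by exact/val_inj.
    exact: Ej_inv.
  apply: Ej_inv'; last exact: jb.
  by apply: contraTneq ij => ->; rewrite ltnn.
- by move=> T /kb; exact: Ej0.
- by move=> T /pb; exact: Ej0.
(* Dropping a dc_i from such a [T] leaves [cosize] below [p], where [b] vanishes, so [Ej] commutes
   with [d] here. *)
move=> T Tp; rewrite Ej_kd; last first.
  move=> l lT sc; apply: pb; apply: leq_trans Tp.
  apply: proper_card; apply/properP; split.
    by apply/fintype.subsetP => l'; rewrite !finset.inE => /andP[/andP[_ ->] ->].
  by exists l; rewrite !finset.inE ?lT// eqxx.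
(* The right-hand side is already invariant, and the partition sums to 1. *)
rewrite (@Ej_fix j _ (fun T => a T - mseq es (a T))) ?Eb//.
apply/funext => T'; rewrite /tw linearB scalerBr.
have := congr1 (fun f => f T') (mseq_inv La (ja j)); rewrite /tw => ->.
by have := congr1 (fun f => f T') (ja j); rewrite /tw => ->.
Qed.

Lemma spans_enum (V : normedModType R) (J : finType) (c : J -> R) (g : J -> V) :
  exists r : 'I_(size [seq g j | j <- enum J]) -> R,
    \sum_j c j *: g j = \sum_i r i *: tnth (in_tuple [seq g j | j <- enum J]) i.
Proof.
pose ca := cast_ord (size_map g (enum J)).
exists (fun i => c (tnth (in_tuple (enum J)) (ca i))).
rewrite -big_enum /= big_tnth (reindex ca) /=; last first.
  exists (cast_ord (esym (size_map g (enum J)))) => i _; first exact: cast_ordK.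
  exact: cast_ordKV.
apply: eq_bigr => i _; congr (_ *: _).
have j0 : J := tnth (in_tuple (enum J)) (ca i).
rewrite (tnth_nth j0) (tnth_nth (g j0)) /= (nth_map j0)//.
by rewrite -(size_map g).
Qed.

Lemma d_sub a b T : d (fun T => a T - b T) T = d a T - d b T.
Proof.
have -> : (fun T => a T - b T) = (fun T => a T + (fun T => - b T) T) by [].
by rewrite kdD kdN.
Qed.

Lemma d_d a T : d (d a) T = 0.
Proof. exact: (kd_kd (D := @frameD R s t) a T (fun l l' f => frameD_comm l l' f)). Qed.

Lemma inv_add j a b : inv j a -> inv j b -> inv j (fun T => a T + b T).
Proof.
move=> ja jb; apply/funext => T; rewrite -[in RHS]ja -[in RHS]jb /tw.
by rewrite linearD scalerDr.
Qed.

Lemma inv_scale j c a : inv j a -> inv j (fun T => c *: a T).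
Proof.
move=> ja; apply/funext => T; rewrite -[in RHS]ja /tw linearZ !scalerA.
by rewrite mulrC.
Qed.

Lemma inv_opp j a : inv j a -> inv j (fun T => - a T).
Proof.
move=> /(inv_scale (-1)); congr inv; apply/funext => T; by rewrite scaleN1r.
Qed.

Lemma inv_zero j : inv j (fun=> 0).
Proof. by apply/funext => T; rewrite /tw linear0 scaler0. Qed.

Lemma inv_kd j a : inv j a -> inv j (d a).
Proof. by move=> ja; rewrite /inv -kd_tw// ja. Qed.

Lemma Linv_kd a : Linv a -> Linv (d a).
Proof.
move=> La T; apply: invar_sum => l _; apply: invarZ; apply: invar_sum => k _.
apply: invarZ => v Lv; apply/pull_transP.
by rewrite -(Der_pull (trans v)) (proj2 (pull_transP v _) (La _ v Lv)).
Qed.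

Lemma deg_kd k a : degS k a -> deg k (d a).
Proof.
move=> ka T Tk; rewrite /Kd /kd big1// => l lT; rewrite ka ?linear0 ?scaler0//.
by move: Tk; rewrite (finset.cardsD1 l) lT.
Qed.

Definition Vinv a : Prop := forall T, invar (@vert R s t) (a T).

Lemma vert_part p k a : (#|{: I}| < p + k)%N -> forall n, (forall T, d a T = 0) -> Linv a ->
  (forall j, inv j a) -> deg n a -> filt k a ->
  exists a' b, [/\ Vinv a', forall j, inv j a', deg n a' & [/\ Linv b, forall j, inv j b, degS n b &
    forall T, a T = a' T + d b T]].
Proof.
elim: p k a => [|p IH] k a pk n a0 La ja na ka.
  have az T : a T = 0 by apply: ka; apply: leq_ltn_trans pk; exact: max_card.
  exists (fun=> 0), (fun=> 0); split=> [T|j|T _|]; [exact: invar0|exact: inv_zero|by []|].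
  by split=> [T|j|T _|T]; [exact: invar0|exact: inv_zero|by []|rewrite kd0 addr0 az].
have [b [Lb jb nb pb]] := filtration_step a0 La ja na ka.
pose ma T := mseq es (a T).
have Lma : Vinv ma by move=> T; apply: mseq_invar esspan esL _; exact: La.
have jma j : inv j ma by exact: mseq_inv.
have nma : deg n ma by move=> T /na; rewrite /ma => ->; rewrite linear0.
have ma0 T : d ma T = 0.
  rewrite kd_map ?a0 ?linear0// => l f; exact: frameD_mseq.
have [||||||a' [b' [Va' ja' na' [Lb' jb' nb' Eab]]]] := IH k.+1 (fun T => a T - ma T - d b T) _ n.
- by rewrite addnS -addSn.
- by move=> T; rewrite d_sub d_sub a0 ma0 d_d !subrr.
- move=> T; apply: invarB; last exact: Linv_kd.
  by apply: invarB; [exact: La|exact: invar_sub Lvert (Lma T)].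
- by move=> j; apply: inv_add; [apply: inv_add => //|]; apply: inv_opp => //; exact: inv_kd.
- by move=> T nT; rewrite na// nma// (deg_kd nb nT) !subr0.
- exact: pb.
exists (fun T => ma T + a' T), (fun T => b T + b' T); split=> [T|j|T nT|].
- exact: invarD.
- exact: inv_add.
- by rewrite nma// na'// addr0.
split=> [T|j|T nT|T].
- exact: invarD.
- exact: inv_add.
- by rewrite nb// nb'// addr0.
have aux (x y z w : cinf E) : x + y + z + w = w + x + (z + y).
  by rewrite addrC -addrA addrA [y + z]addrC.
rewrite kdD; have /eqP := Eab T; rewrite 2!subr_eq => /eqP ->.
exact: aux.
Qed.

(** The dc_i have weight 1, so [vpart T] determines chi_T. On vertically invariant forms [d] adds
    only covectors dc_i, hence respects the splitting by [vpart]. *)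
Definition vpart T : {set I} := [set l in T | ~~ isc l]%SET.

Lemma vpart_setD1 l T : isc l -> vpart (T :\ l)%SET = vpart T.
Proof.
move=> sc; apply/finset.setP => l'; rewrite !finset.inE.
by case: (l' =P l) => [->|]; rewrite ?sc ?andbF.
Qed.

Lemma vpart_setU1 l T : isc l -> vpart (l |: T)%SET = vpart T.
Proof.
move=> sc; apply/finset.setP => l'; rewrite !finset.inE.
by case: (l' =P l) => [->|]; rewrite ?sc ?andbF.
Qed.

Lemma wt_c (z : Z) l : isc l -> wt z l = 1.
Proof. by move=> /andP[si /eqP j1]; rewrite /wt si j1. Qed.

Lemma wts_vpart (z : Z) T : wts z (vpart T) = wts z T.
Proof.
rewrite /wts [RHS](bigID (fun l => isc l)) /= [X in X * _]big1 ?mul1r.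
  by apply: eq_bigl => l; rewrite finset.inE.
by move=> l /andP[_]; exact: wt_c.
Qed.

Lemma wts_setU1c (z : Z) l T : isc l -> wts z (l |: T)%SET = wts z T.
Proof. by move=> sc; rewrite -wts_vpart vpart_setU1// wts_vpart. Qed.

Lemma wts_neq0 j T : wts (zs j) T != 0.
Proof.
apply/prodf_neq0 => l _; rewrite /wt; case: ifP => _; case: ifP => _ //; rewrite ?oner_eq0//.
by rewrite conjc_eq0.
Qed.

Lemma log_lin_cvec (z : Z) v : cvec v -> log_lin z v = v.
Proof.
move=> cv; apply/matrixP => i j; rewrite mxE; case: ifP => si.
  by case: (I2P j) => -> //=; rewrite cv ?mulr0// /isc /= si.
by rewrite !cv ?mulr0 ?subr0 ?addr0 ?if_same// /isc /= si.
Qed.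

(** Units fix the c-directions and the covectors dc_i, and contraction with a vector in these
    directions involves no other covectors. *)
Lemma cone_inv j e (ww : R -> R) (hw : weight ww) a : cvec e -> inv j a ->
  inv j (cone e (Lint hw e) a).
Proof.
move=> ce ja; apply/funext => T; rewrite /tw /cone /ki linear_sum scaler_sumr.
apply: eq_bigr => l; rewrite finset.inE => lT.
have [sc|sc] := boolP (isc l); last by rewrite zeta_cvec// mul0r !scale0r linear0 scaler0.
rewrite -[in RHS]ja /tw !linearZ /= Lint_pull /= (log_lin_cvec _ ce) wts_setU1c//.
by rewrite !scalerA mulrC.
Qed.

Lemma Vinv_L a : Vinv a -> Linv a.
Proof. by move=> va T; exact: invar_sub Lvert (va T). Qed.

(** Vertical invariance reduces the unit to the translation by its logarithm; the multiplier rho /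
    chi_T then decides between periodicity and exactness. *)
Lemma Vinv_shift j a T x : Vinv a -> inv j a ->
  (a T (log_vec (zs j) + x) : R[i]) = rs j / wts (zs j) T * (a T x : R[i]).
Proof.
move=> va ja.
have H : (a T x : R[i]) = (rs j)^-1 * wts (zs j) T * (a T (log_act (zs j) x) : R[i]).
  by rewrite -[in LHS]ja.
have [v vv vE] := log_act_split (zs j) x.
rewrite vE (va T v vv) in H; rewrite H mulrA.
have -> : rs j / wts (zs j) T * ((rs j)^-1 * wts (zs j) T) = 1.
  by field; rewrite r0 wts_neq0.
by rewrite mul1r.
Qed.

Definition good n a : Prop := exists (c : {set I} -> R[i]) b,
  (forall T, c T != 0 -> #|T| = n /\ forall j, wts (zs j) T = rs j) /\
  [/\ Linv b, forall j, inv j b, degS n b & forall T, a T = ccst E (c T) + d b T].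

Lemma ccstD (c c' : R[i]) : ccst E (c + c') = ccst E c + ccst E c'.
Proof. exact: cinfP. Qed.

Lemma ccst0 : ccst E (0 : R[i]) = 0.
Proof. exact: cinfP. Qed.

Lemma good_add n a a' : good n a -> good n a' -> good n (fun T => a T + a' T).
Proof.
move=> [c [b [cn [Lb jb nb E1]]]] [c' [b' [cn' [Lb' jb' nb' E2]]]].
exists (fun T => c T + c' T), (fun T => b T + b' T); split.
  move=> T; have [c0|/cn//] := eqVneq (c T) 0; rewrite c0 add0r; exact: cn'.
split=> [T|j|T nT|T].
- exact: invarD.
- exact: inv_add.
- by rewrite nb// nb'// addr0.
by rewrite kdD ccstD E1 E2 addrACA.
Qed.

Lemma good0 n : good n (fun=> 0).
Proof.
exists (fun=> 0), (fun=> 0); split=> [T|]; first by rewrite eqxx.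
split=> [T|j|T _|T]; [exact: invar0|exact: inv_zero|by []|].
by rewrite kd0 ccst0 addr0.
Qed.

Lemma good_part n S a : (forall T, d a T = 0) -> Vinv a -> (forall j, inv j a) -> deg n a ->
  (forall T, vpart T <> S -> a T = 0) -> good n a.
Proof.
move=> a0 va ja na aS.
have [/forallP wS|/forallPn[j wj]] := boolP [forall j, wts (zs j) S == rs j].
  (* All multipliers are 1 on this part, so the coefficients are periodic along the logarithms of
     the generators and can be averaged there. *)
  pose P a := [/\ Vinv a, forall j, inv j a, deg n a & forall T, vpart T <> S -> a T = 0].
  pose Q b := [/\ Linv b, forall j, inv j b & degS n b].
  have per (e : E) a' : e \in [seq log_vec (zs j) | j <- enum 'I_s] -> P a' ->
      forall T x, a' T (e + x) = a' T x.
    move=> /mapP[j _ ->] [va' ja' _ aS'] T x.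
    have [TS|/eqP TS] := eqVneq (vpart T) S; last by rewrite aS'.
    rewrite Vinv_shift// -wts_vpart TS (eqP (wS j)) divff// mul1r //.
  have ecv (e : E) : e \in [seq log_vec (zs j) | j <- enum 'I_s] -> cvec e.
    by move=> /mapP[j _ ->]; exact: cvec_log_vec.
  have [|||||b [[Lb jb nb] [vm jm nm mS] Eb]] := @mean_homotopy R s t P Q
    [seq log_vec (zs j) | j <- enum 'I_s] a per _ _ _ _ _ a0.
  - move=> e a' /ecv ce [va' ja' na' aS']; split=> [T|j|T nT|T TS].
    + exact/invar_Lint/va'.
    + apply/funext => T; rewrite /tw -[in RHS](ja' j) /tw !linearZ /=.
      by rewrite /mean Lint_pull /= log_lin_cvec.
    + by rewrite na'// linear0.
    + by rewrite aS'// linear0.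
  - move=> e a' /ecv ce [va' ja' na' aS']; split=> [|j|].
    + apply: cone_L (Vinv_L va') => f; exact: invar_Lint.
    + exact: cone_inv.
    + exact: cone_deg.
  - by split=> [T|j|//]; [exact: invar0|exact: inv_zero].
  - move=> b b' [h1 h2 h3] [h1' h2' h3']; split=> [T|j|T nT].
    + exact: invarD.
    + exact: inv_add.
    + by rewrite h3// h3'// addr0.
  - by split.
  have csp : spans [seq log_vec (zs j) | j <- enum 'I_s] (@cvec R s t).
    move=> v /cspan ->; exact: (spans_enum (fun k => ll k v) (fun k => log_vec (zs k))).
  (* An averaged coefficient is invariant in all directions, hence equal to its value at 0. *)
  exists (fun T => mseq [seq log_vec (zs j) | j <- enum 'I_s] (a T) 0), b; split.
    move=> T cT; have aT : a T <> 0 by move: cT => /[swap] ->; rewrite linear0 eqxx.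
    split; first by apply/eqP/negPn/negP => /eqP /na.
    move=> j; rewrite -wts_vpart; have [->|/eqP/aS//] := eqVneq (vpart T) S.
    exact/eqP/wS.
  split=> // T; rewrite -const_of_inv; [exact: Eb|by move=> v x vv; exact: vm|].
  move=> v x cv; move: v cv x.
  apply: (mseq_invar (L := [set e | e \in [seq log_vec (zs j) | j <- enum 'I_s]]) csp) => //.
  by move=> e /= he x; exact: per.
(* For this generator the multiplier is not 1: the mean along its logarithm has derivative [k - 1]
   times the form, and division by this scalar gives a primitive. *)
pose k := rs j / wts (zs j) S.
have k1 : k - 1 != 0.
  rewrite subr_eq0; apply: contraNneq wj => kE.
  by rewrite -[rs j](divfK (wts_neq0 j S)) -/k kE mul1r.
pose e := log_vec (zs j); have ce : cvec e := cvec_log_vec (zs j).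
have Ek T : Der e (mean e (a T)) = (k - 1) *: a T.
  apply: cinfP => x; rewrite Der_mean cfunZ mulrBl mul1r.
  have [TS|/eqP TS] := eqVneq (vpart T) S; last by rewrite aS// !cfun0 mulr0.
  by rewrite Vinv_shift// -wts_vpart TS.
exists (fun=> 0), (fun T => (k - 1)^-1 *: cone e (mean e) a T); split=> [T|]; first by rewrite eqxx.
split=> [T|i|T nT|T].
- apply: invarZ; apply: cone_L (Vinv_L va) T => f; exact: invar_Lint.
- apply: inv_scale; exact: cone_inv.
- by rewrite (cone_deg e (mean e) na nT) scaler0.
rewrite ccst0 add0r kdZ cone_cartan//; last by move=> l f; exact: frameD_Lint.
by rewrite Ek scalerA mulVf// scale1r.
Qed.

Theorem cohomology_upper n a : (forall T, d a T = 0) -> Linv a -> (forall j, inv j a) ->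
  deg n a -> good n a.
Proof.
move=> a0 La ja na.
have [||a' [b [Va' ja' na' [Lb jb nb Eab]]]] := @vert_part #|{: I}|.+1 0 a _ n a0 La ja na.
  by rewrite addn0.
  by [].
have a'0 T : d a' T = 0.
  have -> : a' = (fun T => a T - d b T) by apply/funext => T'; rewrite Eab addrK.
  by rewrite d_sub a0 d_d subrr.
have Dv l T : ~~ isc l -> frameD l (a' T) = 0.
  by move=> nl; apply: frameD_vert0 => // v x vv; exact: Va'.
(* The pieces are separately closed and invariant, so [good_part] applies to each. *)
pose part S T := if vpart T == S then a' T else 0.
have gS S : good n (part S).
  apply: (good_part (S := S)).
  - move=> T; have [TS|TS] := eqVneq (vpart T) S.
      rewrite -[RHS](a'0 T); apply: eq_bigr => l lT; congr (_ *: _).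
      have [sc|sc] := boolP (isc l); last first.
        rewrite [RHS]Dv// /part; case: ifP => _; [exact: Dv|exact: linear0].
      by rewrite /part vpart_setD1// TS eqxx.
    rewrite /Kd /kd big1// => l lT; rewrite /part.
    case: ifP => TlS; last by rewrite linear0 scaler0.
    have [sc|sc] := boolP (isc l); last by rewrite [X in _ *: X]Dv// scaler0.
    by rewrite vpart_setD1// (negbTE TS) in TlS.
  - by move=> T; rewrite /part; case: ifP => _; [exact: Va'|exact: invar0].
  - move=> j; apply/funext => T; rewrite /tw /part; case: ifP => _.
      by have := congr1 (fun f => f T) (ja' j).
    by rewrite linear0 scaler0.
  - by move=> T nT; rewrite /part; case: ifP => // _; exact: na'.
  - by move=> T /eqP /negbTE; rewrite /part => ->.
have gsum : good n (fun T => \sum_S part S T).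
  suff H (r : seq {set I}) : good n (fun T => \sum_(S <- r) part S T) by exact: H.
  elim: r => [|S r IH].
    have -> : (fun T => \sum_(S <- [::]) part S T) = (fun=> 0).
      by apply/funext => T; rewrite big_nil.
    exact: good0.
  have -> : (fun T => \sum_(S <- S :: r) part S T) =
      (fun T => part S T + \sum_(S <- r) part S T).
    by apply/funext => T; rewrite big_cons.
  exact: good_add.
have Ea' T : \sum_S part S T = a' T.
  rewrite (bigD1 (vpart T))//= /part eqxx big1 ?addr0// => S.
  by rewrite eq_sym => /negbTE ->.
have [c [b' [cn [Lb' jb' nb' E']]]] := gsum.
exists c, (fun T => b' T + b T); split=> //; split=> [T|j|T nT|T].
- exact: invarD.
- exact: inv_add.
- by rewrite nb'// nb// addr0.
by rewrite kdD addrA -E' Ea'; exact: Eab.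
Qed.

(** The average of [d b] along the integers loses the derivatives dual to vertical covectors. If [l]
    is one of the dc_i, then [T :\ l] has the same character as [T], so the coefficient there is
    periodic and the average along the logarithms kills its derivative. A constant survives both
    averages. *)
Theorem cohomology_lower (c : {set I} -> R[i]) b : Linv b -> (forall j, inv j b) ->
  (forall T, c T != 0 -> forall j, wts (zs j) T = rs j) ->
  (forall T, ccst E (c T) = d b T) -> forall T, c T = 0.
Proof.
move=> Lb jb cw cE T; apply/eqP/negPn/negP => cT; have wT := cw T cT.
pose cs := [seq log_vec (zs j) | j <- enum 'I_s].
have ccst_id (r : seq E) (k : R[i]) : mseq r (ccst E k) = ccst E k by exact: mseq_id.
have : mseq cs (mseq es (d b T)) = 0; last first.
  by rewrite -cE !ccst_id => /(congr1 (fun f : cinf E => f 0)) /= c0; rewrite c0 eqxx in cT.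
rewrite /Kd /kd !linear_sum /= big1// => l lT; rewrite !linearZ /=.
rewrite -!frameD_mseq.
have Vf : invar (@vert R s t) (mseq es (b (T :\ l)%SET)).
  by apply: mseq_invar esspan esL _; exact: Lb.
have [sc|sc] := boolP (isc l); last first.
  by rewrite frameD_mseq frameD_vert0 ?linear0 ?scaler0// => v x vv; exact: Vf.
rewrite frameD_cvec0 ?scaler0//.
have csp : spans cs (@cvec R s t).
  move=> v /cspan ->; exact: (spans_enum (fun k => ll k v) (fun k => log_vec (zs k))).
move=> v x cv; move: v cv x.
apply: (mseq_invar (L := [set e | e \in cs]) csp) => //.
move=> e /= /mapP[j _ ->] x.
have jm := mseq_inv Lb (jb j).
have Vm : Vinv (fun T => mseq es (b T)) by move=> T'; apply: mseq_invar esspan esL _; exact: Lb.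
have := Vinv_shift (T :\ l)%SET x Vm jm.
have -> : wts (zs j) (T :\ l)%SET = rs j by rewrite -wts_vpart vpart_setD1// wts_vpart wT.
by rewrite divff// mul1r.
Qed.

End Core.

(** * Increasing index tuples and minors *)

Section SortedIndices.
Local Close Scope classical_set_scope.
Variables (I : finType) (l0 : I).
Implicit Types (T : {set I}) (l : I).

(** [l0] is the default of [nth], returned only when [T] has at most [a] elements. *)
Definition sorted_idx (k : nat) T (a : 'I_k) : I := nth l0 (enum T) a.

Lemma sorted_idx_in k T (a : 'I_k) : #|T| = k -> sorted_idx T a \in T.
Proof.
by move=> Tk; rewrite -mem_enum; apply: mem_nth; rewrite -cardE Tk.
Qed.

Lemma sorted_idx_inj k T : #|T| = k -> injective (@sorted_idx k T).
Proof.
move=> Tk a b /eqP; rewrite /sorted_idx nth_uniq ?enum_uniq -?cardE ?Tk//.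
by move=> /eqP/val_inj.
Qed.

Lemma sorted_idx_onto k T l : #|T| = k -> l \in T -> exists a : 'I_k, sorted_idx T a = l.
Proof.
move=> Tk lT; have li : (index l (enum T) < k)%N by rewrite -Tk cardE index_mem mem_enum.
by exists (Ordinal li); rewrite /sorted_idx nth_index// mem_enum.
Qed.

(** The place of [l] in the enlarged list is the exponent in [sgn]; this identifies the Koszul sign
    with a cofactor sign. *)
Lemma sorted_setU1 k T l : #|T| = k -> l \notin T ->
  exists p : 'I_k.+1, [/\ nat_of_ord p = #|[set j in T | before j l]|,
    sorted_idx (l |: T) p = l &
    forall a : 'I_k, sorted_idx (l |: T) (lift p a) = sorted_idx T a].
Proof.
move=> Tk lT.
have enE A : enum A = [seq x <- enum I | x \in A] by rewrite enumT; exact: erefl.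
have lI : l \in enum I by rewrite mem_enum.
have uI := enum_uniq I.
have rankE j : index j (enum I) = enum_rank j.
  by rewrite -{1}(nth_enum_rank l0 j) index_uniq ?enum_uniq// -cardE ltn_ord.
have [s1 [s2 sE]] : exists s1 s2, enum I = s1 ++ l :: s2.
  by case/splitPr: lI => s1 s2; exists s1, s2.
move: uI; rewrite sE cat_uniq /= => /and4P[us1 /norP[ls1 /hasPn s12] ls2 us2].
have idl : index l (enum I) = size s1.
  by rewrite sE index_cat (negbTE ls1) /= eqxx addn0.
have bef j : before j l = (j \in s1).
  rewrite /before -!rankE idl sE index_cat; case: ifP => js1; first by rewrite index_mem.
  by rewrite ltnNge leq_addr.
pose f1 := [seq x <- s1 | x \in T]; pose f2 := [seq x <- s2 | x \in T].
have E1 : enum T = f1 ++ f2.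
  by rewrite enE sE filter_cat /= (negbTE lT).
have E2 : enum (l |: T) = f1 ++ l :: f2.
  rewrite enE sE filter_cat /= finset.setU11; congr (_ ++ _ :: _).
  - apply: eq_in_filter => x xs1; rewrite !inE; case: eqP => // xl.
    by move: xs1; rewrite xl (negbTE ls1).
  - apply: eq_in_filter => x xs2; rewrite !inE; case: eqP => // xl.
    by move: xs2; rewrite xl (negbTE ls2).
have f1k : (size f1 < k.+1)%N.
  by rewrite ltnS -Tk cardE E1 size_cat leq_addr.
exists (Ordinal f1k); split=> [|/=|a].
- rewrite -[RHS]/#|_| /= -(card_uniqP (filter_uniq _ us1)).
  by apply: eq_card => x; rewrite mem_filter !inE bef.
- by rewrite /sorted_idx E2 nth_cat ltnn subnn.
rewrite /sorted_idx E1 E2 /= !nth_cat /fintype.bump.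
case: (leqP (size f1) a) => [fa|af] /=; last by rewrite add0n af.
by rewrite add1n ltnNge (leq_trans fa (leqnSn a)) /= subSn.
Qed.

(* Sorting an index tuple: a function that changes sign (modulo [B]) when two
   arguments are swapped is determined by its values on increasing tuples. *)
Lemma sorted_mod (F : fieldType) (V : lmodType F) (B : V -> Prop) (k : nat)
    (G : {ffun 'I_k -> I} -> V) :
  (forall c x y, B x -> B y -> B (c *: x + y)) -> B 0 ->
  (forall (f : {ffun 'I_k -> I}) i j, i != j -> f i = f j -> B (G f)) ->
  (forall (f : {ffun 'I_k -> I}) (p q : 'I_k), B (G f + G [ffun a => f (tperm p q a)]) \/ p = q) ->
  forall f, B (G f) \/ exists T c, #|T| = k /\ B (G f - c *: G [ffun a => sorted_idx T a]).
Proof.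
move=> BD B0 Gn Gt f.
have [fi|] := boolP (injectiveb f); last first.
  by move=> /injectivePn[i [j ij fij]]; left; exact: Gn ij fij.
right; pose T := [set f a | a in 'I_k].
have Tk : #|T| = k.
  by rewrite card_imset ?card_ord//; exact/injectiveP.
exists T.
have [p pE] : exists p : {perm 'I_k}, forall a, f a = sorted_idx T (p a).
  have ex a : exists b : 'I_k, sorted_idx T b == f a.
    by have [|b bE] := @sorted_idx_onto k T (f a) Tk; [exact: imset_f|exists b; apply/eqP].
  pose q a := xchoose (ex a); have qE a : sorted_idx T (q a) = f a.
    exact/eqP/(xchooseP (ex a)).
  have qi : injective q.
    by move=> a b qab; apply: (injectiveP _ fi); rewrite -!qE qab.
  by exists (perm qi) => a; rewrite permE qE.
have key (r : {perm 'I_k}) (h : {ffun 'I_k -> I}) :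
    exists c, B (G [ffun a => h (r a)] - c *: G h).
  have [ts -> _] := prod_tpermP r; elim: ts h => [|[i j] ts IH] h.
    exists 1; rewrite big_nil scale1r (_ : [ffun a => _] = h) ?subrr//.
    by apply/ffunP => a; rewrite ffunE perm1.
  rewrite big_cons.
  have [c Bc] := IH h; set h' := [ffun a => _] in Bc.
  have -> : [ffun a => h ((tperm i j * \prod_(t <- ts) tperm t.1 t.2)%g a)] =
      [ffun a => h' (tperm i j a)].
    by apply/ffunP => a; rewrite !ffunE permM.
  have [Bt|ij] := Gt h' i j; last first.
    exists c; rewrite ij (_ : [ffun a => _] = h')//.
    by apply/ffunP => a; rewrite ffunE tperm1 perm1.
  exists (- c).
  have -> : G [ffun a => h' (tperm i j a)] - - c *: G h =
      (- 1) *: (G h' - c *: G h) + (G h' + G [ffun a => h' (tperm i j a)]).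
    by rewrite scaleNr opprK scaleN1r opprB subrKA addrC.
  exact: BD.
have [c Bc] := key p [ffun a => sorted_idx T a]; exists c; split=> //.
congr B: Bc; congr (G _ - _); apply/ffunP => a; by rewrite !ffunE pE.
Qed.

End SortedIndices.

Section Minors.
Local Close Scope classical_set_scope.
Variables (F : numFieldType) (I : finType) (l0 : I).
Implicit Types (T : {set I}) (l : I).

(** With [M l b] the value of the covector [l] on the b-th vector, this is the wedge product over
    [T] evaluated on these vectors. *)
Definition minor k T (M : I -> 'I_k -> F) : F :=
  \det (\matrix_(a, b) M (sorted_idx l0 T a) b).

(** Laplace expansion of the matrix with row [l] put on top of those of [T]. If [l] is in [T] two
    rows agree; otherwise the sum is compared with the expansion along the row where [l] belongs. *)
Lemma minor_wedge k T l (M : I -> 'I_k.+1 -> F) : #|T| = k ->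
  \sum_(i < k.+1) (-1) ^+ i * M l i * minor T (fun l' b => M l' (lift i b)) =
  if l \in T then 0 else sgn F l T * minor (l |: T) M.
Proof.
move=> Tk.
pose N : 'M[F]_k.+1 := \matrix_(a, b) M (if unlift ord0 a is Some a' then sorted_idx l0 T a' else l) b.
have NE : \sum_(i < k.+1) (-1) ^+ i * M l i * minor T (fun l' b => M l' (lift i b)) = \det N.
  rewrite (expand_det_row N ord0); apply: eq_bigr => i _.
  rewrite mxE unlift_none /cofactor add0n mulrA [M l i * _]mulrC; congr (_ * _ * \det _).
  by apply/matrixP => a b; rewrite !mxE liftK.
rewrite NE; case: ifP => lT.
  have [a aE] := sorted_idx_onto l0 Tk lT.
  rewrite (determinant_alternate (i1 := ord0) (i2 := lift ord0 a))//.
  by move=> b; rewrite !mxE unlift_none liftK aE.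
have [p [pE pl pT]] := sorted_setU1 l0 Tk (negbT lT).
rewrite -NE [in RHS]/minor (expand_det_row _ p) /sgn -pE mulr_sumr.
apply: eq_bigr => i _; rewrite mxE pl /cofactor exprD.
have sgnK x : (-1) ^+ p * ((-1) ^+ p * x) = x :> F by rewrite mulrA -expr2 sqrr_sign mul1r.
rewrite [M l i * _]mulrC -!mulrA sgnK [\det _ * _]mulrC; congr (_ * (_ * \det _)).
by apply/matrixP => a b; rewrite !mxE pT.
Qed.

(** Multilinearity in the columns, with [g] running over all maps so that no sorting is involved. *)
Lemma det_expand k (A : 'I_k -> I -> F) (N : 'I_k -> I -> F) :
  \sum_(g : {ffun 'I_k -> I}) (\prod_b A b (g b)) * \det (\matrix_(a, b) N a (g b)) =
  \det (\matrix_(a, b) \sum_l A b l * N a l).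
Proof.
rewrite /determinant; under eq_bigr do rewrite mulr_sumr.
rewrite exchange_big; apply: eq_bigr => p _ /=.
under eq_bigr do rewrite mulrCA.
rewrite -mulr_sumr; congr (_ * _).
under [RHS]eq_bigr do rewrite mxE.
rewrite [RHS](reindex_inj (@perm_inj _ p^-1)%g) /=.
under [RHS]eq_bigr do rewrite permKV.
rewrite bigA_distr_bigA; apply: eq_bigr => g _.
rewrite big_split; congr (_ * _).
rewrite (reindex_inj (@perm_inj _ p^-1)%g) /=; apply: eq_bigr => i _.
by rewrite mxE permKV.
Qed.

Lemma minor_delta k T T' : #|T| = k -> #|T'| = k ->
  minor T (fun l (b : 'I_k) => (l == sorted_idx l0 T' b)%:R) = (T == T')%:R :> F.
Proof.
move=> Tk Tk'; have [TT|TT] := eqVneq T T'.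
  rewrite -TT /minor (_ : \matrix_(a, b) _ = 1%:M) ?det1//.
  apply/matrixP => a b; rewrite !mxE (inj_eq _)//.
  exact: sorted_idx_inj.
have [l lT lT'] : exists2 l, l \in T & l \notin T'.
  apply/subsetPn; apply: contraNN TT => /subset_leqif_cards[_].
  by rewrite Tk Tk' eqxx => /esym.
have [a aE] := sorted_idx_onto l0 Tk lT.
rewrite /minor (expand_det_row _ a) big1// => b _.
rewrite mxE aE; case: eqP => [lb|]; last by rewrite mul0r.
by move: lT'; rewrite lb sorted_idx_in.
Qed.

End Minors.

(** * Forms on the cover *)

Section AlternatingForms.
Variables (R : realType) (V : normedModType R) (k : nat).
Implicit Types (phi psi : ('I_k -> V) -> R[i]) (v : 'I_k -> V).

Lemma dfwith_same v i : dfwith v i (v i) = v.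
Proof. by apply/funext => j; have [->|ij] := eqVneq j i; rewrite ?dfwithin// dfwithout// eq_sym. Qed.

Lemma dfwith_comm v i j x y : i != j ->
  dfwith (dfwith v i x) j y = dfwith (dfwith v j y) i x.
Proof.
move=> ij; apply/funext => a; have [->|aj] := eqVneq a j.
  by rewrite dfwithin dfwithout// dfwithin.
rewrite dfwithout 1?eq_sym//; have [->|ai] := eqVneq a i; first by rewrite !dfwithin.
by rewrite !dfwithout// eq_sym.
Qed.

Definition multilinear phi := forall v i (c : R) x y, phi (dfwith v i (c *: x + y)) =
     c%:C%C * phi (dfwith v i x) + phi (dfwith v i y).

Lemma multilinear0 phi v i : multilinear phi -> phi (dfwith v i 0) = 0.
Proof.
move=> mphi; have := mphi v i (-1) 0 0; rewrite scaler0 addr0.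
by rewrite rmorphN rmorph1 mulN1r addNr.
Qed.

Lemma multilinear_sum phi v i (J : Type) (r : seq J) (c : J -> R) (u : J -> V) :
  multilinear phi ->
  phi (dfwith v i (\sum_(j <- r) c j *: u j)) =
  \sum_(j <- r) (c j)%:C%C * phi (dfwith v i (u j)).
Proof.
move=> mphi; elim: r => [|j r IH]; first by rewrite !big_nil multilinear0.
by rewrite !big_cons mphi IH.
Qed.

Lemma multilinear_basis (J : finType) (e : J -> V) phi psi :
  (forall x : V, exists c : J -> R, x = \sum_j c j *: e j) ->
  multilinear phi -> multilinear psi ->
  (forall g : {ffun 'I_k -> J}, phi (e \o g) = psi (e \o g)) -> phi =1 psi.
Proof.
move=> eb mphi mpsi E.
(* Arguments are replaced by basis vectors one at a time; those of index at least [n] already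
   are. *)
suff H n v : (forall a : 'I_k, (n <= a)%N -> exists h, v a = e h) -> phi v = psi v.
  by move=> v; apply: (H k) => a; rewrite leqNgt ltn_ord.
elim: n v => [|n IH] v vE.
  have [g gE] := choice (fun a => vE a (leq0n _)).
  have -> : v = e \o [ffun a => g a] by apply/funext => a /=; rewrite ffunE.
  exact: E.
have [nk|kn] := ltnP n k; last by apply: IH => a na; move: (leq_trans kn na); rewrite leqNgt ltn_ord.
pose i := Ordinal nk; have [c cE] := eb (v i).
rewrite -(dfwith_same v i) cE !multilinear_sum//; apply: eq_bigr => j _; congr (_ * _).
apply: IH => a na; have [->|ai] := eqVneq a i; first by exists j; rewrite dfwithin.
rewrite dfwithout 1?eq_sym//; apply: vE; rewrite ltn_neqAle na andbT.
by rewrite eq_sym; exact: ai.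
Qed.

(** Polarization: expand the vanishing value with x + y in both places. *)
Lemma alternating_tperm phi v i j : alternating_multilinear phi -> i != j ->
  phi (v \o tperm i j) = - phi v.
Proof.
move=> [mphi aphi] ij; pose w x y := dfwith (dfwith v i x) j y.
have w0 x : phi (w x x) = 0.
  by apply: (aphi _ i j ij); rewrite /w dfwithin dfwithout 1?eq_sym// dfwithin.
have wl x y z : phi (w (x + y) z) = phi (w x z) + phi (w y z).
  by rewrite /w !(dfwith_comm _ _ z ij) -[x]scale1r mphi rmorph1 mul1r scale1r.
have wr x y z : phi (w z (x + y)) = phi (w z x) + phi (w z y).
  by rewrite /w -[x]scale1r mphi rmorph1 mul1r scale1r.
have := w0 (v i + v j); rewrite wl !wr !w0 add0r addr0 => /eqP.
have -> : w (v i) (v j) = v by rewrite /w dfwith_same dfwith_same.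
have -> : w (v j) (v i) = v \o tperm i j.
  apply/funext => a; rewrite /w /=; case: tpermP => [->|->|/eqP ai /eqP aj].
  - by rewrite dfwithout 1?eq_sym// dfwithin.
  - by rewrite dfwithin.
  - by rewrite !dfwithout // eq_sym.
by rewrite addrC addr_eq0 => /eqP.
Qed.

End AlternatingForms.

Section FormExpansion.
Local Open Scope complex_scope.
Local Close Scope classical_set_scope.
Variables (R : realType) (s t : nat) (l0 : 'I_(s + t) * 'I_2).
Local Notation E := 'M[R]_(s + t, 2).
Local Notation I := ('I_(s + t) * 'I_2)%type.
Implicit Types (l h : I) (T : {set I}).

Lemma minor_tperm (F : numFieldType) (J : finType) (j0 : J) k (M : J -> 'I_k -> F)
    (S : {set J}) p q : p != q ->
  minor j0 S (fun j b => M j (tperm p q b)) = - minor j0 S M.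
Proof.
move=> pq; rewrite /minor.
have -> : \matrix_(a < k, b < k) M (sorted_idx j0 S a) (tperm p q b) =
    (\matrix_(a, b) M (sorted_idx j0 S a) b) *m perm_mx (tperm p q).
  by rewrite -{2}[tperm p q]tpermV -col_permE; apply/matrixP => a b; rewrite !mxE.
by rewrite det_mulmx det_perm odd_tperm pq expr1 mulrN1.
Qed.

Lemma minor_scale (F : numFieldType) (J : finType) (j0 : J) k (c : J -> F) (M : J -> 'I_k -> F)
    (S : {set J}) : #|S| = k ->
  minor j0 S (fun j b => c j * M j b) = (\prod_(j in S) c j) * minor j0 S M.
Proof.
move=> Sk; rewrite /minor.
have -> : \matrix_(a, b) (c (sorted_idx j0 S a) * M (sorted_idx j0 S a) b) =
    diag_mx (\row_(a < k) c (sorted_idx j0 S a)) *m \matrix_(a, b) M (sorted_idx j0 S a) b.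
  by rewrite mul_diag_mx; apply/matrixP => a b; rewrite !mxE.
rewrite det_mulmx det_diag; congr (_ * _).
under eq_bigr do rewrite mxE.
rewrite -[RHS]big_enum /= (big_nth j0) big_mkord -cardE Sk.
by [].
Qed.

(** Coordinates of the frame vector dual to [zeta l]. It is complex whereas forms take real vectors,
    hence the multilinear extension in [frame_value]. *)
Definition dual_coef l h : R[i] := (l.1 == h.1)%:R * coefA R l h.2.

Definition basis_vec h : E := delta_mx h.1 h.2.

Lemma basis_vec_span (x : E) : exists c : I -> R, x = \sum_h c h *: basis_vec h.
Proof. by exists (fun h => x h.1 h.2); rewrite [LHS]matrix_sum_delta pair_big. Qed.

Lemma dual_coefP l l' : \sum_h dual_coef l h * zeta l' (basis_vec h) = (l == l')%:R.
Proof.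
case: l l' => i k [i' k']; rewrite -(pair_bigA _ (fun a b => dual_coef (i, k) (a, b) * zeta (i', k') (delta_mx a b))) /=.
rewrite (bigD1 i)//= [X in _ + X]big1 ?addr0 => [|a ai]; last first.
  by apply: big1 => b _; rewrite /dual_coef /= eq_sym (negbTE ai) !mul0r.
under eq_bigr do rewrite /dual_coef zeta_delta /= eqxx mul1r mulrCA.
rewrite -mulr_sumr xpair_eqE [i' == i]eq_sym; have [->|_] := eqVneq i i'; last by rewrite mul0r.
by rewrite coefAB mul1r.
Qed.

Lemma dual_coefP' g h : \sum_l dual_coef l g * zeta l (basis_vec h) = (g == h)%:R.
Proof.
case: g h => i k [i' k']; rewrite -(pair_bigA _ (fun a b => dual_coef (a, b) (i, k) * zeta (a, b) (delta_mx i' k'))) /=.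
rewrite (bigD1 i)//= [X in _ + X]big1 ?addr0 => [|a ai]; last first.
  by apply: big1 => b _; rewrite /dual_coef /= (negbTE ai) !mul0r.
under eq_bigr do rewrite /dual_coef zeta_delta /= eqxx mul1r mulrCA.
rewrite -mulr_sumr xpair_eqE; have [->|_] := eqVneq i i'; last by rewrite mul0r.
by rewrite coefBA mul1r.
Qed.

Section Degree.
Variable k : nat.
Implicit Types (phi : ('I_k -> E) -> R[i]) (v : 'I_k -> E).

Definition fminor T v : R[i] := minor l0 T (fun l b => zeta l (v b)).

Lemma fminor_alternating T : alternating_multilinear (fminor T).
Proof.
split=> [v i c x y|v i j ij vij]; rewrite /fminor /minor.
  rewrite -![\det (\matrix_(a, b) zeta (sorted_idx l0 T a) _)]det_tr.
  rewrite (determinant_multilinear (i0 := i) (B := (\matrix_(a, b) zeta (sorted_idx l0 T a) (dfwith v i x b))^T)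
     (C := (\matrix_(a, b) zeta (sorted_idx l0 T a) (dfwith v i y b))^T) (b := c%:C) (c := 1)) ?mul1r//.
  - by apply/matrixP => a b; rewrite !mxE !dfwithin zeta_linear mul1r.
  - by apply/matrixP => a b; rewrite !mxE !dfwithout// neq_lift.
  - by apply/matrixP => a b; rewrite !mxE !dfwithout// neq_lift.
rewrite -det_tr; apply: (determinant_alternate ij) => a.
by rewrite !mxE vij.
Qed.

(* The value of [phi] on the frame vectors dual to [zeta]. *)
Definition frame_value phi (f : 'I_k -> I) : R[i] :=
  \sum_(g : {ffun 'I_k -> I}) (\prod_a dual_coef (f a) (g a)) * phi (basis_vec \o g).

Definition frame_coef phi T := frame_value phi (sorted_idx l0 T).

Lemma frame_value_tperm phi f p q : alternating_multilinear phi -> p != q ->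
  frame_value phi (f \o tperm p q) = - frame_value phi f.
Proof.
move=> aphi pq; pose tg (g : {ffun 'I_k -> I}) : {ffun 'I_k -> I} := [ffun a => g (tperm p q a)].
have tgK : involutive tg by move=> g; apply/ffunP => a; rewrite !ffunE tpermK.
rewrite /frame_value (reindex_inj (can_inj tgK)) /= -sumrN; apply: eq_bigr => g _.
rewrite -mulrN -(alternating_tperm _ aphi pq); congr (_ * phi _).
  rewrite (reindex_inj (@perm_inj _ (tperm p q))) /=; apply: eq_bigr => a _.
  by rewrite ffunE tpermK.
by apply/funext => a /=; rewrite ffunE.
Qed.

(** Both sides change sign under a transposition and agree on increasing tuples by [minor_delta];
    [sorted_mod] with the zero subspace concludes. *)
Lemma frame_value_sorted phi (f : {ffun 'I_k -> I}) : alternating_multilinear phi ->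
  frame_value phi f = \sum_(T : {set I} | #|T| == k)
    frame_coef phi T * minor l0 T (fun l b => (l == f b)%:R).
Proof.
move=> aphi; pose P (f : 'I_k -> I) := \sum_(T : {set I} | #|T| == k)
    frame_coef phi T * minor l0 T (fun l b => (l == f b)%:R).
have Pt (h : {ffun 'I_k -> I}) p q : p != q -> P [ffun a => h (tperm p q a)] = - P h.
  move=> pq; rewrite /P -sumrN; apply: eq_bigr => T _.
  rewrite -mulrN -(minor_tperm _ _ _ pq) //; congr (_ * \det _).
  by apply/matrixP => a b; rewrite !mxE ffunE.
pose G (h : {ffun 'I_k -> I}) : (R[i])^o := frame_value phi h - P h.
have Gt (h : {ffun 'I_k -> I}) p q : p != q -> G h + G [ffun a => h (tperm p q a)] = 0.
  move=> pq; rewrite /G Pt// (_ : frame_value _ [ffun a => _] = frame_value phi (h \o tperm p q)).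
    by rewrite frame_value_tperm// opprK addrACA subrr addNr addr0.
  by congr (frame_value _ _); apply/funext => a; rewrite ffunE.
have [||||/eqP|[T [c [Tk /eqP]]]] := @sorted_mod I l0 _ (R[i])^o (fun x => x = 0) k G _ _ _ _ f.
- by move=> c x y -> ->; rewrite scaler0 addr0.
- by [].
- move=> h i j ij hij; have := Gt h i j ij.
  have -> : [ffun a => h (tperm i j a)] = h.
    by apply/ffunP => a; rewrite ffunE; case: tpermP => [->|->|].
  by move=> /eqP; rewrite -mulr2n -[_ *+ 2]mulr_natr mulf_eq0 pnatr_eq0 orbF => /eqP.
- by move=> h p q; have [->|pq] := eqVneq p q; [right|left; exact: Gt].
- by rewrite subr_eq0 => /eqP.
rewrite subr_eq0 => /eqP Gf.
suff G0 : G [ffun a => sorted_idx l0 T a] = 0.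
  by move: Gf; rewrite G0 scaler0 => /eqP; rewrite subr_eq0 => /eqP.
rewrite /G /P (bigD1 T) ?Tk//= big1 ?addr0 => [|S /andP[/eqP Sk ST]].
  rewrite (_ : minor _ _ _ = 1) ?mulr1 /frame_coef.
    by apply/eqP; rewrite subr_eq0; apply/eqP; congr frame_value; apply/funext => a; rewrite ffunE.
  rewrite -[RHS]/(true%:R) -(eqxx T) -(@minor_delta _ _ l0 k T T)//.
  by congr (\det _); apply/matrixP => a b; rewrite !mxE ffunE.
rewrite (_ : minor _ _ _ = 0) ?mulr0//.
rewrite -[RHS]/(false%:R) -(negbTE ST) -(@minor_delta _ _ l0 k S T)//.
by congr (\det _); apply/matrixP => a b; rewrite !mxE ffunE.
Qed.

Lemma alternating_sum (J : finType) (P : pred J) (c : J -> R[i]) (F : J -> ('I_k -> E) -> R[i]) :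
  (forall j, alternating_multilinear (F j)) ->
  alternating_multilinear (fun v => \sum_(j | P j) c j * F j v).
Proof.
move=> aF; split=> [v i r x y|v i j ij vij].
  rewrite mulr_sumr -big_split; apply: eq_bigr => j _ /=.
  by rewrite (proj1 (aF j)) mulrDr mulrCA.
by apply: big1 => a _; rewrite (proj2 (aF a) v i j ij vij) mulr0.
Qed.

(** Two multilinear maps need comparing only on the real basis; there the value is expanded in the
    dual frame and the index tuples are sorted. *)
Lemma frame_expansion phi v : alternating_multilinear phi ->
  phi v = \sum_(T : {set I} | #|T| == k) frame_coef phi T * fminor T v.
Proof.
move=> aphi.
pose psi v := \sum_(T : {set I} | #|T| == k) frame_coef phi T * fminor T v.
rewrite -/(psi v).
have apsi : alternating_multilinear psi.
  by apply: alternating_sum; exact: fminor_alternating.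
apply: (multilinear_basis basis_vec_span) (proj1 aphi) (proj1 apsi) _ v => h.
transitivity (\sum_(f : {ffun 'I_k -> I})
    (\prod_b zeta (f b) (basis_vec (h b))) * frame_value phi f).
  rewrite /frame_value; under eq_bigr do rewrite mulr_sumr.
  rewrite exchange_big (bigD1 h)//= [X in _ + X]big1 ?addr0 => [|g gh].
    under eq_bigr do rewrite mulrA -big_split /=.
    rewrite -mulr_suml -(bigA_distr_bigA (fun b l => zeta l (basis_vec (h b)) * dual_coef l (h b))).
    rewrite big1 ?mul1r// => b _.
    by under eq_bigr do rewrite mulrC; rewrite dual_coefP' eqxx.
  under eq_bigr do rewrite mulrA -big_split /=.
  rewrite -mulr_suml -(bigA_distr_bigA (fun b l => zeta l (basis_vec (h b)) * dual_coef l (g b))).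
  have [b bE] : exists b, g b != h b.
    by apply/existsP; rewrite -negb_forall; apply: contraNN gh => /forallP H; apply/eqP/ffunP => b; exact/eqP.
  rewrite (bigD1 b)//= (_ : \sum_l _ = 0) ?mul0r//.
  by under eq_bigr do rewrite mulrC; rewrite dual_coefP' (negbTE bE).
under eq_bigr do rewrite frame_value_sorted// mulr_sumr.
rewrite exchange_big; apply: eq_bigr => T _ /=.
under eq_bigr do rewrite mulrCA.
rewrite -mulr_sumr; congr (_ * _).
rewrite (det_expand (fun b l => zeta l (basis_vec (h b))) (fun a l => (sorted_idx l0 T a == l)%:R)).
congr (\det _); apply/matrixP => a b; rewrite !mxE (bigD1 (sorted_idx l0 T a))//= eqxx mulr1.
by rewrite big1 ?addr0// => l /negbTE; rewrite eq_sym => ->; rewrite mulr0.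
Qed.

Lemma frame_coef_unique (c : {set I} -> R[i]) T : #|T| = k ->
  frame_coef (fun v => \sum_(S : {set I} | #|S| == k) c S * fminor S v) T = c T.
Proof.
move=> Tk; rewrite /frame_coef /frame_value.
under eq_bigr do rewrite mulr_sumr.
rewrite exchange_big /=.
have H (S : {set I}) : #|S| = k -> \sum_(g : {ffun 'I_k -> I})
    (\prod_a dual_coef (sorted_idx l0 T a) (g a)) * (c S * fminor S (basis_vec \o g)) = c S * (S == T)%:R.
  move=> Sk; under eq_bigr do rewrite mulrCA.
  rewrite -mulr_sumr; congr (_ * _).
  rewrite (det_expand (fun b => dual_coef (sorted_idx l0 T b)) (fun a l => zeta (sorted_idx l0 S a) (basis_vec l))).
  rewrite -(@minor_delta _ _ l0 k S T)//; congr (\det _); apply/matrixP => a b.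
  by rewrite !mxE dual_coefP eq_sym.
rewrite (bigD1 T) ?Tk//= H// eqxx mulr1 big1 ?addr0// => S /andP[/eqP Sk ST].
by rewrite H// (negbTE ST) mulr0.
Qed.

End Degree.
End FormExpansion.

Section LogSmooth.
Variable R : realType.

Lemma is_derive_scaled (f : R -> R) (x w d : R) :
  is_derive x (1 : R) f d -> is_derive x w f (w * d).
Proof.
move=> [df <-]; have diff : differentiable f x by exact/derivable1_diffP.
apply: DeriveDef; first exact: diff_derivable.
rewrite !deriveE// -[w in LHS]mulr1 -[w * 1]/(w *: (1 : R)) linearZ.
by [].
Qed.

Variables (m n : nat) (i : 'I_m) (j : 'I_n).
Local Notation M := 'M[R]_(m, n).

Lemma is_derive_coord (f : R -> R) (x v : M) (d : R) : is_derive (x i j) (1 : R) f d ->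
  is_derive x v (fun y : M => f (y i j)) (v i j * d).
Proof.
move=> /(is_derive_scaled (v i j))[df <-].
apply: (@is_derive_affine R M R^o (fun y : M => y i j) f x v (v i j)) df => h.
by rewrite !mxE.
Qed.

Lemma sm_coord (W : set M) : open W -> sm W (fun x : M => x i j).
Proof.
move=> oW; apply/smP; split=> [x _|v]; first exact: coord_continuous.
have H x : is_derive x v (fun y : M => y i j) (v i j).
  by rewrite -[v i j]mulr1; exact: (@is_derive_coord id).
split=> [x _|]; first by case: (H x).
apply: sm_ext (sm_cst (v i j) oW) => // x _; by case: (H x).
Qed.

Lemma sm_coord_expR : sm (setT : set M) (fun x : M => expR (x i j)).
Proof.
apply: (@sm_coind _ _ setT (fun f => exists c, f = fun x : M => c * expR (x i j)) openT).
  move=> _ [c ->]; have H x v : is_derive x v (fun y : M => c * expR (y i j)) (v i j * (c * expR (x i j))).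
    exact: (@is_derive_coord (fun t => c * expR t)).
  split=> [x _|v]; last first.
    exists (fun x : M => (v i j * c) * expR (x i j)); first by exists (v i j * c).
    by move=> x _; rewrite -mulrA.
  apply: (cvgM (@cvg_cst _ c _ (nbhs x) _)).
  apply: (@continuous_comp _ _ _ (fun y : M => y i j) expR); first exact: coord_continuous.
  exact: continuous_expR.
by exists 1; apply/funext => x; rewrite mul1r.
Qed.

Lemma sm_coord_ln (W : set M) : open W -> (forall x, W x -> 0 < x i j) ->
  sm W (fun x : M => ln (x i j)).
Proof.
move=> oW Wp; apply/smP; split=> [x Wx|v].
  apply: (@continuous_comp _ _ _ (fun y : M => y i j) (@ln R)); first exact: coord_continuous.
  exact/continuous_ln/Wp.
have H x : W x -> is_derive x v (fun y : M => ln (y i j)) (v i j * (x i j)^-1).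
  by move=> Wx; apply: is_derive_coord; exact/is_derive1_ln/Wp.
split=> [x /H[]//|].
apply: sm_ext (smM oW (sm_cst (v i j) oW) (smV oW _ (sm_coord oW))) => // x Wx.
- by case: (H x Wx).
- exact/lt0r_neq0/Wp.
Qed.

End LogSmooth.

(** * Passage to logarithmic coordinates *)

Section LogCoordinates.
Local Open Scope complex_scope.
Variables (R : realType) (s t : nat).
Local Notation E := 'M[R]_(s + t, 2).
Local Notation I := ('I_(s + t) * 'I_2)%type.
Local Notation W := (@OT_cover R s t).
Implicit Types (l : I) (T : {set I}) (f g : E -> R[i]) (q p v : E).

Lemma coverP q : W q <-> forall i : 'I_(s + t), (i < s)%N -> 0 < q i 1.
Proof.
split=> [Wq i si|H i]; last exact: (H (lshift t i) (ltn_ord i)).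
by have := Wq (Ordinal si); rewrite (_ : lshift t (Ordinal si) = i)//; exact: val_inj.
Qed.

Lemma open_cover : open W.
Proof.
rewrite openE => q /coverP Wq.
have : \near q, forall i : 'I_(s + t), (i < s)%N -> 0 < (q : E) i 1.
  apply: (@filter_forall E 'I_(s + t) (fun i (x : E) => (i < s)%N -> 0 < x i 1) (nbhs q)) => i; case: (ltnP i s) => si; last by apply: nearW => x.
  have c1 : (fun x : E => x i 1) x @[x --> q] --> q i 1 by exact: coord_continuous.
  have := @cvgr_gt R E (nbhs q) (nbhs_filter q) (fun x : E => x i 1) (q i 1) c1 _ (Wq i si).
  by apply: filterS => x.
by apply: filterS => x /coverP.
Qed.

Lemma isc_cover q l : W q -> isc l -> 0 < q l.1 l.2.
Proof. by move=> /coverP Wq /andP[/Wq + /eqP ->]. Qed.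

Definition logc q : E := \matrix_(i, j) if isc (i, j) then ln (q i j) else q i j.

Definition expc p : E := \matrix_(i, j) if isc (i, j) then expR (p i j) else p i j.

Lemma cover_expc p : W (expc p).
Proof. by apply/coverP => i si; rewrite mxE /isc /= si expR_gt0. Qed.

Lemma expcK p : logc (expc p) = p.
Proof.
by apply/matrixP => i j; rewrite !mxE; case: (isc _) => //; rewrite expRK.
Qed.

Lemma logcK q : W q -> expc (logc q) = q.
Proof.
move=> Wq; apply/matrixP => i j; rewrite !mxE; case: (boolP (isc (i, j))) => // sc.
by rewrite lnK// posrE; exact: (isc_cover Wq sc).
Qed.

Lemma sm_logc i j : sm W (fun q => logc q i j).
Proof.
have oW := open_cover; have [sc|sc] := boolP (isc (i, j)).
  apply: sm_ext (sm_coord_ln (i := i) (j := j) oW _) => // q Wq; first by rewrite mxE sc.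
  exact: (isc_cover Wq sc).
by apply: sm_ext (sm_coord i j oW) => // q Wq; rewrite mxE (negbTE sc).
Qed.

Lemma sm_expc i j : sm setT (fun p => expc p i j).
Proof.
have oT := @openT E; have [sc|sc] := boolP (isc (i, j)).
  by apply: sm_ext (sm_coord_expR R i j) => // q Wq; rewrite mxE sc.
by apply: sm_ext (sm_coord i j oT) => // q Wq; rewrite mxE (negbTE sc).
Qed.

(** Since dc_i = dy_i / y_i with y_i = Im w_i, division by [heights T] turns the product of the
    covectors [zeta] in the original coordinates into the product of the logarithmic covectors. *)
Definition height l q : R := if isc l then q l.1 l.2 else 1.

Definition heights T q : R := \prod_(l in T) height l q.

Lemma height_gt0 l q : W q -> 0 < height l q.
Proof. by move=> Wq; rewrite /height; case: ifP => // /(isc_cover Wq). Qed.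

Lemma heights_gt0 T q : W q -> 0 < heights T q.
Proof. by move=> Wq; apply: prodr_gt0 => l _; exact: height_gt0. Qed.

Lemma sm_height l : sm W (height l).
Proof.
have oW := open_cover; rewrite /height; case: (isc l); last exact: (sm_cst 1 oW).
exact: sm_coord.
Qed.

Lemma sm_heights T : sm W (heights T).
Proof.
have oW := open_cover; rewrite /heights.
elim: (index_enum _) => [|l r IH].
  by apply: sm_ext (sm_cst 1 oW) => // q _; rewrite big_nil.
have [lT|lT] := boolP (l \in T).
  by apply: sm_ext (smM oW (sm_height l) IH) => // q _; rewrite big_cons lT.
by apply: sm_ext IH => // q _; rewrite big_cons (negbTE lT).
Qed.

Lemma csm_heightsV T : smooth_on W (fun q => (heights T q)^-1%:C).
Proof.
have oW := open_cover; apply: csm_real => //; apply: smV => //; last exact: sm_heights.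
by move=> q Wq; exact/lt0r_neq0/heights_gt0.
Qed.

Lemma csm_pull_log (b : cinf E) : smooth_on W (fun q => b (logc q)).
Proof.
exact: (csm_comp open_cover (@openT E) sm_logc (fun _ _ => Logic.I) (smooth_cinf b)).
Qed.

Lemma csm_pull_exp f : smooth_on W f -> smooth_on setT (f \o expc).
Proof.
exact: (csm_comp (@openT E) open_cover sm_expc (fun p _ => cover_expc p)).
Qed.

Lemma zeta_sum l (J : Type) (r : seq J) (c : J -> R) (u : J -> E) :
  zeta l (\sum_(j <- r) c j *: u j) = \sum_(j <- r) (c j)%:C * zeta l (u j).
Proof.
elim: r => [|j r IH]; last by rewrite !big_cons zeta_linear IH.
by rewrite !big_nil /zeta; apply: big1 => j _; rewrite mxE mulr0.
Qed.

Definition frame_derive l f q : R[i] := \sum_j coefA R l j * cderive (delta_mx l.1 j) f q.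

Lemma frame_derive_expand v f q : smooth_on W f -> W q ->
  cderive v f q = \sum_l zeta l v * frame_derive l f q.
Proof.
move=> sf Wq.
have -> : cderive v f q = \sum_(h : I) (v h.1 h.2)%:C * cderive (basis_vec R h) f q.
  rewrite -(cderive_sumv _ _ _ open_cover sf Wq).
  by rewrite [in LHS](matrix_sum_delta v) pair_big.
under eq_bigr => h _.
  have -> : (v h.1 h.2)%:C = \sum_l dual_coef R l h * zeta l v.
    rewrite [in RHS](matrix_sum_delta v) pair_big /=.
    under eq_bigr do rewrite zeta_sum mulr_sumr.
    rewrite exchange_big (bigD1 h)//= [X in _ + X]big1 ?addr0 => [|g gh].
      under eq_bigr do rewrite mulrCA.
      by rewrite -mulr_sumr dual_coefP' eqxx mulr1.
    under eq_bigr do rewrite mulrCA.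
    by rewrite -mulr_sumr dual_coefP' eq_sym (negbTE gh) mulr0.
  rewrite mulr_suml; over.
rewrite exchange_big; apply: eq_bigr => l _ /=.
under eq_bigr do rewrite mulrAC mulrC.
rewrite -mulr_sumr; congr (_ * _).
rewrite -(pair_bigA _ (fun i j => dual_coef R l (i, j) * cderive (delta_mx i j) f q)) /=.
rewrite (bigD1 l.1)//= [X in _ + X]big1 ?addr0 => [|a ai]; last first.
  by apply: big1 => b _; rewrite /dual_coef /= eq_sym (negbTE ai) !mul0r.
by apply: eq_bigr => j _; rewrite /dual_coef eqxx mul1r.
Qed.

Lemma frame_deriveM l f g q : smooth_on W f -> smooth_on W g -> W q ->
  frame_derive l (fun q => f q * g q) q = frame_derive l f q * g q + f q * frame_derive l g q.
Proof.
move=> sf sg Wq; rewrite /frame_derive mulr_suml mulr_sumr -big_split.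
apply: eq_bigr => j _ /=; rewrite (cderiveM _ sf sg Wq); ring.
Qed.

(* The coordinate directions occurring in the frame vector dual to [zeta l]
   have the same height as [l]. *)
Lemma coefA_isc l j : coefA R l j != 0 -> isc (s := s) (l.1, j) = isc l.
Proof.
rewrite /coefA /isc /=; case: ifP => //= _.
by case: (l.2 =P j) => [->|]; rewrite ?eqxx.
Qed.

Lemma cderive_inv v f q : (forall r : R, f (r *: v + q) = f q) -> cderive v f q = 0.
Proof.
move=> fv; apply/eqP; rewrite eq_complex /cderive /derive /=.
apply/andP; split; apply/eqP.
  under eq_fun do rewrite /= fv subrr scaler0.
  exact: lim_cst.
under eq_fun do rewrite /= fv subrr scaler0.
exact: lim_cst.
Qed.

(** [heights T] involves only the y_i whose dc_i lies in [T]; this expresses that the logarithmic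
    covectors are closed. *)
Lemma frame_derive_heightsV l T q : W q -> l \notin T ->
  frame_derive l (fun q => (heights T q)^-1%:C) q = 0.
Proof.
move=> Wq lT; apply: big1 => j _.
have [->|/coefA_isc lj] := eqVneq (coefA R l j) 0; first by rewrite mul0r.
rewrite cderive_inv ?mulr0// => r; congr ((_^-1)%:C); apply: eq_bigr => h hT.
rewrite /height; case: ifP => // hc; rewrite !mxE; case: (h.1 =P l.1) => [h1|]; last by rewrite mulr0 add0r.
case: (h.2 =P j) => [h2|]; last by rewrite mulr0 add0r.
case/negP: lT; rewrite (_ : l = h)//; move: hc lj; rewrite /isc -h1 -h2 => /andP[-> /eqP h21].
rewrite h21 eqxx /= => /esym/eqP l2.
by rewrite [l]surjective_pairing [h]surjective_pairing h1 h21 l2.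
Qed.

Lemma derivable_logc q v : W q -> derivable logc q v.
Proof.
move=> Wq; apply/derivable_mxP => i j; exact: (sm_derivable (sm_logc i j) Wq).
Qed.

Lemma derive_logc v q i j : W q ->
  'D_v (fun y => logc y i j) q = v i j * (if isc (s := s) (i, j) then (q i j)^-1 else 1).
Proof.
move=> Wq; have [sc|sc] := boolP (isc (i, j)).
  have -> : (fun y => logc y i j) = (fun y : E => ln (y i j)).
    by apply/funext => y; rewrite mxE sc.
  have dln := is_derive1_ln (isc_cover Wq sc).
  by have [_ ->] := @is_derive_coord R (s + t) 2 i j (@ln R) q v _ dln.
have -> : (fun y => logc y i j) = (fun y : E => y i j).
  by apply/funext => y; rewrite mxE (negbTE sc).
by have [_ ->] := @is_derive_coord _ _ _ i j id q v 1 (is_derive_id _ _).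
Qed.

Lemma frame_derive_log l (b : cinf E) q : W q ->
  frame_derive l (fun q => b (logc q)) q = (height l q)^-1%:C * frameD l b (logc q).
Proof.
move=> Wq; rewrite /frame_derive /frameD cfun_sum mulr_sumr; apply: eq_bigr => j _.
rewrite cfunZ mulrCA; have [->|/coefA_isc lj] := eqVneq (coefA R l j) 0; first by rewrite !mul0r.
congr (_ * _).
have := @cderive_comp R E (s + t) 2 setT b logc q (delta_mx l.1 j) (@openT E) (smooth_cinf b) Logic.I (@derivable_logc q _ Wq).
rewrite /comp => ->.
have D (ij : I) : 'D_(delta_mx l.1 j) (fun y => logc y ij.1 ij.2) q =
    (ij == (l.1, j))%:R * (height l q)^-1.
  rewrite (derive_logc _ _ _ Wq) mxE -xpair_eqE -surjective_pairing.
  case: eqP => [->|_]; last by rewrite !mul0r.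
  rewrite !mul1r lj /height; case: ifP => [lc|]; last by rewrite invr1.
  by move: lj; rewrite lc /isc /=; case/andP: lc => -> /= /eqP -> /eqP ->.
under eq_bigr do rewrite D.
rewrite (bigD1 (l.1, j))//= eqxx mul1r big1 ?addr0// => ij /negbTE ->.
by rewrite mul0r rmorph0 mul0r.
Qed.

End LogCoordinates.

Section LogForms.
Local Open Scope complex_scope.
Variables (R : realType) (s t : nat) (l0 : 'I_(s + t) * 'I_2).
Local Notation E := 'M[R]_(s + t, 2).
Local Notation I := ('I_(s + t) * 'I_2)%type.
Local Notation W := (@OT_cover R s t).
Implicit Types (l : I) (T : {set I}) (q p : E) (a b : {set I} -> cinf E) (k : nat).

Definition log_form k b : dform E k := fun q v =>
  \sum_(T : {set I} | #|T| == k) ((heights T q)^-1%:C * b T (logc q)) * fminor l0 T v.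

Arguments log_form k b : clear implicits.

Lemma csm_log_coef T b : smooth_on W (fun q => (heights T q)^-1%:C * b T (logc q)).
Proof. by apply: csmM; [exact: open_cover|exact: csm_heightsV|exact: csm_pull_log]. Qed.

Lemma log_form_smooth k b : smooth_form W (log_form k b).
Proof.
have oW := @open_cover R s t; split=> [q _|v].
  by apply: alternating_sum => T; exact: fminor_alternating.
apply: csm_sum => // T _; apply: csmM => //; first exact: csm_log_coef.
exact: csm_cst.
Qed.

Lemma log_formP k c a b q v :
  log_form k (fun T => c *: a T + b T) q v = c * log_form k a q v + log_form k b q v.
Proof.
rewrite mulr_sumr -big_split; apply: eq_bigr => T _ /=.
transitivity ((heights T q)^-1%:C * (c * a T (logc q) + b T (logc q)) * fminor l0 T v); first by [].
by rewrite mulrDr mulrDl mulrCA !mulrA.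
Qed.

Lemma log_form_ext k a b : (forall T, #|T| = k -> a T = b T) -> log_form k a = log_form k b.
Proof.
move=> ab; apply/funext => q; apply/funext => v; apply: eq_bigr => T /eqP Tk.
by rewrite ab.
Qed.

(** The chain rule for the logarithm supplies exactly the factor by which [heights (l |: T)] differs
    from [heights T]. *)
Lemma frame_derive_coef l T b q : W q -> l \notin T ->
  frame_derive l (fun q => (heights T q)^-1%:C * b T (logc q)) q =
  (heights (l |: T)%SET q)^-1%:C * frameD l (b T) (logc q).
Proof.
move=> Wq lT; rewrite (frame_deriveM l (csm_heightsV R T) (csm_pull_log (b T)) Wq).
rewrite frame_derive_heightsV// mul0r add0r frame_derive_log// mulrA; congr (_ * _).
rewrite /heights big_setU1//= invfM rmorphM.
exact: mulrC.
Qed.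

(** Each derivative along [v i] is expanded in the frame; the alternating sum over [i] is then that
    of [minor_wedge]. *)
Lemma exterior_d_log_form k b q v : W q ->
  exterior_d (log_form k b) q v = log_form k.+1 (Kd b) q v.
Proof.
move=> Wq; have oW := @open_cover R s t.
pose ga T q := (heights T q)^-1%:C * b T (logc q).
transitivity (\sum_(T : {set I} | #|T| == k) \sum_l frame_derive l (ga T) q *
   \sum_(i < k.+1) (-1) ^+ i * zeta l (v i) * fminor l0 T (v \o lift i)).
  rewrite /exterior_d.
  have step (i : 'I_k.+1) : cderive (v i) (fun y => log_form k b y (v \o lift i)) q =
      \sum_(T : {set I} | #|T| == k) \sum_l frame_derive l (ga T) q *
         (zeta l (v i) * fminor l0 T (v \o lift i)).
    rewrite /log_form (cderive_sum (v i) _ oW (W := W))//; last first.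
      by move=> T _; apply: csmM => //; [exact: csm_log_coef|exact: csm_cst].
    apply: eq_bigr => T _; rewrite (cderiveM _ (csm_log_coef T b) (csm_cst _ oW) Wq).
    rewrite cderive_cst mulr0 addr0 (frame_derive_expand _ (csm_log_coef T b) Wq).
    rewrite mulr_suml; apply: eq_bigr => l _.
    by rewrite mulrAC mulrC mulrA.
  under eq_bigr do rewrite step mulr_sumr.
  rewrite exchange_big; apply: eq_bigr => T _ /=.
  under eq_bigr do rewrite mulr_sumr.
  rewrite exchange_big; apply: eq_bigr => l _ /=.
  rewrite mulr_sumr; apply: eq_bigr => i _.
  by rewrite mulrCA !mulrA.
transitivity (\sum_(T : {set I} | #|T| == k) \sum_(l | l \notin T)
   ((heights (l |: T)%SET q)^-1%:C * frameD l (b T) (logc q)) *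
   (sgn R[i] l T * fminor l0 (l |: T)%SET v)).
  apply: eq_bigr => T /eqP Tk; rewrite (bigID (mem T)) /= big1 ?add0r => [|l lT].
    apply: eq_bigr => l lT; rewrite frame_derive_coef//; congr (_ * _).
    have := @minor_wedge _ _ l0 k T l (fun l c => zeta l (v c)) Tk.
    by rewrite (negbTE lT) => <-.
  have := @minor_wedge _ _ l0 k T l (fun l c => zeta l (v c)) Tk.
  by rewrite lT => H; rewrite [X in _ * X]H mulr0.
rewrite (exchange_big_dep predT) //= /log_form /Kd /kd.
have step (T : {set I}) (F : I -> cinf E) (h m : R[i]) :
    h * (\sum_(l in T) F l) (logc q) * m = \sum_(l in T) h * F l (logc q) * m.
  by rewrite cfun_sum -mulr_suml mulr_sumr.
under [RHS]eq_bigr do rewrite step.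
rewrite [RHS](exchange_big_dep predT) //=; apply: eq_bigr => l _.
(* Sets of size k+1 containing [l] correspond to sets of size k avoiding it. *)
rewrite [RHS](reindex_onto (fun T => l |: T)%SET (fun T => T :\ l)%SET) /=; last first.
  by move=> T /andP[_ lT]; exact: finset.setD1K.
apply: eq_big => [T|T /andP[Tk lT]].
  rewrite finset.setU11 andbT; have [lT|lT] := boolP (l \in T).
    by rewrite andbF; apply/esym/negbTE; rewrite negb_and; apply/orP; right; apply/eqP => /finset.setP/(_ l); rewrite finset.setD11 lT.
  by rewrite cardsU1 lT add1n eqSS finset.setU1K// eqxx !andbT.
rewrite finset.setU1K// sgn_setU1// beforexx expr0 mulr1.
transitivity ((heights (l |: T)%SET q)^-1%:C * (sgn R[i] l T * frameD l (b T) (logc q)) *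
  fminor l0 (l |: T)%SET v); last by [].
by rewrite -!mulrA; congr (_ * _); rewrite mulrCA.
Qed.

End LogForms.
Arguments log_form {R s t} l0 k b.

Section LogFormsBijection.
Local Open Scope complex_scope.
Variables (R : realType) (s t : nat) (l0 : 'I_(s + t) * 'I_2).
Local Notation E := 'M[R]_(s + t, 2).
Local Notation I := ('I_(s + t) * 'I_2)%type.
Local Notation W := (@OT_cover R s t).
Local Notation Z := ('I_(s + t) -> R[i]).
Implicit Types (l : I) (T : {set I}) (q p : E) (a b : {set I} -> cinf E) (k : nat) (z y : Z).

(** The coefficients are read off on the dual frame, multiplied by the heights and pulled back by
    the exponential. *)
Lemma log_form_onto k (w : dform E k) : smooth_form W w ->
  exists a, (forall T, #|T| <> k -> a T = 0) /\ forall q, W q -> w q = log_form l0 k a q.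
Proof.
move=> [aw sw]; have oW := @open_cover R s t.
have sc T : smooth_on W (fun q => (heights T q)%:C * frame_coef l0 (w q) T).
  apply: csmM => //; first by apply: csm_real => //; exact: sm_heights.
  rewrite /frame_coef /frame_value; apply: csm_sum => // g _.
  by apply: csmM => //; exact: csm_cst.
exists (fun T => if #|T| == k then mk_cinf (csm_pull_exp (sc T)) else 0); split.
  by move=> T /eqP/negbTE ->.
move=> q Wq; apply/funext => v; rewrite (frame_expansion l0 v (aw q Wq)).
apply: eq_bigr => T Tk; rewrite Tk; congr (_ * _).
transitivity ((heights T q)^-1%:C * ((heights T (expc (logc q)))%:C * frame_coef l0 (w (expc (logc q))) T)); last by [].
rewrite logcK// mulrA -rmorphM mulVf ?rmorph1 ?mul1r//.
exact/lt0r_neq0/heights_gt0.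
Qed.

Lemma log_form_inj k a b T :
  (forall q v, W q -> log_form l0 k a q v = log_form l0 k b q v) -> #|T| = k -> a T = b T.
Proof.
move=> ab Tk; apply: cinfP => p; have Wp := cover_expc p.
pose co (a : {set I} -> cinf E) S := ((heights S (expc p))^-1%:C * a S (logc (expc p))) : R[i].
have := @frame_coef_unique R s t l0 k (co a) T Tk.
have -> : (fun v : 'I_k -> E => \sum_(S : {set I} | #|S| == k) co a S * fminor l0 S v) =
    (fun v => \sum_(S : {set I} | #|S| == k) co b S * fminor l0 S v).
  by apply/funext => v; exact: (ab (expc p) v Wp).
rewrite (@frame_coef_unique R s t l0 k (co b) T Tk) /co expcK => /mulfI ->//.
by rewrite fmorph_eq0 invr_eq0; exact/lt0r_neq0/heights_gt0.
Qed.

Definition cact z y q : E := of_ccoord (fun i => z i * ccoord q i + y i).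
Definition ctan z v : E := of_ccoord (fun i => z i * ccoord v i).

Definition real_shift y : Prop := forall i : 'I_(s + t), (i < s)%N -> complex.Im (y i) = 0.

Lemma vert_shift y : real_shift y -> vert (of_ccoord y).
Proof. by move=> ry i si; rewrite mxE /= ry. Qed.

Lemma cact_coord z y q (i : 'I_(s + t)) : positive_scale z -> real_shift y -> (i < s)%N ->
  cact z y q i 1 = complex.Re (z i) * q i 1.
Proof.
move=> pz ry si; have [zi _] := pz i si; rewrite mxE /= raddfD /= ry// addr0.
by case: (z i) zi => c d /= ->; rewrite mul0r addr0.
Qed.

Lemma cact_cover z y q : positive_scale z -> real_shift y -> W q -> W (cact z y q).
Proof.
move=> pz ry /coverP Wq; apply/coverP => i si; rewrite cact_coord//.
by have [_ zi] := pz i si; apply: mulr_gt0 => //; exact: Wq.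
Qed.

Lemma logc_cact z y q : positive_scale z -> real_shift y -> W q ->
  logc (cact z y q) = of_ccoord y + log_act z (logc q).
Proof.
move=> pz ry Wq; apply/matrixP => i j; rewrite mxE; case: ifP => sc.
  have /andP[/= si /eqP j1] := sc; rewrite j1 in sc *; rewrite cact_coord//.
  have [_ zi] := pz i si; rewrite !mxE /= si sc ry// add0r lnM//; last exact: (isc_cover Wq sc).
  by rewrite addrC.
rewrite !mxE /= sc; case: (I2P j) sc => ->; rewrite /isc /= ?andbT ?andbF => sc.
  rewrite addrC; case: (ltnP i s) => si.
    have [zi _] := pz i si.
    by rewrite raddfD /=; case: (z i) zi => c d /= ->; rewrite mul0r subr0 addr0.
  by rewrite raddfD /=; case: (z i) => c d /=; rewrite addr0.
rewrite sc raddfD /=; case: (z i) => c d /=; rewrite addr0 addrC; congr (_ + _).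
Qed.

(** At a covector dc_i the factor z_i of the tangent map is cancelled by the change of height, in
    accordance with the weight 1. *)
Lemma zeta_ctan z y q l v : positive_scale z -> real_shift y -> W q ->
  (height l (cact z y q))^-1%:C * zeta l (ctan z v) = wt z l * ((height l q)^-1%:C * zeta l v).
Proof.
move=> pz ry Wq; case: (boolP (isc l)) => lc.
  have /andP[si /eqP l1] := lc; have [zi zp] := pz _ si.
  rewrite /height lc l1 cact_coord// /wt si l1 /= mul1r /zeta !sumI2 /coefB si l1 /= !mul0r !add0r !mul1r.
  rewrite mxE /=; case: (z l.1) zi zp => c d /= -> c0; rewrite mul0r addr0.
  rewrite -!rmorphM; congr (_%:C); rewrite invfM mulrACA mulVf ?mul1r//; exact: lt0r_neq0.
rewrite /height (negbTE lc) invr1 rmorph1 !mul1r; case: l lc => i j /=; rewrite /isc /wt /zeta !sumI2 /coefB /= !mxE /=.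
case: ifP => si /=.
  case: (I2P j) => -> //= _; have [zi _] := pz i si.
  rewrite !mul1r !mul0r !addr0; case: (z i) zi => c d /= ->.
  by apply/eqP; rewrite eq_complex /=; apply/andP; split; apply/eqP; ring.
case: (z i) => c d; case: (I2P j) => -> _ /=; apply/eqP; rewrite eq_complex /=;
  by apply/andP; split; apply/eqP; ring.
Qed.

Lemma log_form_cact k a z y q v : positive_scale z -> real_shift y -> W q ->
  log_form l0 k a (cact z y q) (fun i => ctan z (v i)) =
  log_form l0 k (fun T => wts z T *: pull (log_act z) (pull (trans (of_ccoord y)) (a T))) q v.
Proof.
move=> pz ry Wq; apply: eq_bigr => T /eqP Tk.
transitivity (a T (logc (cact z y q)) *
    ((heights T (cact z y q))^-1%:C * fminor l0 T (fun i => ctan z (v i)))).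
  by rewrite mulrA [a T _ * _]mulrC.
transitivity ((wts z T * a T (of_ccoord y + log_act z (logc q))) *
    ((heights T q)^-1%:C * fminor l0 T v)); last first.
  by rewrite mulrA [_ * (heights T q)^-1%:C]mulrC.
rewrite logc_cact// [wts z T * _]mulrC -mulrA; congr (_ * _).
rewrite /wts /heights -!prodfV !rmorph_prod /= -!minor_scale//.
congr (\det _); apply/matrixP => i j; rewrite !mxE.
exact: zeta_ctan.
Qed.

End LogFormsBijection.

(** * Bundle-valued forms as equivariant families of coefficients *)

Section BundleForms.
Local Open Scope complex_scope.
Variables (R : realType) (s t : nat) (K : fieldExtType rat).
Variables (sigma : 'I_(s + t + t) -> {rmorphism K -> R[i]}) (U : set K).
Variable (l0 : 'I_(s + t) * 'I_2).
Hypothesis hsigma : embeddings_of_signature sigma.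
Hypothesis hU : U `<=` positive_units sigma.
Local Notation E := 'M[R]_(s + t, 2).
Local Notation I := ('I_(s + t) * 'I_2)%type.
Local Notation W := (@OT_cover R s t).
Implicit Types (l : I) (T : {set I}) (q p : E) (a b : {set I} -> cinf E) (k : nat).

Definition scaling (x : K) (i : 'I_(s + t)) : R[i] := sigma (lshift t i) x.

Definition integer_lattice : set E := [set of_ccoord (scaling x) | x in @ring_of_integers K].

Lemma scaling_real x : real_shift (scaling x).
Proof. by move=> i si; have [_ _ + _ _] := hsigma; apply. Qed.

Lemma scaling_pos x : U x -> positive_scale (scaling x).
Proof.
move=> /hU[_ xp] i si; split; first exact: scaling_real.
have := xp (Ordinal si); rewrite (_ : lshift t (lshift t (Ordinal si)) = lshift t i); last exact: val_inj.
by rewrite -/(scaling x i) ltcE => /andP[_].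
Qed.

Lemma integer_lattice_vert : integer_lattice `<=` @vert R s t.
Proof. by move=> _ [x _ <-]; exact/vert_shift/scaling_real. Qed.

Lemma OT_actionE x y q : OT_action sigma x y q = cact (scaling x) (scaling y) q.
Proof. by []. Qed.

Lemma OT_tangentE x q : OT_tangent sigma x q = ctan (scaling x) q.
Proof. by []. Qed.

Lemma bundle_form_ext (rho : U -> R[i]) k (w w' : dform E k) : eq_on_cover w w' ->
  bundle_form sigma rho w -> bundle_form sigma rho w'.
Proof.
move=> ww [[aw sw] ew]; split; first split.
- by move=> q Wq; rewrite -ww//; exact: aw.
- move=> v; apply: csm_ext (sw v); first exact: open_cover.
  by move=> q Wq; rewrite ww.
move=> u b bO q Wq v; rewrite -!ww//; first exact: ew.
by rewrite OT_actionE; apply: cact_cover => //; [exact/scaling_pos/set_valP|exact: scaling_real].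
Qed.

Variables (rho : U -> R[i]) (k : nat).
Hypothesis rho0 : forall u, rho u != 0.
Hypothesis rho1 : exists2 u : U, val u = 1 & rho u = 1.

Definition equivariant a : Prop :=
  Linv integer_lattice a /\ forall u : U, tw (scaling (val u)) (rho u) a = a.

Lemma log_form_bundle a : equivariant a -> bundle_form sigma rho (log_form l0 k a).
Proof.
move=> [La ta]; split; first exact: log_form_smooth.
move=> u b bO q Wq v; have zu := scaling_pos (set_valP u).
rewrite OT_actionE; under [X in log_form _ _ _ _ X]eq_fun do rewrite OT_tangentE.
rewrite (log_form_cact _ _ _ zu (scaling_real b) Wq).
have -> : (fun T => wts (scaling (val u)) T *: pull (log_act (scaling (val u)))
   (pull (trans (of_ccoord (scaling b))) (a T))) = (fun T => rho u *: a T).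
  apply/funext => T; rewrite (_ : pull (trans _) (a T) = a T).
    rewrite -[in RHS](ta u) /tw scalerA mulrA divff ?mul1r//.
  by apply/pull_transP; apply: La; exists b.
rewrite /log_form mulr_sumr; apply: eq_bigr => T _.
transitivity ((heights T q)^-1%:C * (rho u * a T (logc q)) * fminor l0 T v); first by [].
by rewrite mulrCA !mulrA.
Qed.

(** Injectivity of [log_form] transfers equivariance to the coefficients. The unit 1 then isolates
    the translations, and the integer 0 isolates the units. *)
Lemma bundle_log_form a : (forall T, #|T| <> k -> a T = 0) ->
  bundle_form sigma rho (log_form l0 k a) -> equivariant a.
Proof.
move=> a0 [_ ea].
have key (u : U) (b : K) T : ring_of_integers b ->
    wts (scaling (val u)) T *: pull (log_act (scaling (val u)))
      (pull (trans (of_ccoord (scaling b))) (a T)) = rho u *: a T.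
  move=> bO; have [Tk|/eqP Tk] := eqVneq #|T| k; last by rewrite a0// !linear0.
  pose a1 S := wts (scaling (val u)) S *: pull (log_act (scaling (val u)))
      (pull (trans (of_ccoord (scaling b))) (a S)).
  pose a2 S := rho u *: a S.
  apply: (@log_form_inj R s t l0 k a1 a2 T) => // q v Wq.
  have zu := scaling_pos (set_valP u).
  rewrite -(log_form_cact _ _ _ zu (scaling_real b) Wq).
  have := ea u b bO q Wq v => ->; rewrite /log_form mulr_sumr; apply: eq_bigr => S _.
  transitivity ((heights S q)^-1%:C * (rho u * a S (logc q)) * fminor l0 S v); last by [].
  by rewrite [_ * (rho u * _)]mulrCA !mulrA.
split.
  move=> T _ [b bO <-]; apply/pull_transP.
  have [u1 u11 r1] := rho1; have := key u1 b T bO.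
  rewrite u11 r1 scale1r (_ : scaling 1 = fun=> 1); last first.
    by apply/funext => i; rewrite /scaling rmorph1.
  rewrite wts1 scale1r => H; rewrite -[RHS]H; apply: cinfP => p.
  by congr (a T (_ + _)); exact/esym/log_act1.
move=> u; apply/funext => T; rewrite /tw -scalerA.
have O0 : ring_of_integers (0 : K) by exact: (mxpoly.integral0 (intmul 1 : {rmorphism int -> K})).
have := key u 0 T O0; rewrite (_ : of_ccoord _ = 0).
  rewrite (_ : pull (trans 0) (a T) = a T) => [->|].
    by rewrite scalerA mulVf// scale1r.
  by apply: cinfP => p /=; rewrite add0r.
by apply/matrixP => i j; rewrite !mxE /scaling rmorph0 if_same.
Qed.

End BundleForms.

(** * Dimensions *)

Section QuotientDimension.
Variables (R : realType) (F : fieldType) (V : lmodType F) (Z B : set V).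

(** If more than [#|J|] vectors were independent modulo [B], the matrix of their coordinates on [w]
    would have a nonzero left kernel vector, which is a relation between them. *)
Lemma dim_quot_basis (J : finType) (w : J -> V) :
  (forall c x y, B x -> B y -> B (c *: x + y)) -> B 0 ->
  (forall j, Z (w j)) ->
  (forall z, Z z -> exists c : J -> F, B (z - \sum_j c j *: w j)) ->
  (forall c : J -> F, B (\sum_j c j *: w j) -> forall j, c j = 0) ->
  dim_quot R Z B = #|J|%:R%:E.
Proof.
move=> BD B0 wZ span free; apply/eqP; rewrite eq_le; apply/andP; split; last first.
  apply: ereal_sup_ubound; exists #|J| => //.
  exists (fun i => w (enum_val i)); split=> // c Bc i.
  rewrite -(enum_valK i); apply: (free (fun j => c (enum_rank j))).
  have -> // : \sum_j c (enum_rank j) *: w j = \sum_i c i *: w (enum_val i).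
  rewrite [RHS](reindex (@enum_rank J)) /=; last exact/onW_bij/enum_rank_bij.
  by apply: eq_bigr => j _; rewrite enum_rankK.
apply: ge_ereal_sup => _ [n [b [bZ bfree]] <-]; rewrite lee_fin ler_nat leqNgt.
apply/negP => Jn; have [C CE] := choice (fun i => span _ (bZ i)).
pose M : 'M[F]_(n, #|J|) := \matrix_(i, j) C i (enum_val j).
have : kermx M != 0.
  rewrite kermx_eq0 /row_free; apply: contraTneq Jn => <-.
  by rewrite -leqNgt; exact: rank_leq_col.
case/rowV0Pn => u /sub_kermxP uM /eqP; apply.
apply/matrixP => i0 i; rewrite ord1 mxE; apply: (bfree (fun i => u 0 i)).
have -> : \sum_i u 0 i *: b i = \sum_i u 0 i *: (b i - \sum_j C i j *: w j).
  under [RHS]eq_bigr do rewrite scalerBr scaler_sumr.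
  rewrite sumrB exchange_big /= [X in _ - X]big1 ?subr0// => j _.
  under eq_bigr do rewrite scalerA.
  rewrite -scaler_suml; have := congr1 (fun N : 'rV_#|J| => N 0 (enum_rank j)) uM.
  rewrite !mxE; under eq_bigr do rewrite mxE enum_rankK.
  by move=> ->; rewrite scale0r.
by elim/big_rec: _ => // i1 x _ Bx; exact: BD.
Qed.

End QuotientDimension.

(** * The dimension of the exterior power *)

Section ExteriorDimension.
Local Close Scope classical_set_scope.
Variables (F : numFieldType) (n k : nat) (l0 : 'I_n).
Local Notation V := (tensor_power F n k).
Local Notation B := (@alt_relations F n k).
Implicit Types (f : {ffun 'I_k -> 'I_n}) (v : 'I_k -> 'rV[F]_n) (x y : V).

Lemma lin_span_closed (W : lmodType F) (S : set W) (c : F) (x y : W) :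
  lin_span S x -> lin_span S y -> lin_span S (c *: x + y).
Proof.
move=> [m [a [b [Sb ->]]]] [m' [a' [b' [Sb' ->]]]].
exists (m + m')%N, (fun i => match fintype.split i with inl j => c * a j | inr j => a' j end),
  (fun i => match fintype.split i with inl j => b j | inr j => b' j end); split.
  by move=> i; case: (fintype.split i).
rewrite big_split_ord scaler_sumr /=; congr (_ + _); apply: eq_bigr => i _.
- by rewrite (unsplitK (inl i)) scalerA.
- by rewrite (unsplitK (inr i)).
Qed.

Lemma lin_span0 (W : lmodType F) (S : set W) : lin_span S 0.
Proof. by exists 0%N, (fun=> 0), (fun=> 0); split=> [[]//|]; rewrite big_ord0. Qed.

Lemma lin_span_mem (W : lmodType F) (S : set W) (x : W) : S x -> lin_span S x.
Proof.
by move=> Sx; exists 1%N, (fun=> 1), (fun=> x); split=> //; rewrite big_ord1 scale1r.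
Qed.

Definition basis_tensor f : V := pure_tensor (fun i => delta_mx 0 (f i)).

Lemma basis_tensorE f g : basis_tensor f g = (g == f)%:R.
Proof.
rewrite ffunE; have [->|gf] := eqVneq g f.
  by rewrite big1// => i _; rewrite mxE !eqxx.
have [i gfi] : exists i, g i != f i.
  by apply/existsP; rewrite -negb_forall; apply: contraNN gf => /forallP H; apply/eqP/ffunP => b; exact/eqP.
by rewrite (bigD1 i)//= mxE (negbTE gfi) andbF mul0r.
Qed.

Lemma tensor_expand x : x = \sum_f x f *: basis_tensor f.
Proof.
apply/ffunP => g; rewrite sum_ffunE (bigD1 g)//= big1 ?addr0 => [|f /negbTE gf].
  by rewrite ffunE basis_tensorE eqxx [_ *: _]mulr1.
by rewrite ffunE basis_tensorE eq_sym gf scaler0.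
Qed.

Lemma alt_relations_tperm f (p q : 'I_k) : p != q ->
  B (basis_tensor f + basis_tensor [ffun a => f (tperm p q a)]).
Proof.
move=> pq; pose v i : 'rV[F]_n := delta_mx 0 (f i).
pose Q (a b : 'rV[F]_n) : 'I_k -> 'rV[F]_n := fun i => if i == p then a else if i == q then b else v i.
have QE a b g : pure_tensor (Q a b) g = a 0 (g p) * (b 0 (g q) * \prod_(i | (i != p) && (i != q)) v i 0 (g i)).
  rewrite ffunE (bigD1 p)//= (bigD1 q) 1?eq_sym//= /Q eqxx eq_sym (negbTE pq) eqxx; congr (_ * (_ * _)).
  by apply: eq_bigr => i /andP[/negbTE -> /negbTE ->].
have BQ a : B (pure_tensor (Q a a)).
  apply: lin_span_mem; exists (Q a a); split=> //; exists p, q; split=> //.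
  by rewrite /Q eqxx eq_sym (negbTE pq) eqxx.
(* Polarization in the factors [p] and [q]: the tensor with [v p + v q] twice, minus those with
   [v p] twice and with [v q] twice. *)
have -> : basis_tensor f + basis_tensor [ffun a => f (tperm p q a)] =
   (-1) *: pure_tensor (Q (v p) (v p)) + ((-1) *: pure_tensor (Q (v q) (v q)) + pure_tensor (Q (v p + v q) (v p + v q))).
  have -> : basis_tensor f = pure_tensor (Q (v p) (v q)).
    congr pure_tensor; apply/funext => i; rewrite /Q /v.
    by case: eqP => [->//|_]; case: eqP => [->|].
  have -> : basis_tensor [ffun a => f (tperm p q a)] = pure_tensor (Q (v q) (v p)).
    congr pure_tensor; apply/funext => i; rewrite /Q /v ffunE.
    by case: tpermP => [->|->|/eqP/negbTE -> /eqP/negbTE ->]; rewrite ?eqxx// eq_sym (negbTE pq).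
  have addE (x y : V) g : (x + y) g = x g + y g by exact: ffunE.
  have sclE (x : V) g : ((-1) *: x) g = - x g by rewrite ffunE [_ *: _]mulN1r.
  have vD i : (v p + v q) 0 i = v p 0 i + v q 0 i by rewrite mxE.
  apply/ffunP => g; rewrite !addE !sclE !QE !vD.
  move: (v p 0 _) (v p 0 _) (v q 0 _) (v q 0 _) (\prod_(_ | _) _) => z1 z2 z3 z4 z5.
  by ring.
by do 2?[apply: lin_span_closed; first exact: BQ]; exact: BQ.
Qed.

(** A linear functional that vanishes on the relations, being on each generator a determinant with
    two equal columns. These functionals are dual to the increasing basis tensors. *)
Definition minor_coef (T : {set 'I_n}) x : F :=
  \sum_f x f * minor l0 T (fun l b => (l == f b)%:R).

Lemma minor_coefP T c x y : minor_coef T (c *: x + y) = c * minor_coef T x + minor_coef T y.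
Proof.
rewrite mulr_sumr -big_split; apply: eq_bigr => f _ /=.
by rewrite !ffunE mulrDl -mulrA.
Qed.

Lemma minor_coef_sum T (J : finType) (c : J -> F) (b : J -> V) :
  minor_coef T (\sum_i c i *: b i) = \sum_i c i * minor_coef T (b i).
Proof.
have Z0 : minor_coef T 0 = 0 by apply: big1 => f _; rewrite ffunE mul0r.
elim: (index_enum _) => [|i r IH]; first by rewrite !big_nil.
by rewrite !big_cons minor_coefP IH.
Qed.

Lemma minor_coef_alt T x : B x -> minor_coef T x = 0.
Proof.
move=> [m [c [b [bB ->]]]]; rewrite minor_coef_sum big1// => i _.
have [v [[p [q [pq vpq]]] ->]] := bB i.
rewrite (_ : minor_coef _ _ = 0) ?mulr0//.
rewrite /minor_coef; under eq_bigr do rewrite ffunE.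
rewrite (det_expand (fun b l => v b 0 l) (fun a l => (sorted_idx l0 T a == l)%:R)).
by rewrite -det_tr; apply: (determinant_alternate pq) => a; rewrite !mxE vpq.
Qed.

Lemma minor_coef_basis (T S : {set 'I_n}) : #|T| = k -> #|S| = k ->
  minor_coef T (basis_tensor [ffun a => sorted_idx l0 S a]) = (T == S)%:R.
Proof.
move=> Tk Sk; rewrite /minor_coef (bigD1 [ffun a => sorted_idx l0 S a])//= big1 => [|f /negbTE fS].
  rewrite basis_tensorE eqxx mul1r addr0 -(@minor_delta _ _ l0 k)//.
  by congr (\det _); apply/matrixP => a b; rewrite !mxE ffunE.
by rewrite basis_tensorE fS mul0r.
Qed.

(** The increasing basis tensors, one for each subset of size k, span by [sorted_mod] and are
    separated by [minor_coef]. *)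
Lemma dim_quot_exterior (R : realType) : dim_quot R setT B = ('C(n, k))%:R%:E.
Proof.
pose J := {T : {set 'I_n} | #|T| == k}.
have -> : 'C(n, k) = #|{: J}|.
  by rewrite card_sig -[n in LHS]card_ord -card_draws; apply: eq_card => T; rewrite finset.inE.
pose w (T : J) : V := basis_tensor [ffun a => sorted_idx l0 (val T) a].
have BD := @lin_span_closed V _; have B0 := @lin_span0 V.
apply: (@dim_quot_basis R F V setT B J w) => //.
- exact: BD.
- exact: B0.
- move=> x _.
  have H f : exists c : J -> F, B (basis_tensor f - \sum_T c T *: w T).
    have [||||Bf|[T [c [Tk Bf]]]] := @sorted_mod _ l0 F V B k basis_tensor _ _ _ _ f.
    + exact: BD.
    + exact: B0.
    + move=> g i j ij gij; apply: lin_span_mem; exists (fun i => delta_mx 0 (g i)); split=> //.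
      by exists i, j; split=> //; rewrite gij.
    + by move=> g p q; have [->|pq] := eqVneq p q; [right|left; exact: alt_relations_tperm].
    + exists (fun=> 0); rewrite big1 ?subr0// => T _; exact: scale0r.
    exists (fun S => if val S == T then c else 0).
    rewrite (bigD1 (exist _ T (introT eqP Tk)))//= eqxx big1 ?addr0// => S ST.
    case: eqP => [E|_]; last exact: scale0r.
    by case/eqP: ST; exact: val_inj.
  have [c cE] := choice H.
  exists (fun T => \sum_f x f * c f T).
  have -> : x - \sum_T (\sum_f x f * c f T) *: w T =
      \sum_f x f *: (basis_tensor f - \sum_T c f T *: w T).
    under [RHS]eq_bigr do rewrite scalerBr scaler_sumr.
    rewrite sumrB -tensor_expand exchange_big /=; congr (_ - _); apply: eq_bigr => T _.
    by rewrite scaler_suml; apply: eq_bigr => f _; rewrite scalerA.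
  by apply: (big_rec B) => [|f y _ By]; [exact: B0|exact: BD (cE f) By].
have dual (T S : J) : minor_coef (val T) (w S) = (T == S)%:R.
  by case: T S => [T Tk] [S Sk]; rewrite minor_coef_basis//=; exact/eqP.
move=> c Bc T; have := minor_coef_alt (val T) Bc.
rewrite minor_coef_sum (bigD1 T)//= dual eqxx mulr1 big1 ?addr0// => S ST.
by rewrite dual eq_sym (negbTE ST) mulr0.
Qed.

End ExteriorDimension.

(** * Number fields *)

Section Integers.
Variable K : fieldExtType rat.
Implicit Types x y : K.

Let iota : {rmorphism int -> K} := intmul 1.

Lemma ring_of_integersM x y : ring_of_integers x -> ring_of_integers y -> ring_of_integers (x * y).
Proof. exact: (@mxpoly.integral_mul _ _ iota x y). Qed.

Lemma ring_of_integersX x n : ring_of_integers x -> ring_of_integers (x ^+ n).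
Proof.
move=> xO; elim: n => [|n IH]; first exact: (mxpoly.integral1 iota).
by rewrite exprS; exact: ring_of_integersM.
Qed.

Lemma intr_ext_eq0 (z : int) : (z%:~R == 0 :> K) = (z == 0).
Proof. by rewrite -(rmorph_int (GRing.in_alg K)) fmorph_eq0 intr_eq0. Qed.

(** If [a] is the leading coefficient of an integer polynomial q of degree d with root x, then a x
    is a root of the monic integer polynomial a^(d-1) q(X/a), which is [r]. *)
Lemma scale_integral x : exists2 c : int, c != 0 & ring_of_integers (c%:~R * x).
Proof.
have [p mp rp] : exists2 p : {poly rat}, p != 0 & root (map_poly (in_alg K) p) x.
  have /polyOver1P[p pE] := minPolyOver 1%AS x.
  exists p; last by rewrite -pE root_minPoly.
  by apply: contraTneq (monic_minPoly 1%AS x) => p0; rewrite pE p0 map_poly0 monicE lead_coef0 eq_sym oner_eq0.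
have [q [c c0 pq]] := rat_poly_scale p.
have q0 : q != 0 by apply: contraNneq mp => q0; rewrite pq q0 map_poly0 scaler0.
have rq : root (map_poly intr q) x.
  have E : map_poly (in_alg K) (map_poly intr q) = map_poly intr q.
    by rewrite -map_poly_comp; apply: eq_map_poly => z; exact: (rmorph_int (GRing.in_alg K)).
  move: rp; rewrite pq map_polyZ /root hornerZ mulf_eq0 E fmorph_eq0 invr_eq0 intr_eq0.
  by rewrite (negbTE c0).
pose d := (size q).-1; have sq : size q = d.+1 by rewrite prednK// lt0n size_poly_eq0.
pose a := lead_coef q.
exists a; first by rewrite lead_coef_eq0.
pose r := \poly_(i < d.+1) (if i == d then 1 else q`_i * a ^+ (d - i.+1)).
have rE i : r`_i = if (i < d.+1)%N then (if i == d then 1 else q`_i * a ^+ (d - i.+1)) else 0 by rewrite coef_poly.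
have sr : size r = d.+1 by rewrite size_poly_eq// eqxx oner_eq0.
have d0 : (0 < d)%N.
  rewrite lt0n; apply: contraTneq rq => d0; rewrite /root.
  have := sq; rewrite d0 => /eqP/size_poly1P[z z0 ->].
  by rewrite map_polyC hornerC intr_ext_eq0.
exists r; first by rewrite monicE lead_coefE sr rE /= ltnSn eqxx.
rewrite /root horner_coef size_map_poly_id0; last first.
  by rewrite lead_coefE sr rE /= ltnSn eqxx rmorph1 oner_eq0.
rewrite sr; move: rq; rewrite /root horner_coef size_map_poly_id0; last first.
  by rewrite intr_ext_eq0 lead_coef_eq0.
rewrite sq => /eqP Q; apply/eqP; transitivity (a%:~R ^+ d.-1 * \sum_(i < d.+1) (map_poly intr q)`_i * x ^+ i : K); last by rewrite Q mulr0.
rewrite mulr_sumr; apply: eq_bigr => i _; rewrite !coef_map rE ltn_ord /= exprMn.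
case: eqP => [id|/eqP id].
  rewrite id rmorph1 mul1r -[q`_d]/a.
  by rewrite mulrA -exprSr prednK.
have {}id : (i < d)%N by rewrite ltn_neqAle id -ltnS ltn_ord.
have -> : d.-1 = (d - i.+1 + i)%N by lia.
rewrite rmorphM rmorphXn /= exprD.
rewrite -!mulrA mulrCA; congr (_ * _); exact: mulrCA.
Qed.

(** A primitive element times a denominator; division by that integer shows that the generated field
    does not shrink. *)
Lemma integral_generator : exists2 a : K, ring_of_integers a & <<1; a>>%VS = fullv.
Proof.
have sep : separable 1 {: K}.
  by apply/separableP => y _; apply: pcharf0_separable; move=> p; rewrite pchar_lalg; exact: pchar_num.
have := eq_adjoin_separable_generator sep (sub1v _).
set a := separable_generator _ _ => aE.
have [c c0 cO] := scale_integral a.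
exists (c%:~R * a) => //; apply/eqP; rewrite eqEsubv subvf /= aE.
apply/FadjoinP; split; first exact: subv_adjoin.
have aE' : c%:~R^-1 * (c%:~R * a) = a by rewrite mulrA mulVf ?mul1r// intr_ext_eq0.
rewrite -[X in X \in _]aE'.
apply: rpredM; last exact: memv_adjoin.
by rewrite rpredV rpred_int.
Qed.

End Integers.

(** * The integers span the vertical directions *)

Section LatticeSpan.
Local Open Scope complex_scope.
Variables (R : realType) (s t : nat) (K : fieldExtType rat).
Variables (sigma : 'I_(s + t + t) -> {rmorphism K -> R[i]}).
Hypothesis hsigma : embeddings_of_signature sigma.
Local Notation E := 'M[R]_(s + t, 2).
Local Notation n := (s + t + t)%N.
Local Notation sc := (scaling sigma).

Lemma generator_inj (a : K) i j : <<1; a>>%VS = fullv -> sigma i a = sigma j a -> i = j.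
Proof.
move=> aE ij; have [_ inj _ _ _] := hsigma; apply: inj => x.
have : x \in <<1; a>>%VS by rewrite aE memvf.
have E k p : sigma k (map_poly (GRing.in_alg K) p).[a] = (map_poly ratr p).[sigma k a].
  rewrite -horner_map -map_poly_comp; congr (horner _ _); apply: eq_map_poly => q.
  exact: (fmorph_eq_rat (sigma k \o GRing.in_alg K)).
by move=> /Fadjoin1_polyP[p ->]; rewrite !E ij.
Qed.

Lemma conj_real (z : R[i]) : complex.Im z = 0 -> conjc z = z.
Proof. by case: z => c d /= ->; rewrite oppr0. Qed.

Lemma conj_sum (J : finType) (F : J -> R[i]) : conjc (\sum_j F j) = \sum_j conjc (F j).
Proof. exact: (rmorph_sum conjc). Qed.

(** The Vandermonde matrix of the conjugates of [a] is invertible, which gives complex coefficients.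
    Conjugation permutes the equations, so the conjugate coefficients solve them too. *)
Lemma real_span (a : K) v : <<1; a>>%VS = fullv -> @vert R s t v ->
  exists c : 'I_n -> R, v = \sum_j c j *: of_ccoord (sc (a ^+ j)).
Proof.
move=> aE vv; have [_ _ sreal _ sconj] := hsigma.
pose M : 'M[R[i]]_n := \matrix_(j, i) sigma i a ^+ j.
have Mu : M \in unitmx.
  have -> : M = Vandermonde n (\row_i sigma i a) by apply/matrixP => i j; rewrite !mxE.
  rewrite unitmxE det_Vandermonde unitfE prodf_seq_neq0; apply/allP => i _ /=.
  rewrite prodf_seq_neq0; apply/allP => j _; apply/implyP => ij; rewrite !mxE subr_eq0.
  by apply: contraTneq ij => /(generator_inj aE) ->; rewrite ltnn.
(* The prescribed values: those of [v] at the first s + t embeddings and the matching conjugates at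
   the last t. *)
pose x : 'rV[R[i]]_n := \row_i match fintype.split i with
  inl i' => ccoord v i' | inr k => conjc (ccoord v (rshift s k)) end.
pose d := x *m invmx M.
have dE i : \sum_j d 0 j * sigma i a ^+ j = x 0 i.
  have := congr1 (fun N : 'rV_n => N 0 i) (mulmxKV Mu x).
  by rewrite mxE => <-; apply: eq_bigr => j _; rewrite [M j i]mxE.
have dE' (i : 'I_(s + t)) : \sum_j conjc (d 0 j) * sigma (lshift t i) a ^+ j = ccoord v i.
  have key i' y : (forall k : nat, conjc (sigma i' a ^+ k) = sigma (lshift t i) a ^+ k) ->
      x 0 i' = y -> conjc y = ccoord v i ->
      \sum_j conjc (d 0 j) * sigma (lshift t i) a ^+ j = ccoord v i.
    move=> ci xi <-; rewrite -xi -dE conj_sum; apply: eq_bigr => j _.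
    by rewrite -ci -rmorphM.
  case: (ltnP i s) => si.
    apply: (key (lshift t i) (ccoord v i)).
    - by move=> k; apply: conj_real; rewrite -rmorphXn; exact: sreal.
    - by rewrite mxE (unsplitK (inl i)).
    - by apply: conj_real; exact: vv.
  pose k : 'I_t := cast_ord (addKn s t) (Ordinal (ltn_sub2r (leq_ltn_trans si (ltn_ord i)) (ltn_ord i))).
  have ik : rshift s k = i by apply/val_inj; rewrite /= subnKC.
  apply: (key (rshift (s + t) k) (conjc (ccoord v i))).
  - by move=> m; rewrite rmorphXn /= -sconj ik.
  - by rewrite mxE (unsplitK (inr k)) ik.
  - exact: conjcK.
have [r key] : exists r : 'I_n -> R,
    forall i : 'I_(s + t), \sum_j (r j)%:C * sc (a ^+ j) i = ccoord v i.
  (* Half the sum of the solution and its conjugate. *)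
  exists (fun j => complex.Re (d 0 j)) => i.
  have h2 : (2 : R[i]) != 0 by rewrite pnatr_eq0.
  have E1 := dE' i; have E2 := dE (lshift t i); rewrite mxE (unsplitK (inl i)) in E2.
  apply: (mulfI h2); transitivity (ccoord v i + ccoord v i); last by rewrite mulr_natl mulr2n.
  rewrite -{1}E1 -E2 mulr_sumr -big_split /=; apply: eq_bigr => j _.
  rewrite /scaling rmorphXn -mulrDl mulrA; congr (_ * _).
  rewrite mulr_natl mulr2n; case: (d 0 j) => b c /=.
  by apply/eqP; rewrite eq_complex /= addNr addr0 !eqxx.
exists r; apply/matrixP => i j; rewrite summxE.
under eq_bigr do rewrite !mxE.
have := key i; move/eqP; rewrite eq_complex !raddf_sum /= => /andP[/eqP re /eqP im].
case: (I2P j) => -> /=; [rewrite -re|rewrite -im]; apply: eq_bigr => k _.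
- by case: (sc (a ^+ k) i) => b c /=; rewrite mul0r subr0.
- by case: (sc (a ^+ k) i) => b c /=; rewrite mul0r addr0.
Qed.

Lemma spans_map (V : normedModType R) (m : nat) (g : 'I_m -> V) (W : set V) :
  (forall v, W v -> exists c : 'I_m -> R, v = \sum_j c j *: g j) ->
  spans [seq g j | j <- enum 'I_m] W.
Proof.
move=> H v /H[c ->]; have [r rE] := spans_enum c g; exists r; exact: rE.
Qed.

Lemma log_lin_scaling (x y : K) (z : 'I_(s + t) -> R[i]) : z =1 sc x ->
  log_lin z (of_ccoord (sc y)) = of_ccoord (sc (x * y)).
Proof.
move=> zx; apply/matrixP => i j; rewrite !mxE /= zx /scaling rmorphM.
have [_ _ sreal _ _] := hsigma.
case: (ltnP i s) => si.
  have := sreal (lshift t i) si x; have := sreal (lshift t i) si y.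
  case: (sigma _ x) => b c; case: (sigma _ y) => b' c' /= -> ->.
  by rewrite !mulr0 mul0r subr0 addr0.
by case: (sigma _ x) => b c; case: (sigma _ y) => b' c' /=.
Qed.

(** Lets a vertical vector be moved by the inverse unit, expanded in powers of the generator and
    moved back, so that the list transformed by a unit still spans. *)
Lemma log_linK (z z' : 'I_(s + t) -> R[i]) v : positive_scale z -> positive_scale z' ->
  (forall i, z i * z' i = 1) -> @vert R s t v -> log_lin z (log_lin z' v) = v.
Proof.
move=> pz pz' zz vv; apply/matrixP => i j; rewrite !mxE /=.
have := zz i; case: (ltnP i s) => si.
  have [zi _] := pz i si; have [zi' _] := pz' i si.
  case: (z i) zi => b c /= ->; case: (z' i) zi' => b' c' /= -> /eqP.
  rewrite eq_complex /= !mulr0 mul0r subr0 addr0 => /andP[/eqP bb _].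
  by case: (I2P j) => -> //=; rewrite mulrA bb mul1r.
case: (z i) => b c; case: (z' i) => b' c' /eqP; rewrite eq_complex /= => /andP[/eqP h1 /eqP h2].
case: (I2P j) => -> /=.
  transitivity ((b * b' - c * c') * v i 0 - (b * c' + c * b') * v i 1); first ring.
  by rewrite h1 h2 mul1r mul0r subr0.
transitivity ((b * b' - c * c') * v i 1 + (b * c' + c * b') * v i 0); first ring.
by rewrite h1 h2 mul1r mul0r addr0.
Qed.

End LatticeSpan.

Section UnitBasis.
Local Open Scope complex_scope.
Variables (R : realType) (s t : nat) (K : fieldExtType rat).
Variables (sigma : 'I_(s + t + t) -> {rmorphism K -> R[i]}) (U : set K).
Hypothesis s0 : (0 < s)%N.
Hypothesis hsigma : embeddings_of_signature sigma.
Hypothesis hU : OT_admissible sigma U.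
Local Notation lg := (log_embedding sigma).
Implicit Types x y : K.

Lemma unit_val x (i : 'I_s) : U x ->
  sigma (lshift t (lshift t i)) x = (complex.Re (sigma (lshift t (lshift t i)) x))%:C /\
  0 < complex.Re (sigma (lshift t (lshift t i)) x).
Proof.
move=> Ux; have [Up _ _ _] := hU.
have [zi zp] := scaling_pos hsigma Up Ux (i := lshift t i) (ltn_ord i).
split; last exact: zp.
by move: zi; rewrite /scaling; case: (sigma _ x) => a b /= ->.
Qed.

Lemma unit_neq0 x : U x -> x != 0.
Proof.
move=> Ux; have [xE] := unit_val (Ordinal s0) Ux.
by apply: contraTneq => ->; rewrite rmorph0 ltxx.
Qed.

Lemma log_embeddingM x y : U x -> U y -> lg (x * y) = lg x + lg y.
Proof.
move=> Ux Uy; apply/rowP => i; rewrite !mxE rmorphM.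
have [xE xp] := unit_val i Ux; have [yE yp] := unit_val i Uy.
by rewrite xE yE -rmorphM /= lnM.
Qed.

Lemma log_embedding1 : lg 1 = 0.
Proof. by apply/rowP => i; rewrite !mxE rmorph1 /= ln1. Qed.

(** A single real embedding is injective, and the logarithm determines its positive value. *)
Lemma log_embedding_inj x y : U x -> U y -> lg x = lg y -> x = y.
Proof.
move=> Ux Uy /rowP/(_ (Ordinal s0)); rewrite !mxE.
have [xE xp] := unit_val (Ordinal s0) Ux; have [yE yp] := unit_val (Ordinal s0) Uy.
move=> /ln_inj H; apply: (fmorph_inj (sigma (lshift t (lshift t (Ordinal s0))))).
by rewrite xE yE H.
Qed.

(** The generators are preimages of a lattice basis, and injectivity of the logarithm turns additive
    decompositions into multiplicative ones. Generation is phrased as an induction principle, the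
    form in which invariance and equality of characters are checked. *)
Lemma unit_basis : exists (u : 'I_s -> K) (B : 'M[R]_s),
  [/\ B \in unitmx, (forall j, U (u j)), (forall j, lg (u j) = row j B) &
   forall P : K -> Prop, P 1 -> (forall x y, U x -> U y -> P x -> P y -> P (x * y)) ->
     (forall x, U x -> P x -> P x^-1) -> (forall j, P (u j)) -> forall x, U x -> P x].
Proof.
have [_ [U1 UM UV] _ [b Bu bE]] := hU.
have [u uE] : exists u : 'I_s -> K, forall j, U (u j) /\ lg (u j) = b j.
  suff H j : exists x, U x /\ lg x = b j by have [u uE] := choice H; exists u.
  have : [set \sum_i b i *~ m i | m in [set: 'I_s -> int]] (b j).
    exists (fun i => (i == j)%:Z) => //; rewrite (bigD1 j)//= eqxx big1 ?addr0// => i /negbTE ->.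
    by [].
  by rewrite -bE => -[x Ux xE]; exists x.
exists u, (\matrix_i b i); split=> // [j|j|P P1 PM PV Pu x Ux].
- exact: (uE j).1.
- by rewrite rowK; exact: (uE j).2.
pose D y l := [/\ U y, P y & lg y = l].
have D1 : D 1 0 by split=> //; exact: log_embedding1.
have DM y z l l' : D y l -> D z l' -> D (y * z) (l + l').
  move=> [Uy Py yl] [Uz Pz zl]; split; [exact: UM|exact: PM|].
  by rewrite log_embeddingM// yl zl.
have DV y l : D y l -> D y^-1 (- l).
  move=> [Uy Py yl]; split; [exact: UV|exact: PV|apply/eqP; rewrite -addr_eq0 -yl].
  by rewrite -log_embeddingM ?mulVf ?log_embedding1 ?unit_neq0//; exact: UV.
have DX y l n : D y l -> D (y ^+ n) (l *+ n).
  by move=> Dy; elim: n => [|n IH]; rewrite ?exprS ?mulrS //; exact: DM.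
have DXz y l (m : int) : D y l -> D (y ^ m) (l *~ m).
  by move=> Dy; case: m => n; [exact: DX|apply: DV; exact: DX].
have : [set lg x | x in U] (lg x) by exists x.
rewrite bE => -[m _ mE].
have [] : D (\prod_j u j ^ m j) (\sum_j b j *~ m j).
  apply: (big_ind2 D) => [//|y l z l'|j _]; first exact: DM.
  by apply: DXz; split=> //; [exact: (uE j).1|exact: (uE j).2].
by move=> Uy Py; rewrite mE => /(log_embedding_inj Uy Ux) <-.
Qed.

End UnitBasis.

Section Characters.
Local Open Scope complex_scope.
Variables (R : realType) (s t : nat) (K : fieldExtType rat).
Variables (sigma : 'I_(s + t + t) -> {rmorphism K -> R[i]}) (U : set K).
Hypothesis s0 : (0 < s)%N.
Hypothesis hsigma : embeddings_of_signature sigma.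
Hypothesis hU : OT_admissible sigma U.
Local Notation E := 'M[R]_(s + t, 2).
Local Notation I := ('I_(s + t) * 'I_2)%type.
Local Notation sc := (scaling sigma).
Implicit Types (T : {set I}) (a b : {set I} -> cinf E) (u w : U).

Let Up : U `<=` positive_units sigma. Proof. by case: hU. Qed.

Lemma scalingM (x y : K) : sc (x * y) = fun i => sc x i * sc y i.
Proof. by apply/funext => i; exact: rmorphM. Qed.

Lemma scaling1 : sc 1 = fun=> 1.
Proof. by apply/funext => i; exact: rmorph1. Qed.

Definition unit_elt (x : K) (Ux : U x) : U := SigSub (mem_set Ux).

Lemma unit_one : U 1. Proof. by case: hU => _ []. Qed.

Lemma scaling_unit_pos u : positive_scale (sc (val u)).
Proof. exact/(scaling_pos hsigma Up)/set_valP. Qed.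

Lemma val_neq0 u : val u != 0.
Proof. exact/(unit_neq0 s0 hsigma hU)/set_valP. Qed.

Definition chi T u : R[i] := wts (sc (val u)) T.

Lemma chi_character T : @characters R K U (chi T).
Proof.
split=> [u|u v w wE]; last by rewrite /chi wE scalingM wtsM.
apply/prodf_neq0 => l _; have z0 : sc (val u) l.1 != 0 by rewrite fmorph_eq0 val_neq0.
by rewrite /wt; case: ifP => _; case: ifP => _; rewrite ?oner_neq0 // fmorph_eq0.
Qed.

Section OneCharacter.
Variable rho : U -> R[i].
Hypothesis rhoc : @characters R K U rho.

Let rho0 u : rho u != 0. Proof. exact: rhoc.1. Qed.

Lemma character1 u : val u = 1 -> rho u = 1.
Proof.
move=> u1; apply: (mulfI (rho0 u)); rewrite mulr1; apply/esym/rhoc.2.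
by rewrite u1 mulr1.
Qed.

Definition fixed_by a u : Prop := tw (sc (val u)) (rho u) a = a.

Lemma fixed_by1 a u : val u = 1 -> fixed_by a u.
Proof. by move=> u1; rewrite /fixed_by (character1 u1) u1 scaling1 tw1. Qed.

Lemma fixed_byM a u v w : val w = val u * val v -> fixed_by a u -> fixed_by a v -> fixed_by a w.
Proof.
move=> wE ua va; rewrite /fixed_by wE (rhoc.2 u v w wE) scalingM.
by rewrite twM ?va ?ua//; exact: scaling_unit_pos.
Qed.

Lemma fixed_byV a u w : val w = (val u)^-1 -> fixed_by a u -> fixed_by a w.
Proof.
move=> wE ua; have e1 : val (unit_elt unit_one) = val w * val u by rewrite wE mulVf ?val_neq0.
rewrite /fixed_by -{1}ua -twM; [|exact: scaling_unit_pos..].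
by rewrite -scalingM -e1 -(rhoc.2 w u _ e1); exact: fixed_by1.
Qed.

(** Provides the data of the abstract argument from the number field and converts conditions at the
    generators into conditions on all of U. *)
Lemma cohomology_OT k :
  (forall a, (forall T, Kd a T = 0) -> equivariant sigma rho a -> deg k a ->
     exists (c : {set I} -> R[i]) b, (forall T, c T != 0 -> #|T| = k /\ chi T = rho) /\
       [/\ equivariant sigma rho b, degS k b & forall T, a T = ccst E (c T) + Kd b T]) /\
  (forall (c : {set I} -> R[i]) b, equivariant sigma rho b -> (forall T, c T != 0 -> chi T = rho) ->
     (forall T, ccst E (c T) = Kd b T) -> forall T, c T = 0).
Proof.
have [g gO gE] := integral_generator K.
have [u0 [B [Bu Uu0 lgu Uind]]] := unit_basis s0 hsigma hU.
pose u j : U := unit_elt (Uu0 j).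
have Uind' (Q : U -> Prop) : (forall w, val w = 1 -> Q w) ->
    (forall x y w, val w = val x * val y -> Q x -> Q y -> Q w) ->
    (forall x w, val w = (val x)^-1 -> Q x -> Q w) -> (forall j, Q (u j)) -> forall w, Q w.
  move=> Q1 QM QV Qu w; have := set_valP w.
  suff H x : U x -> forall w, val w = x -> Q w by move=> /H; exact.
  move=> Ux; apply: (Uind (fun x => forall w, val w = x -> Q w)) Ux => //.
  - move=> y z Uy Uz Qy Qz v vE.
    by apply: (QM (unit_elt Uy) (unit_elt Uz)) => //; [exact: Qy|exact: Qz].
  - by move=> y Uy Qy v vE; apply: (QV (unit_elt Uy)) => //; exact: Qy.
  - by move=> j v vE; rewrite (_ : v = u j)//; exact: val_inj.
pose zs j := sc (val (u j)); pose rs j := rho (u j).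
have inv_eq a : (forall j, inv zs rs j a) <-> forall w, fixed_by a w.
  split=> [H|H j]; last exact: H.
  apply: Uind'; [exact: fixed_by1|exact: fixed_byM|exact: fixed_byV|exact: H].
have chi_eq T : (forall j, wts (zs j) T = rs j) -> chi T = rho.
  move=> H; apply/funext; apply: Uind' => //.
  - by move=> w w1; rewrite character1// /chi w1 scaling1 wts1.
  - move=> x y w wE Qx Qy; rewrite (rhoc.2 x y w wE) -Qx -Qy.
    by rewrite /chi wE scalingM wtsM.
  - move=> x w wE Qx; have e1 : val (unit_elt unit_one) = val w * val x by rewrite wE mulVf ?val_neq0.
    apply: (mulIf (rho0 x)); rewrite -(rhoc.2 w x _ e1) -Qx /chi -wtsM -scalingM -e1 character1//.
    by rewrite scaling1 wts1.
have zpos j : positive_scale (zs j) by exact: scaling_unit_pos.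
have z0 j i : zs j i != 0 by rewrite fmorph_eq0 val_neq0.
have r0 j : rs j != 0 by exact: rho0.
pose L := integer_lattice sigma.
have Lvert : L `<=` @vert R s t := integer_lattice_vert hsigma.
have [_ [U1 UM UV] _ _] := hU.
have UX x (m : int) : U x -> U (x ^ m).
  move=> Ux; have UXn n : U (x ^+ n) by elim: n => [|n IH]; rewrite ?expr0 ?exprS//; exact: UM.
  by case: m => n; [exact: UXn|exact/UV/UXn].
have Lstab j m v : L v -> L (log_lin (zpow zs j m) v).
  move=> [x xO <-]; rewrite (log_lin_scaling hsigma (x := u0 j ^ m)).
    exists (u0 j ^ m * x) => //; apply: ring_of_integersM => //.
    by have [[]] := Up (UX _ m (Uu0 j)).
  by move=> i; rewrite /zpow /scaling fmorphXz.
pose es := [seq of_ccoord (sc (g ^+ j)) | j : 'I_(s + t + t) <- enum 'I_(s + t + t)].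
have esL e : e \in es -> L e.
  by move=> /mapP[j _ ->]; exists (g ^+ j) => //; exact: ring_of_integersX.
have esspan : spans es (@vert R s t).
  by apply: spans_map => v vv; exact: (real_span hsigma gE vv).
have esspan' j : spans [seq log_lin (zs j) e | e <- es] (@vert R s t).
  rewrite /es -map_comp; apply: spans_map => v vv.
  have UVj : U (u0 j)^-1 by exact: UV.
  have zV i : zs j i * sc (val (unit_elt UVj)) i = 1.
    by rewrite -rmorphM mulfV ?rmorph1 ?(val_neq0 (u j)).
  have vv' : vert (log_lin (sc (val (unit_elt UVj))) v) by move=> i si; rewrite mxE si /= vv.
  have [c cE] := real_span hsigma gE vv'.
  exists c; rewrite -{1}(log_linK (zpos j) (scaling_unit_pos (unit_elt UVj)) zV vv) cE.
  have ls (J : Type) (r : seq J) (d : J -> R) (f : J -> E) :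
      log_lin (zs j) (\sum_(i <- r) d i *: f i) = \sum_(i <- r) d i *: log_lin (zs j) (f i).
    have l0 : log_lin (zs j) 0 = 0 :> E.
      by have := log_lin_linear (zs j) (-1) 0 0; rewrite scaler0 addr0 scaleN1r addNr.
    by elim: r => [|i r IH]; rewrite ?big_nil ?big_cons ?log_lin_linear ?IH.
  exact: ls.
(* The row of c-coordinates times the inverse of [B], that is, coordinates in the basis of
   logarithms of the generators. *)
pose ll j (v : E) := \sum_(i < s) v (lshift t i) 1 * invmx B i j.
have lcont j : continuous (ll j).
  move=> x; apply: (@sm_cont _ _ setT) => //; apply: sm_sum => [|i _]; first exact: openT.
  by apply: smM (sm_cst _ _); [exact: openT|apply: sm_coord; exact: openT|exact: openT].
have llin j (h : R) v x : ll j (h *: v + x) = h * ll j v + ll j x.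
  rewrite mulr_sumr -big_split; apply: eq_bigr => i _ /=.
  by rewrite !mxE mulrDl mulrA.
have lvert j v : vert v -> ll j v = 0.
  by move=> vv; apply: big1 => i _; rewrite (vv (lshift t i) (ltn_ord i)) mul0r.
have lvE m (i : 'I_s) : log_vec (zs m) (lshift t i) 1 = B m i.
  rewrite mxE /isc /= ltn_ord /=; have := congr1 (fun r : 'rV_s => r 0 i) (lgu m).
  by rewrite !mxE.
have llog j m : ll j (log_vec (zs m)) = (j == m)%:R.
  have := congr1 (fun A : 'M[R]_s => A m j) (mulmxV Bu); rewrite !mxE eq_sym => <-.
  by apply: eq_bigr => i _; rewrite lvE.
have cspan v : cvec v -> v = \sum_m ll m v *: log_vec (zs m).
  move=> cv; apply/matrixP => i j; rewrite summxE.
  have [ij|ij] := boolP (isc (i, j)); last first.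
    by rewrite cv// big1// => m _; rewrite mxE cvec_log_vec// mulr0.
  have /andP[/= si /eqP j1] := ij; rewrite j1.
  have -> : i = lshift t (Ordinal si) by exact: val_inj.
  under eq_bigr do rewrite mxE lvE mulr_suml.
  rewrite exchange_big /= (bigD1 (Ordinal si))//= [X in _ + X]big1 ?addr0 => [|i' i'i].
    under eq_bigr do rewrite -mulrA; rewrite -mulr_sumr.
    have := congr1 (fun A : 'M[R]_s => A (Ordinal si) (Ordinal si)) (mulVmx Bu).
    by rewrite !mxE eqxx => ->; rewrite mulr1.
  under eq_bigr do rewrite -mulrA; rewrite -mulr_sumr.
  have := congr1 (fun A : 'M[R]_s => A i' (Ordinal si)) (mulVmx Bu).
  by rewrite !mxE (negbTE i'i) => ->; rewrite mulr0.
split.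
  move=> a a0 [La /inv_eq ja] da.
  have [c [b [cP [Lb jb db Eab]]]] := @cohomology_upper R s t L es zs rs ll zpos z0 r0 Lvert Lstab
    esL esspan esspan' lcont llin lvert llog cspan k a a0 La ja da.
  exists c, b; split.
    by move=> T /cP[Tk /chi_eq].
  by split=> //; split=> //; exact/inv_eq.
move=> c b [Lb /inv_eq jb] cP.
apply: (@cohomology_lower R s t L es zs rs ll z0 r0 Lvert Lstab esL esspan esspan' cspan c b Lb jb).
by move=> T /cP H j; rewrite /rs -H.
Qed.

End OneCharacter.
End Characters.

(** * Cohomology of the flat bundles *)

Section DimCohomology.
Local Open Scope complex_scope.
Variables (R : realType) (s t : nat) (K : fieldExtType rat).
Variables (sigma : 'I_(s + t + t) -> {rmorphism K -> R[i]}) (U : set K).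
Variable l0 : 'I_(s + t) * 'I_2.
Hypothesis s0 : (0 < s)%N.
Hypothesis hsigma : embeddings_of_signature sigma.
Hypothesis hU : OT_admissible sigma U.
Local Notation E := 'M[R]_(s + t, 2).
Local Notation I := ('I_(s + t) * 'I_2)%type.
Local Notation W := (@OT_cover R s t).
Variable rho : U -> R[i].
Hypothesis rhoc : @characters R K U rho.
Implicit Types (T : {set I}) (a b : {set I} -> cinf E) (k : nat) (c e : {set I} -> R[i]).
Local Notation equiv := (equivariant sigma rho).

Let Up : U `<=` positive_units sigma. Proof. by case: hU. Qed.
Let rho0 u : rho u != 0. Proof. exact: rhoc.1. Qed.
Let rho1 : exists2 u : U, val u = 1 & rho u = 1.
Proof. by exists (unit_elt (unit_one hU)) => //; exact: character1. Qed.

Lemma equivariantP (r : R[i]) a b : equiv a -> equiv b -> equiv (fun T => r *: a T + b T).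
Proof.
move=> [La ta] [Lb tb]; split; first by move=> T; apply: invarD; [exact: invarZ|].
move=> u; apply/funext => T; rewrite -[in RHS](ta u) -[in RHS](tb u) /tw linearP scalerDr.
by rewrite !scalerA mulrC.
Qed.

Lemma equivariant0 : equiv (fun=> 0).
Proof. by split=> [T|u]; [exact: invar0|apply/funext => T; rewrite /tw linear0 scaler0]. Qed.

Lemma log_form_lin k (r : R[i]) a b :
  log_form l0 k (fun T => r *: a T + b T) = r *: log_form l0 k a + log_form l0 k b.
Proof. by apply/funext => q; apply/funext => v; exact: log_formP. Qed.

Lemma log_form0 k : log_form l0 k (fun=> 0) = 0 :> dform E k.
Proof.
apply/funext => q; apply/funext => v; apply: big1 => T _.
by rewrite [X in _ * X * _](_ : _ = 0)// mulr0 mul0r.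
Qed.

Lemma exterior_d_ext k (w w' : dform E k) : eq_on_cover w w' ->
  eq_on_cover (exterior_d w) (exterior_d w').
Proof.
move=> ww q Wq; apply/funext => v; apply: eq_bigr => i _; congr (_ * _).
by apply: (cderive_open _ (@open_cover R s t) Wq) => y Wy; rewrite ww.
Qed.

Lemma exterior_d_eq k (w : dform E k) a : eq_on_cover w (log_form l0 k a) ->
  eq_on_cover (exterior_d w) (log_form l0 k.+1 (Kd a)).
Proof.
move=> wa q Wq; rewrite (exterior_d_ext wa Wq); apply/funext => v.
exact: exterior_d_log_form.
Qed.

Lemma bundle_formP k (w : dform E k) : bundle_form sigma rho w ->
  exists a, [/\ equiv a, deg k a & eq_on_cover w (log_form l0 k a)].
Proof.
move=> bw; have [a [da wa]] := log_form_onto l0 bw.1; exists a; split=> //.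
by apply: (bundle_log_form (l0 := l0) hsigma Up rho0 rho1 da); exact: (bundle_form_ext hsigma Up wa).
Qed.

(** One description for all degrees: in degree 0 [degS] forces [b = 0], which matches the convention
    that only 0 is exact. *)
Lemma exact_formP k (w : dform E k) : exact_form sigma rho w <->
  exists b, [/\ equiv b, degS k b & eq_on_cover w (log_form l0 k (Kd b))].
Proof.
case: k w => [|k] w; split.
- move=> w0; exists (fun=> 0); split=> //; first exact: equivariant0.
  move=> q Wq; rewrite w0// (_ : Kd _ = fun=> 0) ?log_form0//.
  by apply/funext => T; exact: kd0.
- move=> [b [_ db wb]] q Wq; rewrite wb// (_ : Kd b = fun=> 0) ?log_form0//.
  rewrite (_ : b = fun=> 0); first by apply/funext => T; exact: kd0.
  by apply/funext => T; exact: db.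
- move=> [e be we]; have [b [eb db eE]] := bundle_formP be; exists b; split=> //.
    by move=> T Tk; apply: db => H; apply: Tk; rewrite H.
  by move=> q Wq; rewrite we// (exterior_d_eq eE Wq).
- move=> [b [eb db wb]]; exists (log_form l0 k b); first exact: log_form_bundle.
  by move=> q Wq; rewrite wb//; apply/esym; exact: (exterior_d_eq (a := b)).
Qed.

Lemma closed_formP k (w : dform E k) : closed_form sigma rho w ->
  exists a, [/\ equiv a, deg k a, eq_on_cover w (log_form l0 k a) & forall T, Kd a T = 0].
Proof.
move=> [bw dw]; have [a [ea da wa]] := bundle_formP bw; exists a; split=> // T.
have [Tk|Tk] := eqVneq #|T| k.+1; last first.
  apply: (@deg_kd R s t k.+1) => [S Sk|]; last exact/eqP.
  by apply: da => H; apply: Sk; rewrite H.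
apply: (@log_form_inj R s t l0 k.+1 (Kd a) (fun=> 0) T) => // q v Wq.
by rewrite -(exterior_d_eq wa Wq) dw// log_form0.
Qed.

Definition const_form k c : dform E k := log_form l0 k (fun T => ccst E (c T)).

Arguments const_form k c : clear implicits.

Lemma const_form_lin k (r : R[i]) c e :
  const_form k (fun T => r * c T + e T) = r *: const_form k c + const_form k e.
Proof. by rewrite -log_form_lin; congr log_form; apply/funext => T; exact: cinfP. Qed.

Lemma const_form_sum k (J : finType) (r : J -> R[i]) (c : J -> {set I} -> R[i]) :
  \sum_j r j *: const_form k (c j) = const_form k (fun T => \sum_j r j * c j T).
Proof.
elim: (index_enum J) => [|j js IH].
  rewrite big_nil -log_form0; congr log_form; apply/funext => T.
  by rewrite big_nil; exact: cinfP.
rewrite big_cons IH -const_form_lin; congr const_form; apply/funext => T.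
by rewrite big_cons.
Qed.

Lemma equivariant_const c : (forall T, c T != 0 -> chi sigma T = rho) ->
  equiv (fun T => ccst E (c T)).
Proof.
move=> cP; split=> [T v _ x//|u]; apply/funext => T; apply: cinfP => p.
transitivity ((rho u)^-1 * chi sigma T u * c T); first by [].
have [->|/cP ->] := eqVneq (c T) 0; first by rewrite mulr0.
by rewrite mulVf ?mul1r.
Qed.

Lemma dim_cohomology_count k :
  dim_cohomology sigma rho k =
  (\sum_(T : {set I} | #|T| == k) (if `[< chi sigma T = rho >] then 1 else 0))%:E.
Proof.
pose J : finType := {T : {set I} | (#|T| == k) && `[< chi sigma T = rho >]}.
have -> : \sum_(T : {set I} | #|T| == k) (if `[< chi sigma T = rho >] then 1 else 0) = #|J|%:R :> R.
  by rewrite -big_mkcondr card_sig -sum1_card natr_sum.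
have [up low] := cohomology_OT s0 hsigma hU rhoc k.
(* These constant forms are the basis of the cohomology: [up] gives spanning, [low] independence. *)
pose w (j : J) : dform E k := const_form k (fun T => (T == val j)%:R).
have wP (j : J) T : (T == val j)%:R != 0 :> R[i] -> chi sigma T = rho.
  by case: (T =P val j) => [-> _|_]; [case: j => S /= /andP[_ /asboolP]|rewrite eqxx].
rewrite /dim_cohomology; apply: (@dim_quot_basis R _ _ _ _ J w).
- move=> r x y /exact_formP[b [eb db xb]] /exact_formP[b' [eb' db' yb']].
  apply/exact_formP; exists (fun T => r *: b T + b' T); split; first exact: equivariantP.
    by move=> T Tk; rewrite db// db'// scaler0 addr0.
  have -> : Kd (fun T => r *: b T + b' T) = (fun T => r *: Kd b T + Kd b' T).
    by apply/funext => T; rewrite (kdD (fun T => r *: b T)) kdZ.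
  by move=> q Wq; rewrite log_form_lin -[LHS]/(r *: x q + y q) xb// yb'.
- apply/exact_formP; exists (fun=> 0); split=> //; first exact: equivariant0.
  by rewrite (_ : Kd _ = fun=> 0) ?log_form0//; apply/funext => T; exact: kd0.
- move=> j; split; first by apply: log_form_bundle => //; apply: equivariant_const; exact: wP.
  move=> q Wq; rewrite (exterior_d_eq (a := fun T => ccst E (T == val j)%:R) _ Wq)//.
  rewrite (_ : Kd _ = fun=> 0) ?log_form0//; apply/funext => T.
  by apply: big1 => l _; rewrite [X in _ *: X](_ : _ = 0) ?scaler0//; exact: frameD_ccst.
- move=> z /closed_formP[a [ea da za Ka]].
  have [c [b [cP [eb db Eab]]]] := up a Ka ea da.
  exists (fun j => c (val j)); apply/exact_formP; exists b; split=> // q Wq.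
  rewrite /w const_form_sum.
  have -> : const_form k (fun T => \sum_(j : J) c (val j) * (T == val j)%:R) = const_form k c.
    apply: log_form_ext => T Tk; congr ccst.
    have [cT|cT] := eqVneq (c T) 0.
      rewrite cT; apply: big1 => j _; case: eqP => [<-|_]; last by rewrite mulr0.
      by rewrite cT mul0r.
    have Tj : (#|T| == k) && `[< chi sigma T = rho >].
      by rewrite Tk eqxx; apply/asboolP; case: (cP T cT).
    rewrite (bigD1 (exist _ T Tj : J))//= eqxx mulr1 big1 ?addr0// => j jT.
    case: eqP => [Tv|_]; last by rewrite mulr0.
    by case/eqP: jT; apply: val_inj.
  rewrite -[LHS]/(z q - const_form k c q) za//.
  have -> : log_form l0 k a = const_form k c + log_form l0 k (Kd b).
    rewrite -[const_form k c]scale1r -log_form_lin; apply: log_form_ext => T _.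
    by rewrite scale1r.
  by rewrite -[_ q]/(const_form k c q + log_form l0 k (Kd b) q) addrC addKr.
move=> c; rewrite const_form_sum => /exact_formP[b [eb db cb]] j.
(* [low] asks for the equation at every [T], whereas a k-form sees only sets of size k; the
   coefficients are therefore cut off. *)
pose c' T := if #|T| == k then \sum_j c j * (T == val j)%:R else 0.
have jk (i : J) : #|val i| = k by case: i => S /= /andP[/eqP].
have c'P T : c' T != 0 -> chi sigma T = rho.
  rewrite /c'; case: (#|T| =P k) => [_|_]; last by rewrite eqxx.
  move=> H; apply/asboolP; apply: contraNT H => nT; apply/eqP/big1 => i _.
  case: eqP => [Ti|_]; last by rewrite mulr0.
  by case/negP: nT; rewrite {}Ti; case: i => S /= /andP[].
have bk T : ccst E (c' T) = Kd b T.
  rewrite /c'; case: eqP => [Tk|Tk]; last by rewrite (deg_kd db Tk); exact: cinfP.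
  apply: (@log_form_inj R s t l0 k (fun T => ccst E (\sum_j c j * (T == val j)%:R)) (Kd b) T) => //.
  by move=> q v Wq; rewrite -[LHS]/(const_form k _ q v) cb.
have := low c' b eb c'P bk (val j); rewrite /c' jk eqxx (bigD1 j)//= eqxx mulr1 big1 ?addr0// => i ij.
by rewrite (inj_eq val_inj) eq_sym (negbTE ij) mulr0.
Qed.

End DimCohomology.

(** Applied with x = chi_T: the sum over all characters counts each [T] exactly once. *)
Lemma esum_indicator (R : realType) (C : choiceType) (D : set C) (x : C) : D x ->
  \esum_(y in D) (if `[< x = y >] then 1 else 0 : R)%:E = 1%E.
Proof.
move=> Dx; rewrite -[RHS](@esum_set1 R C x (fun=> 1%E)) ?lee01//.
have -> : [set x] = D `&` [set x] by apply/seteqP; split=> [y ->|y []].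
rewrite esum_mkcondr; apply: eq_esum => y _.
case: asboolP => [<-|ne]; first by rewrite mem_set.
by rewrite memNset// => /esym.
Qed.

Theorem proposition1p1 (R : realType) (s t : nat)
    (hs : (1 <= s)%N) (ht : (1 <= t)%N) (K : fieldExtType rat)
    (sigma : 'I_(s + t + t) -> {rmorphism K -> R[i]})
    (hsigma : embeddings_of_signature sigma)
    (U : set K) (hU : OT_admissible sigma U) (r : int) :
  dim_exterior R R[i] (2 * s + 2 * t) r =
  \esum_(rho in @characters R K U) dim_cohomology sigma rho r.
Proof.
case: r => k; last by rewrite esum1.
(* [i0] and [n0] only provide the default indices for sorting. *)
have i0 : 'I_(s + t) by apply: (@Ordinal _ 0); rewrite addn_gt0 hs.
have n0 : (0 < 2 * s + 2 * t)%N by rewrite addn_gt0 muln_gt0 hs.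
rewrite /dim_exterior (dim_quot_exterior _ _ (Ordinal n0)).
under eq_esum => rho rhoc do rewrite (dim_cohomology_count (i0, 0) hs hsigma hU rhoc) -sumEFin.
(* The terms are non-negative, so the sums over characters and over [T] can be exchanged. *)
rewrite esum_sum => [|rho T _ _]; last by case: ifP; rewrite lee_fin ?ler01.
under eq_bigr do rewrite (esum_indicator R (chi_character hs hsigma hU _)).
rewrite sumEFin; congr (_%:E).
have -> : (2 * s + 2 * t)%N = #|{: 'I_(s + t) * 'I_2}| by rewrite card_prod !card_ord -mulnDr mulnC.
rewrite -card_draws -sum1_card natr_sum; apply: eq_bigl => T.
by rewrite finset.inE.
Qed.
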